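(* Let $R$ be an invertible $d\times d$ matrix with real entries, let $M=R\mathbb{Z}^d$ be the lattice generated by the columns of $R$, and let $E\subset\mathbb{R}^d$ be a finite set with $|E|$ elements. Let $I^d=[0,1)^d$ and $$\mathbf{Z}_{I^d}=\{z\in\mathbb{R}^d\setminus\{0\}:\exists j\in\{1,\dots,d\}\text{ with }z_j\in\mathbb{Z}\setminus\{0\}\}.$$ If $M\cap(E-E)=\{0\}$, then the following are equivalent: (1) $(I^d,M+E)$ is a spectral pair; (2) $I^d$ is an $(M+E)$-tile; (3) $|E|=|\det R|$ and $M+(E-E)\subset\mathbf{Z}_{I^d}\cup\{0\}$.
   Context: For a measurable set $\Omega\subset\mathbb{R}^d$ of finite positive Lebesgue measure and a set $\Lambda\subset\mathbb{R}^d$, $(\Omega,\Lambda)$ is called a spectral pair if the exponentials $e_\lambda(x)=e^{i2\pi\lambda\cdot x}$, $\lambda\in\Lambda$, form an orthogonal basis of $\mathcal{L}^2(\Omega)$. For $T\subset\mathbb{R}^d$, $\Omega$ is a $T$-tile if the translates $\Omega+t$, $t\in T$, cover $\mathbb{R}^d$ up to a null set and distinct translates intersect in Lebesgue-null sets. $A+B=\{a+b:a\in A,b\in B\}$, $A-B=\{a-b:a\in A,b\in B\}$. *)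

(* Defs.v *)
From HB Require Import structures.
From mathcomp Require Import all_boot all_order all_algebra.
From mathcomp Require Import all_classical all_reals all_analysis.
Set Implicit Arguments. Unset Strict Implicit. Unset Printing Implicit Defensive.
Import Order.TTheory GRing.Theory Num.Theory.
Local Open Scope classical_set_scope.
Local Open Scope ring_scope.

Definition cv_display : measure_display -> measure_display.
Proof. exact. Qed.

(* Type alias for R^d carrying the Borel sigma-algebra; it inherits the
   algebraic/topological structures of column vectors. *)
Definition vec (R : realType) (d : nat) := 'cV[R]_d.
HB.instance Definition _ (R : realType) d := GRing.Lmodule.on (vec R d).
HB.instance Definition _ (R : realType) d := isPointed.Build (vec R d) 0.

Definition cv_coord (R : realType) (d : nat) (i : 'I_d) (x : vec R d) : R :=
  x i 0.

Section cv_measurable.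
Context (R : realType) (d : nat).
Local Notation G := (g_sigma_preimage (@cv_coord R d)).
Let G0 : G set0. Proof. move=> X [[X0 _ _] _]; exact: X0. Qed.
Let GC A : G A -> G (~` A). Proof.
move=> GA X [sX sub]; have GAX := GA X (conj sX sub).
case: sX => _ XC _; rewrite -setTD; exact: XC.
Qed.
Let GU (F : (set (vec R d))^nat) : (forall i, G (F i)) -> G (\bigcup_i F i).
Proof. exact: (@sigma_algebra_bigcup _ setT). Qed.
HB.instance Definition _ := @isMeasurable.Build (cv_display default_measure_display)
  (vec R d) G G0 GC GU.
End cv_measurable.

Section defs.
Context (R : realType) (d : nat).
Local Notation V := (vec R d).

Definition box (a b : V) : set V :=
  [set x | forall i : 'I_d, a i 0 <= x i 0 < b i 0].

Definition box_vol (a b : V) : R := \prod_(i < d) Num.max (b i 0 - a i 0) 0.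

(* Lebesgue outer measure: infimum of total volumes of countable (possibly
   finite: indexed by K) coverings by half-open boxes. *)
Definition leb_outer (A : set V) : \bar R :=
  ereal_inf [set s : \bar R | exists (K : set nat) (a b : nat -> V),
    A `<=` \bigcup_(k in K) box (a k) (b k) /\
    s = (\sum_(k <oo | k \in K) (box_vol (a k) (b k))%:E)%E].

Definition null_set (A : set V) : Prop := leb_outer A = 0%E.

Definition sumset (A B : set V) : set V :=
  [set x | exists a b, A a /\ B b /\ x = a + b].
Definition diffset (A B : set V) : set V :=
  [set x | exists a b, A a /\ B b /\ x = a - b].
Definition translate (A : set V) (t : V) : set V := [set x + t | x in A].

Definition Icube : set V := [set x | forall i : 'I_d, 0 <= x i 0 < 1].

Definition lattice (Rm : 'M[R]_d) : set V :=
  [set x | exists k : 'cV[int]_d, x = Rm *m map_mx (fun z : int => z%:~R) k].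

Definition ZI : set V :=
  [set z | z <> 0 /\ exists j : 'I_d, z j 0 \is a Num.int /\ z j 0 <> 0].

Definition is_tile (Om T : set V) : Prop :=
  null_set (~` \bigcup_(t in T) translate Om t) /\
  (forall t t', T t -> T t' -> t <> t' ->
     null_set (translate Om t `&` translate Om t')).

Definition dotv (x y : V) : R := \sum_(i < d) x i 0 * y i 0.

(* e_lam(x) = cos(2 pi lam.x) + i sin(2 pi lam.x) *)
Definition ecos (lam : V) (x : V) : R := cos (2 * pi * dotv lam x).
Definition esin (lam : V) (x : V) : R := sin (2 * pi * dotv lam x).

(* A complex function f = u + i v on Om is in L^2(Om) *)
Definition L2 (Om : set V) (u v : V -> R) : Prop :=
  measurable_fun Om u /\ measurable_fun Om v /\
  (\int[leb_outer]_(x in Om) ((u x) ^+ 2 + (v x) ^+ 2)%:E < +oo)%E.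

(* <f, e_lam> = 0 where f = u + i v, i.e. both the real part
   int (u cos + v sin) and the imaginary part int (v cos - u sin) vanish *)
Definition orth_exp (Om : set V) (u v : V -> R) (lam : V) : Prop :=
  (\int[leb_outer]_(x in Om) (u x * ecos lam x + v x * esin lam x)%:E = 0)%E /\
  (\int[leb_outer]_(x in Om) (v x * ecos lam x - u x * esin lam x)%:E = 0)%E.

(* (Om, Lam) is a spectral pair: {e_lam : lam in Lam} is an orthogonal basis
   of L^2(Om), i.e. an orthogonal family (<e_lam, e_mu> = 0 for lam <> mu)
   which is complete (only f = 0 a.e. is orthogonal to all e_lam). *)
Definition spectral_pair (Om Lam : set V) : Prop :=
  (forall lam mu, Lam lam -> Lam mu -> lam <> mu ->
     orth_exp Om (ecos mu) (esin mu) lam) /\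
  (forall u v : V -> R, L2 Om u v ->
     (forall lam, Lam lam -> orth_exp Om u v lam) ->
     null_set [set x | Om x /\ (u x <> 0 \/ v x <> 0)]).

End defs.

(* Main.v *)
(* Call two points of R^d separated if some coordinate of their difference is a
   nonzero integer.  The exponentials e_p, e_q are orthogonal on I^d exactly when
   p, q are separated, and in a tiling by translates of I^d any two corners are
   separated (Keller).  Let W be the indicator of I^d or the squared modulus
   prod_j sinc(x_j)^2 of its Fourier transform.  Over a separated family L the
   sum of W(x - l) is at most 1 (disjointness, resp. Bessel's inequality); it is
   identically 1 exactly when the cubes cover, resp. when Parseval's identity
   holds for all exponentials, i.e. when the system is complete.  For any such
   W, rounding one coordinate of L up to integers preserves "identically 1",
   because a class of points congruent mod 1 in that coordinate can be shifted
   without affecting the other classes.  After d steps L is a subset of Z^d, for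
   which "identically 1" means L = Z^d.  This criterion does not depend on W,
   whence (1) <=> (2).
   For (2) <=> (3), the cubes at M + E are disjoint exactly when M + E is a
   separated family; they then fill volume |E| of a fundamental domain of M,
   which has volume |det R|. *)
Require Import Defs.
From HB Require Import structures.
From mathcomp Require Import all_boot all_order all_fingroup all_algebra.
From mathcomp Require Import all_classical all_reals all_analysis.
From mathcomp Require Import measurable_realfun.
From mathcomp Require Import ring lra zify.
Import Order.TTheory GRing.Theory Num.Theory.
Import numFieldNormedType.Exports.
Local Open Scope classical_set_scope.
Local Open Scope ring_scope.

Set Implicit Arguments. Unset Strict Implicit. Unset Printing Implicit Defensive.

(** * Packings and column shifts *)

(** The bound by 1 holds for every separated family, and this uniformity turns inequalities into
    equalities: a class may be shifted by any real amount, so a shift that only fails to increase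
    the class sum can be reversed from the shifted point. Orthogonality yields separation at once,
    since the zeros of sinc are the nonzero integers, but disjoint cubes need not be separated.
    Keller's theorem extracts separation from the covering, through whole columns of cubes. It
    argues point by point, so the null sets in the definition of a tile must be removed first;
    half-open cubes permit this, because two that meet share a box and a missed point misses a box.
    Completeness is stated through functions orthogonal to the system. Deducing Parseval's identity
    from it requires producing such a function as an L^2 limit; the converse requires that a
    function orthogonal to the exponentials of all real frequencies be null. Since the measure is an
    infimum over coverings by boxes, the lower bound for the volume of a box and the factor
    [|\det A|] of a linear map both have to be proved. *)

Lemma esum_fibers (R : realType) (I K : choiceType) (X : set I) (s : I -> K)
    (a : I -> \bar R) : (forall i, 0 <= a i)%E ->
  (\esum_(i in X) a i = \esum_(r in [set: K]) \esum_(i in X `&` [set i | s i = r]) a i)%E.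
Proof.
move=> a0; rewrite esum_esum//.
apply: (reindex_esum _ _ snd a); split.
- by move=> [r i] [_ []].
- by move=> [r i] [r' i']; rewrite ?inE/= => -[_ [_ <-]] [_ [_ <-]] /= ->.
- by move=> i Xi; exists (s i, i).
Qed.

Section packing.
Context (R : realType) (d : nat).
Local Notation V := (vec R d).

Definition keller_coord (x y : V) (j : 'I_d) : Prop :=
  x j 0 - y j 0 \is a Num.int /\ x j 0 <> y j 0.

(** Points carry indices so that a family and its shifts are sums over the same index set,
    comparable term by term. *)
Definition keller_family (I : Type) (X : set I) (p : I -> V) : Prop :=
  forall i k, X i -> X k -> i <> k -> exists j, keller_coord (p i) (p k) j.

Definition axis (j : 'I_d) : V := delta_mx j 0.

Lemma axisE (j k : 'I_d) : axis j k 0 = (k == j)%:R.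
Proof. by rewrite /axis mxE eqxx andbT. Qed.

Lemma vecDE (x y : V) k : (x + y) k 0 = x k 0 + y k 0.
Proof. by rewrite mxE. Qed.
Lemma vecNE (x : V) k : (- x) k 0 = - x k 0.
Proof. by rewrite mxE. Qed.
Lemma vecZE (a : R) (x : V) k : (a *: x) k 0 = a * x k 0.
Proof. by rewrite mxE. Qed.
Definition vecE := (vecDE, vecNE, vecZE, axisE).

Lemma vecP (x y : V) : (forall k, x k 0 = y k 0) -> x = y.
Proof. by move=> h; apply/colP => k; rewrite h. Qed.

(* Pairs separated in a coordinate other than [j] may be shifted independently. *)
Definition column_shift (I : Type) (j : 'I_d) (X : set I) (p : I -> V)
    (s : I -> R) : Prop :=
  forall i k, X i -> X k -> i <> k ->
    exists2 l, keller_coord (p i) (p k) l & (l = j -> s i = s k).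

Definition shifted (I : Type) (j : 'I_d) (p : I -> V) (s : I -> R) : I -> V :=
  fun i => p i + s i *: axis j.

Lemma column_shift_keller (I : Type) j (X : set I) p s :
  column_shift j X p s -> keller_family X (shifted j p s).
Proof.
move=> h i k Xi Xk ik; have [l [lint lneq] ls] := h _ _ Xi Xk ik.
exists l; rewrite /keller_coord /shifted !vecE.
have [lj|_] := eqVneq l j; last by rewrite !mulr0 !addr0.
rewrite (ls lj) !mulr1; split; first by rewrite opprD addrACA subrr addr0.
by move=> /addIr.
Qed.

Lemma column_shiftW (I : Type) j (X : set I) p s (g : R -> R) :
  column_shift j X p s -> column_shift j X p (g \o s).
Proof.
move=> h i k Xi Xk ik; have [l ll ls] := h _ _ Xi Xk ik.
by exists l => // lj; rewrite /= (ls lj).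
Qed.

(** Undoing a shift is again a column shift, which makes rounding a reversible operation. *)
Lemma column_shiftN (I : Type) j (X : set I) p s :
  column_shift j X p s -> column_shift j X (shifted j p s) (fun i => - s i).
Proof.
move=> h i k Xi Xk ik; have [l [lint lneq] ls] := h _ _ Xi Xk ik.
exists l; last by move=> /ls ->.
rewrite /keller_coord /shifted !vecE.
have [lj|_] := eqVneq l j; last by rewrite !mulr0 !addr0.
rewrite (ls lj) !mulr1; split; first by rewrite opprD addrACA subrr addr0.
by move=> /addIr.
Qed.

Lemma shiftedN (I : Type) j (p : I -> V) s :
  shifted j (shifted j p s) (fun i => - s i) = p.
Proof.
by apply/funext => i; rewrite /shifted scaleNr addrK.
Qed.

Definition packing (I : choiceType) (W : V -> R) : Prop :=
  (forall x, 0 <= W x) /\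
  forall (X : set I) p, keller_family X p ->
    forall x, (\esum_(i in X) (W (x - p i))%:E <= 1)%E.

Section shift.
Context (I : choiceType) (W : V -> R) (j : 'I_d) (X : set I).
Hypothesis packW : packing I W.
Let W0 := packW.1.
Let WE0 x : (0 <= (W x)%:E)%E.
Proof. by rewrite lee_fin W0. Qed.

(* Shifting the class [r] alone keeps the total at most 1, and the other classes
   already account for 1 minus the original contribution of [r]. *)
Lemma class_sum_le p s r t :
  column_shift j X p s ->
  (forall x, (\esum_(i in X) (W (x - p i))%:E = 1)%E) ->
  forall x, (\esum_(i in X `&` [set i | s i = r]) (W (x - t *: axis j - p i))%:E <=
    \esum_(i in X `&` [set i | s i = r]) (W (x - p i))%:E)%E.
Proof.
move=> cs h1 x; pose B := [set i | s i = r].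
pose q := shifted j p ((fun a => if a == r then t else 0) \o s).
have kq : keller_family X q.
  by apply: column_shift_keller; apply: column_shiftW cs.
have := (packW.2 _ _ kq x); rewrite -[leRHS](h1 x).
rewrite (esumID B) 1?[leRHS](esumID B); [|by move=> *; exact: WE0..].
have -> : (\esum_(i in X `&` B) (W (x - q i))%:E =
    \esum_(i in X `&` B) (W (x - t *: axis j - p i))%:E)%E.
  apply: eq_esum => i [_ Bi]; rewrite /q /shifted /= Bi eqxx opprD.
  by rewrite (addrC (- p i)) addrA.
have -> : (\esum_(i in X `&` ~` B) (W (x - q i))%:E =
    \esum_(i in X `&` ~` B) (W (x - p i))%:E)%E.
  apply: eq_esum => i [_ Bi]; rewrite /q /shifted /=.
  by case: eqP => // _; rewrite scale0r addr0.
(* The sum over the other classes can be cancelled because it is finite, being part of a sum equal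
   to 1. *)
rewrite leeD2rE//.
rewrite ge0_fin_numE; last by apply: esum_ge0 => i _; exact: WE0.
apply: (@le_lt_trans _ _ 1%E); last by rewrite ltry.
rewrite -(h1 x) [leRHS](esumID B); last by move=> *; exact: WE0.
by rewrite leeDr// esum_ge0// => i _; exact: WE0.
Qed.

(** Classes of equal shift are treated one at a time. [class_sum_le] holds at every point and for
    every amount; used with [- r] at the point [x - r *: axis j] it gives the reverse inequality. *)
Lemma shifted_sum p s :
  column_shift j X p s ->
  (forall x, (\esum_(i in X) (W (x - p i))%:E = 1)%E) ->
  forall x, (\esum_(i in X) (W (x - shifted j p s i))%:E = 1)%E.
Proof.
move=> cs h1 x; rewrite -(h1 x).
rewrite [LHS](@esum_fibers R _ _ X s); last by move=> *; exact: WE0.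
rewrite [RHS](@esum_fibers R _ _ X s); last by move=> *; exact: WE0.
apply: eq_esum => r _.
transitivity (\esum_(i in X `&` [set i | s i = r]) (W (x - r *: axis j - p i))%:E)%E.
  apply: eq_esum => i [_ /= <-]; rewrite /shifted opprD.
  by rewrite (addrC (- p i)) addrA.
apply/le_anti/andP; split; first exact: class_sum_le.
have := @class_sum_le p s r (- r) cs h1 (x - r *: axis j).
by rewrite scaleNr opprK subrK.
Qed.

End shift.
End packing.

(** * Rounding a separated family up to integer points *)

Section straighten.
Context (R : realType) (d : nat).
Local Notation V := (vec R d).

Definition intv (k : 'cV[int]_d) : V := map_mx (fun z : int => z%:~R) k.

Lemma intvE k j : intv k j 0 = (k j 0)%:~R.
Proof. by rewrite mxE. Qed.

Definition ceilv (x : V) : 'cV[int]_d := \col_j Num.ceil (x j 0).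

Definition ceil_upto (n : nat) (x : V) : V :=
  \col_j (if (j < n)%N then (Num.ceil (x j 0))%:~R else x j 0).

Lemma ceil_sub_int (x y : R) : x - y \is a Num.int ->
  (Num.ceil x)%:~R - (Num.ceil y)%:~R = x - y.
Proof.
move=> /intrP[z xy]; have -> : x = z%:~R + y by rewrite -xy subrK.
by rewrite ceilDzr ?intr_int// intrKceil intrD; lra.
Qed.

Lemma keller_ceilv (X : set V) : keller_family X id -> set_inj X ceilv.
Proof.
move=> kX x y; rewrite !inE => Xx Xy cxy; apply: contrapT => xy.
have [j [jint]] := kX _ _ Xx Xy xy; apply => /=.
apply/eqP; rewrite -subr_eq0 -ceil_sub_int//.
by have /colP/(_ j) := cxy; rewrite !mxE => ->; rewrite subrr.
Qed.

Lemma ceil_upto0 x : ceil_upto 0 x = x.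
Proof. by apply: vecP => k; rewrite mxE. Qed.

Lemma ceil_uptoT x : ceil_upto d x = intv (ceilv x).
Proof. by apply: vecP => k; rewrite !mxE ltn_ord. Qed.

Let ceil_shift (j : 'I_d) (x : V) : R := (Num.ceil (x j 0))%:~R - x j 0.

Lemma ceil_uptoS (j : 'I_d) : ceil_upto j.+1 = shifted j (ceil_upto j) (ceil_shift j).
Proof.
apply/funext => x; apply: vecP => k; rewrite /shifted !vecE !mxE ltnS leq_eqVlt.
have [->|kj] := eqVneq k j; first by rewrite eqxx ltnn/= mulr1 /ceil_shift addrC subrK.
by rewrite mulr0 addr0 (_ : (_ == _ :> nat) = false)//; apply/negbTE.
Qed.

(** Rounding keeps integer differences, so every separating coordinate survives. If that coordinate
    is [j] itself, the two points have the same fractional part there and are rounded by the same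
    amount. *)
Lemma ceil_upto_column_shift (X : set V) (j : 'I_d) : keller_family X id ->
  column_shift j X (ceil_upto j) (ceil_shift j).
Proof.
move=> kX x y Xx Xy xy; have [l [lint lneq]] := kX _ _ Xx Xy xy.
have E : ceil_upto j x l 0 - ceil_upto j y l 0 = x l 0 - y l 0.
  by rewrite !mxE; case: ifP => // _; rewrite ceil_sub_int.
exists l; first split; first by rewrite E.
  by move=> /eqP; rewrite -subr_eq0 E subr_eq0 => /eqP.
move=> <-; have := ceil_sub_int lint; rewrite /ceil_shift; lra.
Qed.

Lemma ceil_sum (W : V -> R) (X : set V) : packing V W -> keller_family X id ->
  (forall x, (\esum_(i in X) (W (x - i))%:E = 1)%E) <->
  (forall x, (\esum_(i in X) (W (x - intv (ceilv i)))%:E = 1)%E).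
Proof.
move=> pW kX.
pose S n := forall x, (\esum_(i in X) (W (x - ceil_upto n i))%:E = 1)%E.
suff SE : S 0%N <-> S d.
  have h0 : @ceil_upto 0 = id by apply/funext => i; exact: ceil_upto0.
  have hd : ceil_upto d = intv \o ceilv by apply/funext => i; exact: ceil_uptoT.
  by move: SE; rewrite /S h0 hd.
have step n : (n <= d)%N -> S 0%N <-> S n.
  elim: n => // n IH nd; rewrite (IH (ltnW nd)).
  have cs := @ceil_upto_column_shift X (Ordinal nd) kX.
  split=> h.
    rewrite /S (ceil_uptoS (Ordinal nd)); exact: (shifted_sum pW cs).
  (* The converse undoes the rounding of this coordinate by the opposite column shift. *)
  rewrite /S -[ceil_upto n](shiftedN (Ordinal nd) _ (ceil_shift (Ordinal nd))).
  rewrite -[shifted _ (ceil_upto n) _](ceil_uptoS (Ordinal nd)).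
  apply: (shifted_sum pW _ h).
  by rewrite (ceil_uptoS (Ordinal nd)); exact: column_shiftN.
exact: step.
Qed.

Lemma packing_sum1P (W : V -> R) (X : set V) : packing V W -> keller_family X id ->
  0 < W 0 ->
  (forall x, (\esum_(k in [set: 'cV[int]_d]) (W (x - intv k))%:E = 1)%E) ->
  (forall x, (\esum_(i in X) (W (x - i))%:E = 1)%E) <->
  (forall k, exists2 i, X i & ceilv i = k).
Proof.
move=> pW kX W0 WZ; rewrite (ceil_sum pW kX).
have W0E x : (0 <= (W x)%:E)%E by rewrite lee_fin pW.1.
have E x : (\esum_(i in X) (W (x - intv (ceilv i)))%:E =
    \esum_(k in ceilv @` X) (W (x - intv k))%:E)%E.
  by rewrite esum_image//; exact: keller_ceilv.
split=> [h k|h x]; last first.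
  by rewrite E (_ : _ @` _ = setT)//; apply/seteqP; split=> // k _; exact: h.
apply: contrapT => nk.
(* At a missed lattice point [k], the image of [X] already contributes 1, and the term of [k] in the
   full lattice sum would add [W 0 > 0] to it. *)
have : (\esum_(k' in ceilv @` X) (W (intv k - intv k'))%:E +
    \esum_(k' in [set k]) (W (intv k - intv k'))%:E <= 1)%E.
  rewrite -[leRHS](WZ (intv k)) [leRHS](esumID [set k]) // addeC leeD//.
    by rewrite setTI.
  rewrite setTI esum_mkcond [leRHS]esum_mkcond; apply: le_esum => k' _.
  case: ifPn => [|_]; last by case: ifP.
  rewrite inE => -[i Xi <-]; rewrite ifT// inE => /= ik.
  by apply: nk; exists i.
rewrite -E h esum_set1// subrr -[leRHS]adde0 leeD2lE// lee_fin.
by rewrite leNgt W0.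
Qed.

End straighten.

(** * Keller's theorem *)

Section tile.
Context (R : realType) (d : nat).
Local Notation V := (vec R d).

(** Every point lies in exactly one cube, with no exceptional null set: the moves along columns
    below follow individual points. *)
Definition exact_tiling (I : Type) (X : set I) (p : I -> V) : Prop :=
  (forall x, exists2 i, X i & Icube (x - p i)) /\
  (forall x i k, X i -> X k -> Icube (x - p i) -> Icube (x - p k) -> i = k).

Lemma Icube0 : Icube (0 : V).
Proof. by move=> i; rewrite mxE lexx ltr01. Qed.

Lemma icubeP (x p : V) :
  Icube (x - p) <-> forall k, p k 0 <= x k 0 < p k 0 + 1.
Proof.
split=> h k; move: (h k); rewrite !vecE => /andP[h1 h2]; apply/andP; split; lra.
Qed.

Section column.
Context (I : Type) (X : set I) (p : I -> V) (j : 'I_d).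
Hypothesis tX : exact_tiling X p.

(** Leaving a cube through its upper face in direction [j], one enters a cube whose corner is
    exactly 1 higher in that coordinate; hence corners met along a line agree modulo 1. *)
Lemma next_in_column x t i : X i -> Icube (x - p i) -> 0 <= t <= 1 ->
  exists2 k, X k & Icube (x + t *: axis R j - p k) /\ p k j 0 - p i j 0 \is a Num.int.
Proof.
move=> Xi xi /andP[t0 t1]; have [cov uniq] := tX.
move/icubeP : (xi) => xi'.
have [xt|xt] := ltP (x j 0 + t) (p i j 0 + 1).
  exists i => //; rewrite subrr; split=> //; apply/icubeP => k; rewrite !vecE.
  have := xi' k; have [->|_] := eqVneq k j; last by rewrite mulr0 addr0.
  by move=> /andP[]; rewrite mulr1 xt andbT => h _; rewrite ler_wpDr.
pose y := x + (p i j 0 + 1 - x j 0) *: axis R j.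
have yE k : y k 0 = if k == j then p i j 0 + 1 else x k 0.
  by rewrite !vecE; have [->|_] := eqVneq k j; rewrite ?mulr0 ?addr0// mulr1 addrC subrK.
have [k Xk yk] := cov y; have yk' := (icubeP _ _).1 yk.
have pk : p k j 0 = p i j 0 + 1.
  have := yk' j; rewrite yE eqxx => /andP[]; rewrite le_eqVlt => /predU1P[//|lt1 lt2].
  (* A corner lower than the upper face of cube [i] would make both cubes contain [z], so they would
     coincide; but cube [i] does not contain [y]. *)
  pose z := x + (Num.max (p i j 0) (p k j 0) - x j 0) *: axis R j.
  have zE l : z l 0 = if l == j then Num.max (p i j 0) (p k j 0) else x l 0.
    by rewrite !vecE; have [->|_] := eqVneq l j; rewrite ?mulr0 ?addr0// mulr1 addrC subrK.
  have ik : i = k.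
    apply: (uniq z) => //; apply/icubeP => l; rewrite zE.
      have [->|_] := eqVneq l j; last exact: xi'.
      by rewrite le_max lexx gt_max lt1 ltrDl ltr01.
    have [->|lj] := eqVneq l j; last by have := yk' l; rewrite yE (negbTE lj).
    by rewrite le_max lexx orbT gt_max; apply/andP; split; lra.
  by move: (yk' j); rewrite yE eqxx -ik ltxx andbF.
exists k => //; rewrite pk; split; last by rewrite addrAC subrr add0r.
apply/icubeP => l; have := yk' l; rewrite yE !vecE.
have [->|lj] := eqVneq l j; last by rewrite mulr0 addr0.
rewrite pk mulr1 xt/= => _; have /andP[_] := xi' j; lra.
Qed.

Lemma column_up x t i : X i -> Icube (x - p i) -> 0 <= t ->
  exists2 k, X k & Icube (x + t *: axis R j - p k) /\ p k j 0 - p i j 0 \is a Num.int.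
Proof.
move=> Xi xi t0; have [n tn] : exists n, t <= n%:R.
  by exists (Num.truncn t).+1; apply/ltW/truncnS_gt.
elim: n t t0 tn => [|n IH] t t0 tn.
  by apply: next_in_column => //; apply/andP; split=> //; lra.
have [tn'|tn'] := leP t n%:R; first exact: IH.
have [k Xk [xk kint]] := IH n%:R (ler0n _ _) (lexx _).
have [|k' Xk' [xk' k'int]] := @next_in_column _ (t - n%:R) _ Xk xk.
  by rewrite -natr1 in tn; apply/andP; split; lra.
exists k' => //; split.
  suff -> : x + t *: axis R j = x + n%:R *: axis R j + (t - n%:R) *: axis R j by [].
  by rewrite -addrA -scalerDl [_ + (t - _)]addrC subrK.
by rewrite -(subrK (p k j 0) (p k' j 0)) -addrA rpredD.
Qed.

(** A downward move is read backwards: going up from the cube that covers the target returns to [x],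
    and uniqueness identifies the cube reached with [i]. *)
Lemma column_move x t i : X i -> Icube (x - p i) ->
  exists2 k, X k & Icube (x + t *: axis R j - p k) /\ p k j 0 - p i j 0 \is a Num.int.
Proof.
move=> Xi xi; have [t0|t0] := leP 0 t; first exact: column_up.
have [k Xk xk] := tX.1 (x + t *: axis R j); exists k => //; split => //.
have [|i' Xi' [xi']] := @column_up _ (- t) _ Xk xk; first by lra.
rewrite scaleNr addrK in xi'; rewrite (tX.2 _ _ _ Xi' Xi xi' xi) => h.
by rewrite -opprB rpredN.
Qed.

(** The cubes met by a line in direction [j] all belong to one class modulo 1, so each line is
    either moved as a whole or left alone. *)
Lemma exact_tiling_shift (a t : R) :
  exact_tiling X (shifted j p (fun i => if p i j 0 - a \is a Num.int then t else 0)).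
Proof.
have int_trans (x y z : R) : x - y \is a Num.int -> (x - z \is a Num.int) = (y - z \is a Num.int).
  move=> xy; rewrite -(subrK y x) -addrA; exact: rpredDl.
split=> [x|x i k Xi Xk].
  have [i Xi xi] := tX.1 x; rewrite /shifted.
  case/boolP : (p i j 0 - a \is a Num.int) => ia; last first.
    by exists i => //; rewrite (negbTE ia) scale0r addr0.
  have [k Xk [xk ki]] := @column_move x (- t) _ Xi xi.
  exists k => //; rewrite (int_trans _ _ _ ki) ia.
  by move: xk; rewrite opprD addrA addrAC scaleNr.
(* A moved cube and an unmoved one cannot share a point: pulling [x] back by [t] and moving forward
   again stays in the class of [i'] and ends in cube [k']. *)
have key i' k' : X i' -> X k' -> p i' j 0 - a \is a Num.int -> Icube (x - (p i' + t *: axis R j)) ->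
    Icube (x - p k') -> p k' j 0 - a \is a Num.int.
  move=> Xi' Xk' ia' xi' xk'; move: xi'; rewrite opprD addrA addrAC => xi'.
  have [l Xl [xl li]] := @column_move _ t _ Xi' xi'.
  rewrite subrK in xl.
  by rewrite -(tX.2 _ _ _ Xl Xk' xl xk') (int_trans _ _ _ li).
rewrite /shifted; case: ifPn => ia; case: ifPn => ka; rewrite ?scale0r ?addr0.
- rewrite !opprD !addrA ![x - p _ - _]addrAC; exact: tX.2.
- by move=> xi xk; move: ka; rewrite (key _ _ Xi Xk ia xi xk).
- by move=> xi xk; move: ia; rewrite (key _ _ Xk Xi ka xk xi).
- exact: tX.2.
Qed.
End column.

(* Keller's theorem: shifting columns makes two cubes agree in one more
   coordinate as long as no coordinate separates them by a nonzero integer. *)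
Lemma exact_tiling_keller (I : Type) (X : set I) (p : I -> V) :
  exact_tiling X p -> keller_family X p.
Proof.
move=> tX i k Xi Xk ik.
have [n] := ubnP #|[set j | p i j 0 != p k j 0]|%SET.
elim: n p tX => // n IH p tX lt_n.
have [E|[j]] := set_0Vmem [set j | p i j 0 != p k j 0]%SET.
  exfalso; apply: ik; apply: (tX.2 (p i)) => //; first by rewrite subrr; exact: Icube0.
  suff -> : p i = p k by rewrite subrr; exact: Icube0.
  apply: vecP => j; apply/eqP; apply: contraT => h.
  have : (j \in [set j | p i j 0 != p k j 0]%SET) by rewrite inE.
  by rewrite E finset.in_set0.
rewrite inE => pj; case/boolP : (p i j 0 - p k j 0 \is a Num.int) => jint.
  by exists j; split=> //; apply/eqP.
(* The class of [k] does not contain [i], so this shift moves [k] to the level of [i] and fixes [i].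
   Afterwards they agree at [j], so the separating coordinate found by induction is another one,
   where nothing has changed. *)
pose s := fun l => if p l j 0 - p k j 0 \is a Num.int then p i j 0 - p k j 0 else 0.
have si : shifted j p s i = p i by rewrite /shifted /s (negbTE jint) scale0r addr0.
have sk l : shifted j p s k l 0 = if l == j then p i j 0 else p k l 0.
  rewrite /shifted /s subrr int_num0 !vecE; have [->|_] := eqVneq l j.
    by rewrite mulr1 addrC subrK.
  by rewrite mulr0 addr0.
have [|l [lint lneq]] := IH _ (@exact_tiling_shift _ _ _ j tX (p k j 0) (p i j 0 - p k j 0)).
  rewrite -ltnS; apply: leq_trans lt_n; rewrite ltnS; apply: proper_card; apply/properP; split.
    apply/fintype.subsetP => l; rewrite !inE si sk.
    by have [->|//] := eqVneq l j; rewrite eqxx.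
  by exists j; rewrite !inE// si sk eqxx eqxx.
rewrite -/s si sk in lint lneq; exists l; move: lint lneq; rewrite /keller_coord.
by have [->|//] := eqVneq l j.
Qed.

End tile.

(** * Lebesgue measure *)

Lemma interval_cut (R : realDomainType) (a b c : R) :
  Num.max (b - a) 0 = Num.max (Num.min b c - a) 0 + Num.max (b - Num.max a c) 0.
Proof.
have [bc|cb] := leP b c; have [ac|ca] := leP a c; rewrite /Num.max;
  by repeat (case: ltP => ?); lra.
Qed.

Section outer.
Context (R : realType) (d : nat).
Local Notation V := (vec R d).
Local Notation leb := (@leb_outer R d).

Lemma box_vol_ge0 (a b : V) : 0 <= box_vol a b.
Proof. by apply: prodr_ge0 => i _; rewrite le_max lexx orbT. Qed.

Let volE (a b : V) : (0 <= (box_vol a b)%:E)%E.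
Proof. by rewrite lee_fin box_vol_ge0. Qed.

Let leb_ge0 A : (0 <= leb A)%E.
Proof.
apply: le_ereal_inf_tmp => _ [K [a [b [_ ->]]]].
by apply: nneseries_ge0 => k _ _; exact: volE.
Qed.

Lemma leb_cover_le (A : set V) (K : set nat) (a b : nat -> V) :
  A `<=` \bigcup_(k in K) box (a k) (b k) ->
  (leb A <= \sum_(k <oo | k \in K) (box_vol (a k) (b k))%:E)%E.
Proof. by move=> Acov; apply: ereal_inf_lbound; exists K, a, b. Qed.

Let leb0 : leb set0 = 0%E.
Proof.
apply/le_anti/andP; split; last exact: leb_ge0.
apply: le_trans (@leb_cover_le _ set0 (fun=> 0) (fun=> 0) _) _ => //.
by rewrite eseries0// => k _; rewrite inE.
Qed.

Lemma leb_cover_esum_le (A : set V) (K : set (nat * nat)) (a b : nat * nat -> V) :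
  A `<=` \bigcup_(k in K) box (a k) (b k) ->
  (leb A <= \esum_(k in K) (box_vol (a k) (b k))%:E)%E.
Proof.
move=> Acov; have /card_esym/ppcard_eqP[f] := card_nat2.
apply: le_trans (@leb_cover_le A (f @^-1` K) (a \o f) (b \o f) _) _.
  move=> x /Acov[k Kk xk]; exists (f^-1%FUN k) => //=; rewrite invK ?inE//.
rewrite nneseries_esum; last by move=> n _; exact: volE.
rewrite [X in (_ <= X)%E](reindex_esum (f @^-1` K) K f) ?set_mem_set//.
split=> //.
- by move=> x y _ _; apply: inj; rewrite ?inE.
- by move=> k Kk; exists (f^-1%FUN k) => //=; rewrite invK ?inE.
Qed.

Let leb_sigma_subadditive (A : set V) F : subset_sigma_subadditive leb A F.
Proof.
move=> AF; have [->|] := eqVneq (\sum_(n <oo) leb (F n))%E +oo%E; first by rewrite leey.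
rewrite -ltey => Fltoo; apply/lee_addgt0Pr => _/posnumP[e].
have fin n : leb (F n) \is a fin_num.
  rewrite ge0_fin_numE//; apply: le_lt_trans Fltoo.
  rewrite (nneseriesD1 (n:=n))//; apply: leeDl; apply: nneseries_ge0 => k _ _; exact: leb_ge0.
have /choice[C PC] n : exists C : set nat * (nat -> V) * (nat -> V),
    F n `<=` \bigcup_(k in C.1.1) box (C.1.2 k) (C.2 k) /\
    (\sum_(k <oo | k \in C.1.1) (box_vol (C.1.2 k) (C.2 k))%:E <=
      leb (F n) + (e%:num / (2 ^ n.+1)%:R)%:E)%E.
  have e0 : 0 < e%:num / (2 ^ n.+1)%:R by rewrite divr_gt0// ltr0n expn_gt0.
  have [_ [K [a [b [cov ->]]]] le] := lb_ereal_inf_adherent e0 (fin n).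
  by exists (K, a, b); split=> //; exact: ltW.
apply: le_trans (@leb_cover_esum_le A
  [set ij | (C ij.1).1.1 ij.2] (fun ij => (C ij.1).1.2 ij.2)
  (fun ij => (C ij.1).2 ij.2) _) _.
  move=> x /AF[n _ xn]; have [k Kk xk] := (PC n).1 _ xn.
  by exists (n, k).
rewrite (_ : [set ij | _] = setT `*`` (fun i => (C i).1.1)); last first.
  by apply/seteqP; split=> -[i j]//= [].
rewrite -(@esum_esum _ _ _ setT (fun i => (C i).1.1) (fun i j => (box_vol ((C i).1.2 j) ((C i).2 j))%:E))//.
apply: le_trans (epsilon_trick xpredT _ (ltW _)) => //.
rewrite nneseries_esum; last by move=> n _; rewrite adde_ge0// lee_fin divr_ge0.
rewrite fun_true; apply: le_esum => n _.
by apply: le_trans (PC n).2; rewrite nneseries_esum ?set_mem_set.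
Qed.

HB.instance Definition _ := isSubsetOuterMeasure.Build R V leb
  leb0 leb_ge0 leb_sigma_subadditive.

Lemma leb_box_le (a b : V) : (leb (box a b) <= (box_vol a b)%:E)%E.
Proof.
apply: le_trans (@leb_cover_le _ [set 0%N] (fun=> a) (fun=> b) _) _.
  by move=> x ?; exists 0%N.
rewrite nneseries_esum; last by move=> n _; exact: volE.
by rewrite set_mem_set esum_set1// lee_fin box_vol_ge0.
Qed.

(** Kept general in [S] because it serves twice: for Carathéodory measurability and for sets whose
    indicator is a multiplier. *)
Lemma borel_ind (S : set (set V)) : sigma_algebra setT S ->
  (forall j c, S [set x | x j 0 < c]) -> forall A, measurable A -> S A.
Proof.
move=> sS halfS A mA; apply: (mA S); split=> // B.
elim/big_ind : _ => [//|P Q hP hQ [/hP|/hQ]//|j _].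
have mE : (measurable : set (set R)) = <<s (@RGenInftyO.G R) >>.
  exact: RGenInftyO.measurableE.
pose T := [set D : set R | S ((fun x : V => x j 0) @^-1` D)].
have sT : sigma_algebra setT T.
  case: sS => S0 SC SU; split=> [|D TD|F TF]; rewrite /T/=.
  - by rewrite preimage_set0.
  - by rewrite setTD preimage_setC -setTD; exact: SC.
  - by rewrite preimage_bigcup; exact: SU.
rewrite mE => -[D mD <-]; rewrite setTI; apply: (mD T); split=> // _ [c ->]; rewrite /T/=.
rewrite (_ : _ @^-1` _ = [set x : V | x j 0 < c]); first exact: halfS.
by apply/seteqP; split=> x /=; rewrite in_itv.
Qed.

(** A hyperplane cuts each box of a covering into two boxes whose volumes add up, so one covering of
    [X] yields coverings of both parts with the same total. *)
Lemma halfspace_caratheodory (j : 'I_d) (c : R) :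
  leb.-caratheodory [set x | x j 0 < c].
Proof.
apply: le_caratheodory_measurable => X.
apply: le_ereal_inf_tmp => _ [K [a [b [cov ->]]]].
pose b' k : V := \col_i (if i == j then Num.min (b k j 0) c else b k i 0).
pose a' k : V := \col_i (if i == j then Num.max (a k j 0) c else a k i 0).
have -> : (\sum_(k <oo | k \in K) (box_vol (a k) (b k))%:E =
    \sum_(k <oo | k \in K) (box_vol (a k) (b' k))%:E +
    \sum_(k <oo | k \in K) (box_vol (a' k) (b k))%:E)%E.
  rewrite -nneseriesD//; try by move=> *; exact: volE.
  apply: eq_eseriesr => k _; rewrite -EFinD; congr EFin.
  rewrite /box_vol (bigD1 j)//= [in RHS](bigD1 j)//= [X in _ = _ + X](bigD1 j)//=.
  rewrite !mxE eqxx.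
  under [X in _ = _ * X + _]eq_bigr => i /negbTE ij do rewrite !mxE ij.
  under [X in _ = _ + _ * X]eq_bigr => i /negbTE ij do rewrite !mxE ij.
  rewrite -mulrDl; congr (_ * _).
  exact: interval_cut.
apply: leeD; apply: leb_cover_le => x [Xx].
- move=> /= xc; have [k Kk xk] := cov _ Xx; exists k => // i; rewrite mxE.
  have [->|_] := eqVneq i j; last exact: xk.
  by have /andP[-> h] := xk j; rewrite lt_min h xc.
- move=> /= /negP; rewrite -leNgt => xc; have [k Kk xk] := cov _ Xx; exists k => // i; rewrite mxE.
  have [->|_] := eqVneq i j; last exact: xk.
  by have /andP[h ->] := xk j; rewrite ge_max h xc.
Qed.

Lemma measurable_caratheodory (A : set V) : measurable A -> leb.-caratheodory A.
Proof.
apply: borel_ind => [|j c]; last exact: halfspace_caratheodory.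
split.
- exact: caratheodory_measurable_set0.
- by move=> B; rewrite setTD; exact: caratheodory_measurable_setC.
- by move=> F; exact: caratheodory_measurable_bigcup.
Qed.

Let leb_sigma_additive : semi_sigma_additive leb.
Proof.
move=> F mF tF mUF; apply: (@caratheodory_measure_sigma_additive _ _ leb) => //.
- by move=> n; exact: measurable_caratheodory.
- exact: measurable_caratheodory.
Qed.

HB.instance Definition _ := isMeasure.Build _ _ _ leb leb0 leb_ge0 leb_sigma_additive.

Lemma measurable_coord (j : 'I_d) : measurable_fun setT (fun x : V => x j 0).
Proof.
move=> _ B mB; rewrite setTI.
suff : g_sigma_preimage (@cv_coord R d) ((fun x : V => x j 0) @^-1` B) by [].
apply: sub_sigma_algebra; rewrite (bigD1 j)//=; left; exists B => //; exact: setTI.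
Qed.

Lemma measurable_box (a b : V) : measurable (box a b).
Proof.
rewrite (_ : box a b = \bigcap_(j in [set: 'I_d]) ((fun x : V => x j 0) @^-1` `[a j 0, b j 0[%classic)).
  apply: fin_bigcap_measurable => // j _.
  by rewrite -[X in measurable X]setTI; apply: (measurable_coord j) => //.
apply/seteqP; split=> x h.
  by move=> j _ /=; rewrite in_itv/=; exact: h.
by move=> j; have := h j I; rewrite /= in_itv.
Qed.

Lemma bigcup_centered_box : \bigcup_n box (\col__ (- n%:R)) (\col__ n%:R) = [set: V].
Proof.
apply/seteqP; split=> // x _.
pose s := \sum_j `|x j 0|; exists (Num.truncn s).+1 => // j; rewrite !mxE.
have : `|x j 0| < (Num.truncn s).+1%:R.
  apply: le_lt_trans (truncnS_gt s); rewrite /s (bigD1 j)//= lerDl.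
  by apply: sumr_ge0.
by rewrite ltr_norml => /andP[/ltW -> ->].
Qed.

Let leb_sigma_finite : sigma_finite setT leb.
Proof.
exists (fun n => box (\col__ (- n%:R)) (\col__ n%:R)).
  by rewrite bigcup_centered_box.
move=> n; split; first exact: measurable_box.
by apply: le_lt_trans (leb_box_le _ _) _; rewrite ltry.
Qed.

HB.instance Definition _ := Measure_isSigmaFinite.Build _ _ _ leb leb_sigma_finite.

End outer.

(** * Lebesgue measure is determined by the volumes of boxes *)

Section unique.
Context (R : realType) (d : nat).
Local Notation V := (vec R d).
Local Notation leb := (@leb_outer R d).

Lemma measurable_vecP d0 (T : measurableType d0) (D : set T) (f : T -> V) :
  (forall j, measurable_fun D (fun x => f x j 0)) -> measurable_fun D f.
Proof.
move=> mf mD A mA; pose S := [set B : set V | measurable (D `&` f @^-1` B)].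
suff : S A by [].
apply: (mA S); split.
  split=> [|B SB|F SF]; rewrite /S/=.
  - by rewrite preimage_set0 setI0.
  - rewrite (_ : D `&` _ = D `\` (D `&` f @^-1` B)); first exact: measurableD.
    by rewrite setDIr setDv set0U setTD setDE preimage_setC.
  - by rewrite preimage_bigcup setI_bigcupr; exact: bigcupT_measurable.
move=> B; elim/big_ind : _ => [//|P Q hP hQ [/hP|/hQ]//|j _ [C mC <-]].
by rewrite setTI; exact: (mf j).
Qed.

Lemma measure_le_leb (mu : {measure set V -> \bar R}) :
  (forall a b, (mu (box a b) <= (box_vol a b)%:E)%E) ->
  forall A, measurable A -> (mu A <= leb A)%E.
Proof.
move=> mubox A mA; apply: le_ereal_inf_tmp => _ [K [a [b [cov ->]]]].
pose F k := if k \in K then box (a k) (b k) else set0.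
have mF k : measurable (F k).
  by rewrite /F; case: ifP => // _; exact: measurable_box.
have AF : A `<=` \bigcup_k F k.
  by move=> x /cov[k Kk xk]; exists k => //; rewrite /F mem_set.
apply: le_trans (measure_sigma_subadditive mu mF mA AF) _.
rewrite [leRHS]eseries_mkcond; apply: lee_nneseries => k _ //.
by rewrite /F; case: ifP; rewrite ?measure0.
Qed.

(** Agreement on boxes gives one inequality on all Borel sets, since the outer measure is an infimum
    over coverings. Inside a box the inequality also holds for the complement, and equality of the
    totals forces both to be equalities; growing boxes then exhaust the space. *)
Lemma leb_unique (mu : {measure set V -> \bar R}) :
  (forall a b, mu (box a b) = (box_vol a b)%:E) ->
  forall A, measurable A -> mu A = leb A.
Proof.
move=> mubox.
have mule : forall A, measurable A -> (mu A <= leb A)%E.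
  by apply: measure_le_leb => a b; rewrite mubox.
have muB a b : mu (box a b) = leb (box a b).
  apply/le_anti; rewrite mule; last exact: measurable_box.
  by rewrite mubox leb_box_le.
have muI A a b : measurable A -> mu (A `&` box a b) = leb (A `&` box a b).
  move=> mA; have mB := measurable_box a b.
  have := muB a b; rewrite (measureDI mu mB mA) (measureDI leb mB mA) => E.
  have m1 : measurable (A `&` box a b) by exact: measurableI.
  have m2 : measurable (box a b `\` A) by exact: measurableD.
  apply/le_anti; rewrite mule//= leNgt; apply/negP => lt.
  have : (mu (box a b `\` A) + mu (box a b `&` A) <
     leb (box a b `\` A) + leb (box a b `&` A))%E.
    rewrite ![box a b `&` A]setIC; apply: lee_ltD => //; last exact: mule.
    rewrite ge0_fin_numE//; apply: (@le_lt_trans _ _ (mu (box a b))).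
      by apply: le_measure; rewrite ?inE//; apply: subDsetl.
    by rewrite mubox ltry.
  by rewrite E ltxx.
move=> A mA; pose B n : set V := box (\col__ (- n%:R)) (\col__ n%:R).
have BT : \bigcup_n B n = setT by exact: bigcup_centered_box.
have ndB : nondecreasing_seq (fun n => A `&` B n).
  move=> m n mn; apply/subsetPset => x [Ax Bx]; split=> // j; have := Bx j.
  rewrite !mxE => /andP[h1 h2]; have : m%:R <= n%:R :> R by rewrite ler_nat.
  by move=> h3; apply/andP; split; lra.
have AB : \bigcup_n (A `&` B n) = A by rewrite -setI_bigcupr BT setIT.
have mAB n : measurable (A `&` B n) by apply: measurableI => //; exact: measurable_box.
have := nondecreasing_cvg_mu (mu := mu) mAB; rewrite AB => /(_ mA ndB) c1.
have := nondecreasing_cvg_mu (mu := leb) mAB; rewrite AB => /(_ mA ndB) c2.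
have E : mu \o (fun n => A `&` B n) = leb \o (fun n => A `&` B n).
  by apply/funext => n /=; exact: muI.
by rewrite E in c1; exact: (cvg_unique (@ereal_hausdorff R) c1 c2).
Qed.

End unique.

(** * Lebesgue measure as a product, by induction on the dimension *)

Section product.
Context (R : realType).

Definition vcons d (x : R * vec R d) : vec R d.+1 :=
  \col_i (if unlift ord0 i is Some k then x.2 k 0 else x.1).

Lemma vcons0 d (x : R * vec R d) : vcons x ord0 0 = x.1.
Proof. by rewrite mxE unlift_none. Qed.

Lemma vconsS d (x : R * vec R d) k : vcons x (lift ord0 k) 0 = x.2 k 0.
Proof. by rewrite mxE liftK. Qed.

Lemma measurable_vcons d : measurable_fun setT (@vcons d).
Proof.
apply: measurable_vecP => j; case: (unliftP ord0 j) => [k ->|->].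
  rewrite (_ : (fun x => _) = (fun y : vec R d => y k 0) \o snd).
    exact: measurableT_comp (measurable_coord k) measurable_snd.
  by apply/funext => x; rewrite vconsS.
rewrite (_ : (fun x => _) = fst); first exact: measurable_fst.
by apply/funext => x; rewrite vcons0.
Qed.

Lemma pushforward_is_measure d1 d2 (T1 : measurableType d1) (T2 : measurableType d2)
    (mu : {measure set T1 -> \bar R}) (f : T1 -> T2) : measurable_fun setT f ->
  exists nu : {measure set T2 -> \bar R}, forall A, nu A = mu (f @^-1` A).
Proof.
by move=> mf; unshelve eexists (pushforward mu f : {measure set T2 -> \bar R}) => //.
Qed.

Lemma box_vcons d (a b : vec R d.+1) :
  @vcons d @^-1` box a b = `[a ord0 0, b ord0 0[%classic `*`
    box (\col_k a (lift ord0 k) 0) (\col_k b (lift ord0 k) 0).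
Proof.
apply/seteqP; split=> x.
  move=> h; split => [|k]; first by have := h ord0; rewrite vcons0 /= in_itv.
  by have := h (lift ord0 k); rewrite vconsS !mxE.
move=> [/=]; rewrite in_itv/= => h0 h k; case: (unliftP ord0 k) => [l ->|->].
  by have := h l; rewrite vconsS !mxE.
by rewrite vcons0.
Qed.

Lemma leb_prod_box d (a b : vec R d.+1) :
  (forall a b : vec R d, leb_outer (box a b) = (box_vol a b)%:E) ->
  (@lebesgue_measure R \x @leb_outer R d)%E (@vcons d @^-1` box a b) = (box_vol a b)%:E.
Proof.
move=> IH; rewrite box_vcons product_measure1E//; last exact: measurable_box.
rewrite /= IH lebesgue_measure_itv/= lte_fin.
rewrite [box_vol a b]big_ord_recl EFinM; congr (_ * _)%E.
  by case: ltP => h; rewrite -?EFinB; congr EFin; rewrite /Num.max; case: ltP => //; lra.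
congr EFin; apply: eq_bigr => i _; by rewrite !mxE.
Qed.

(** The lower bound avoids compactness: the product of one-dimensional Lebesgue measure with the
    measure of dimension [d] is a measure giving boxes their volume, and any such measure is at most
    the outer measure. *)
Lemma leb_box d (a b : vec R d) : leb_outer (box a b) = (box_vol a b)%:E.
Proof.
elim: d => [|d IH] in a b *.
  (* In dimension 0 every box is the single point and has volume 1, the empty product; a covering
     must use at least one box. *)
  apply/le_anti; rewrite leb_box_le/=.
  apply: le_ereal_inf_tmp => _ [K [a' [b' [cov ->]]]].
  have [|k Kk _] := cov 0; first by case.
  rewrite nneseries_esum; last by move=> *; rewrite lee_fin box_vol_ge0.
  rewrite set_mem_set [leLHS](_ : _ = (box_vol (a' k) (b' k))%:E); last first.
    by rewrite /box_vol !big_ord0.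
  rewrite -(@esum_set1 _ _ k (fun k => (box_vol (a' k) (b' k))%:E)) ?lee_fin ?box_vol_ge0//.
  rewrite esum_mkcond [leRHS]esum_mkcond; apply: le_esum => i _.
  case: ifPn => [|_]; first by rewrite inE => /= ->; rewrite mem_set.
  by case: ifP => //; rewrite lee_fin box_vol_ge0.
have [nu nuE] := @pushforward_is_measure _ _ _ _ (@lebesgue_measure R \x @leb_outer R d)%E _ (@measurable_vcons d).
have nuB a' b' : nu (box a' b') = (box_vol a' b')%:E.
  exact: etrans (nuE _) (leb_prod_box _ _ IH).
apply/le_anti; rewrite leb_box_le/= -nuB.
apply: measure_le_leb; last exact: measurable_box.
by move=> a' b'; rewrite nuB.
Qed.

Lemma leb_vcons d (A : set (vec R d.+1)) : measurable A ->
  (@lebesgue_measure R \x @leb_outer R d)%E (@vcons d @^-1` A) = leb_outer A.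
Proof.
move=> mA.
have [nu nuE] := @pushforward_is_measure _ _ _ _ (@lebesgue_measure R \x @leb_outer R d)%E _ (@measurable_vcons d).
transitivity (nu A); first by rewrite nuE.
apply: leb_unique => // a b; apply: etrans (nuE _) _.
by apply: leb_prod_box => *; exact: leb_box.
Qed.

End product.

(** * Integration over the unit cube *)

Section cube.
Context (R : realType).

Lemma Icube_box d : @Icube R d = box 0 (\col__ 1).
Proof. by apply/seteqP; split=> x h j; have := h j; rewrite !mxE. Qed.

Lemma measurable_Icube d : measurable (@Icube R d).
Proof. by rewrite Icube_box; exact: measurable_box. Qed.

Lemma leb_Icube d : leb_outer (@Icube R d) = 1%E.
Proof.
rewrite Icube_box leb_box /box_vol big1// => i _; rewrite !mxE subr0.
by apply/max_idPl; rewrite ler01.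
Qed.

Lemma bounded_integrable d0 (T : measurableType d0) (mu : {measure set T -> \bar R})
    (D : set T) (f : T -> R) (M : R) :
  measurable D -> (mu D < +oo)%E -> measurable_fun D f ->
  (forall x, D x -> `|f x| <= M) -> mu.-integrable D (EFin \o f).
Proof.
move=> mD muD mf fM; apply: measurable_bounded_integrable => //.
exists M; split; rewrite ?num_real// => r Mr x Dx /=.
by apply: le_trans (fM _ Dx) (ltW Mr).
Qed.

Definition vtail d (x : vec R d.+1) : vec R d := \col_k x (lift ord0 k) 0.

Lemma vtail_vcons d (z : R * vec R d) : vtail (vcons z) = z.2.
Proof. by apply: vecP => k; rewrite mxE vconsS. Qed.

Lemma measurable_vtail d : measurable_fun setT (@vtail d).
Proof.
apply: measurable_vecP => j.
rewrite (_ : (fun x => _) = (fun x : vec R d.+1 => x (lift ord0 j) 0)).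
  exact: measurable_coord.
by apply/funext => x; rewrite mxE.
Qed.

Lemma vcons_Icube d : @vcons R d @^-1` @Icube R d.+1 = `[0, 1[%classic `*` @Icube R d.
Proof.
rewrite !Icube_box box_vcons !mxE; congr (_ `*` box _ _);
  by apply: vecP => k; rewrite !mxE.
Qed.

Lemma Icube_fubini d (f : R -> R) (g : vec R d -> R) (M : R) :
  measurable_fun setT f -> measurable_fun setT g ->
  (forall t, `|f t| <= M) -> (forall x, `|g x| <= M) ->
  (\int[@leb_outer R d.+1]_(x in @Icube R d.+1) (f (x ord0 0%R) * g (vtail x)) =
   \int[lebesgue_measure]_(t in `[0%R, 1%R[) f t *
   \int[@leb_outer R d]_(x in @Icube R d) g x)%R.
Proof.
move=> mf mg fM gM.
have mI01 : measurable (`[0, 1[%classic : set R) by exact: measurable_itv.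
have mI := @measurable_Icube d.
have fint : (@lebesgue_measure R).-integrable `[0, 1[ (EFin \o f).
  apply: (bounded_integrable (M := M)) => //.
  - by rewrite /= lebesgue_measure_itv/= lte_fin ltr01 -EFinB ltry.
  - exact: measurable_funTS.
have gint : (@leb_outer R d).-integrable (@Icube R d) (EFin \o g).
  apply: (bounded_integrable (M := M)) => //.
  - by rewrite /= leb_Icube ltry.
  - exact: measurable_funTS.
pose mu : {measure set (measurableTypeR R * vec R d) -> \bar R} :=
  (@lebesgue_measure R \x @leb_outer R d)%E.
pose F (x : vec R d.+1) : \bar R := (f (x ord0 0) * g (vtail x))%:E.
have mF : measurable_fun setT F.
  apply/measurable_EFinP; apply: measurable_funM.
    exact: measurableT_comp mf (measurable_coord _).
  exact: measurableT_comp mg (@measurable_vtail d).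
pose Q : set (measurableTypeR R * vec R d) := `[0, 1[%classic `*` @Icube R d.
have mQ : measurable Q by exact: measurableX.
have FQ : (F \o @vcons R d) = (fun z => (f z.1 * g z.2)%:E).
  by apply/funext => z; rewrite /F /= vcons0 vtail_vcons.
have Fint : mu.-integrable Q (F \o @vcons R d).
  rewrite FQ.
  apply: (@bounded_integrable _ (measurableTypeR R * vec R d)%type mu Q
    (fun z => f z.1 * g z.2) (M * M)) => //.
  - have -> : mu Q = (@lebesgue_measure R `[0%R, 1%R[ * leb_outer (@Icube R d))%E.
      exact: product_measure1E.
    rewrite lebesgue_measure_itv/= lte_fin ltr01.
    by rewrite leb_Icube -EFinB mule1 ltry.
  - apply: measurable_funM; apply: measurable_funTS.
      exact: measurableT_comp mf measurable_fst.
    exact: measurableT_comp mg measurable_snd.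
  - by move=> z _; rewrite normrM ler_pM.
rewrite /Rintegral -fineM; [|exact: integrable_fin_num fint|exact: integrable_fin_num gint].
congr fine.
transitivity (\int[pushforward mu (@vcons R d)]_(x in @Icube R d.+1) F x)%E.
  apply: eq_measure_integral => //=; first exact: measurable_vcons.
  by move=> ? A mA _; rewrite /pushforward leb_vcons.
rewrite integral_pushforward//; [|exact: measurable_vcons|by rewrite vcons_Icube|exact: measurable_Icube].
rewrite vcons_Icube -/Q integral_mkcond -integral12_prod_meas1; last first.
  exact/(integrable_mkcond _ mQ).
have gfin := integrable_fin_num mI gint; set c := (\int[_]_(x in _) (g x)%:E)%E in gfin *.
transitivity (\int[@lebesgue_measure R]_t ((fun t => (f t)%:E * c) \_ `[0%R, 1%R[) t)%E; last first.
  by rewrite -integral_mkcond -(fineK gfin) integralZr.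
apply: eq_integral => t _; rewrite patchE; case: ifPn => t01.
  transitivity (\int[@leb_outer R d]_y ((fun y => (f t)%:E * (g y)%:E) \_ (@Icube R d)) y)%E.
    apply: eq_integral => y _; rewrite FQ !patchE -EFinM/=.
    congr (if _ then _ else _); apply/idP/idP; rewrite !inE /Q/=; first by case.
    by split=> //; move: t01; rewrite inE.
  by rewrite -integral_mkcond integralZl.
rewrite /fubini_F integral0_eq// => y _; rewrite patchE ifF//; apply/negbTE.
by move: t01; apply: contra; rewrite !inE /Q => -[].
Qed.
End cube.

(** * The Fourier transform of the cube *)

Section sinc.
Context (R : realType).
Implicit Types x y t : R.

(** Squared modulus of the Fourier transform of [[0, 1[]; the value 1 at 0 is the limit. *)
Definition sinc2 (x : R) : R := if x == 0 then 1 else (sin (pi * x) / (pi * x)) ^+ 2.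

Lemma sinc2_ge0 x : 0 <= sinc2 x.
Proof. by rewrite /sinc2; case: ifP => // _; exact: sqr_ge0. Qed.

Lemma sin2_pi_shift x (n : int) : sin (pi * (x + n%:~R)) ^+ 2 = sin (pi * x) ^+ 2.
Proof.
have pos y (m : nat) : sin (pi * (y + m%:R)) ^+ 2 = sin (pi * y) ^+ 2.
  elim: m => [|m IH]; first by rewrite addr0.
  by rewrite -natr1 addrA mulrDr mulr1 sinDpi sqrrN IH.
case: n => m; first exact: pos.
by have := pos (x - m.+1%:R) m.+1; rewrite NegzE mulrNz subrK => ->.
Qed.

Lemma sin_pi_eq0 x : sin (pi * x) = 0 -> x \is a Num.int.
Proof.
move=> s0; set n := Num.floor x.
have /andP[h1 h2] : 0 <= x - n%:~R < 1.
  by have := floor_itv x; rewrite -/n intrD; lra.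
have : sin (pi * (x - n%:~R)) ^+ 2 = 0.
  by rewrite -mulrNz sin2_pi_shift s0 expr0n.
move=> /eqP; rewrite sqrf_eq0 => /eqP s0'.
have [xn|xn] := eqVneq (x - n%:~R) 0.
  by rewrite -(subrK n%:~R x) xn add0r intr_int.
have : 0 < sin (pi * (x - n%:~R)).
  apply: sin_gt0_pi; have p0 := pi_gt0 R.
  rewrite mulr_gt0//=; last by rewrite lt_neqAle eq_sym xn.
  by rewrite -[ltRHS]mulr1 ltr_pM2l.
by rewrite s0' ltxx.
Qed.

Lemma sinc2_eq0 x : sinc2 x = 0 <-> x \is a Num.int /\ x <> 0.
Proof.
rewrite /sinc2; have [->|x0] := eqVneq x 0.
  by split=> [/eqP|[_ /(_ erefl)]//]; rewrite oner_eq0.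
have px0 : pi * x != 0 by rewrite mulf_neq0// gt_eqF// pi_gt0.
split=> [/eqP|[/intrP[n xn] _]].
  rewrite sqrf_eq0 mulf_eq0 invr_eq0 (negbTE px0) orbF => /eqP/sin_pi_eq0 ?.
  by split=> //; apply/eqP.
have /eqP : sin (pi * x) ^+ 2 = 0.
  by rewrite xn -[n%:~R]add0r sin2_pi_shift mulr0 sin0 expr0n.
by rewrite sqrf_eq0 => /eqP ->; rewrite mul0r expr0n.
Qed.

Lemma mulr_cos_le_sin x : 0 <= x <= pi / 2 -> x * cos x <= sin x.
Proof.
move=> /andP[x0 xpi].
pose f (t : R) := sin t - t * cos t.
have df t : is_derive t 1 f (t * sin t).
  have -> : t * sin t = cos t - (t *: - sin t + cos t *: 1).
    by rewrite /GRing.scale/=; ring.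
  by apply: is_deriveB.
suff : f 0 <= f x by rewrite /f sin0 mul0r subrr subr_ge0.
apply: (@ger0_derive1_ndecr _ f 0 (pi / 2)) => //.
  move=> t; rewrite in_itv/= => /andP[t0 tpi].
  rewrite derive1E derive_val mulr_ge0 ?ltW// sin_gt0_pihalf//.
  by rewrite t0.
apply: continuous_subspaceT => t.
by apply/differentiable_continuous/derivable1_diffP; have [] := df t.
Qed.

(** Squaring [x * cos x <= sin x], that is tan x >= x, and replacing cos^2 by 1 - sin^2 gives x^2 <=
    sin^2 + x^2 sin^2. *)
Lemma inv_sin2_le x : - (pi / 2) < x < pi / 2 -> x != 0 ->
  (sin x ^+ 2)^-1 <= (x ^+ 2)^-1 + 1.
Proof.
wlog x0 : x / 0 <= x.
  move=> H; have [x0|x0] := leP 0 x; first exact: H.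
  move=> /andP[h1 h2] xn0; have := H (- x); rewrite sinN !sqrrN oppr_eq0.
  by apply => //; [lra|apply/andP; split; lra].
move=> /andP[_ xpi] xn0; have {x0}x0 : 0 < x by rewrite lt_neqAle eq_sym xn0.
have s0 : 0 < sin x by apply: sin_gt0_pihalf; rewrite x0.
have c0 : 0 < cos x by apply: cos_gt0_pihalf; apply/andP; split => //; lra.
have le := @mulr_cos_le_sin x; rewrite (ltW x0) (ltW xpi) in le.
have {}le := le isT.
have x2 : 0 < x ^+ 2 by rewrite exprn_gt0.
have s2 : 0 < sin x ^+ 2 by rewrite exprn_gt0.
rewrite -(ler_pM2l s2) mulfV ?gt_eqF// mulrDr mulr1 -(ler_pM2r x2).
rewrite mul1r mulrDl mulfVK ?gt_eqF//.
have := cos2Dsin2 x => cs.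
have : (x * cos x) ^+ 2 <= sin x ^+ 2.
  by rewrite ler_sqr// ?nnegrE ?mulr_ge0// ltW.
rewrite exprMn (cos2sin2 x); lra.
Qed.

Lemma sin_pow2_eq0 (m : nat) x : sin x = 0 -> sin (x * 2 ^+ m) = 0.
Proof.
elim: m => [|m IH] s0; first by rewrite mulr1.
rewrite exprSr mulrA mulr_natr sin_mulr2n (IH s0).
by rewrite mulr0 mul0rn.
Qed.

Lemma sin_pi_natD (k : nat) x : sin (x + k%:R * pi) ^+ 2 = sin x ^+ 2.
Proof.
elim: k => [|k IH]; first by rewrite mul0r addr0.
by rewrite -natr1 mulrDl mul1r addrA sinDpi sqrrN.
Qed.

Lemma inv_sin2_double x : sin (x *+ 2) != 0 ->
  (sin x ^+ 2)^-1 + (sin (x + pi / 2) ^+ 2)^-1 = 4 * (sin (x *+ 2) ^+ 2)^-1.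
Proof.
rewrite sinDpihalf sin_mulr2n => h.
have [c0|c0] := eqVneq (cos x) 0; first by rewrite c0 mul0r mul0rn eqxx in h.
have [s0|s0] := eqVneq (sin x) 0; first by rewrite s0 mulr0 mul0rn eqxx in h.
have cs : cos x ^+ 2 + sin x ^+ 2 = 1 := cos2Dsin2 x.
rewrite -(mulr_natr (cos x * _)).
transitivity ((cos x ^+ 2 + sin x ^+ 2) / (cos x ^+ 2 * sin x ^+ 2)).
  by field; rewrite c0 s0.
by rewrite cs; field; rewrite c0 s0.
Qed.

(** Induction by pairing the indices k and 2^m + k of the next level: their arguments differ by pi /
    2, so [inv_sin2_double] merges them into one term of the current level. *)
Lemma sum_inv_sin2 (m : nat) x : sin x != 0 ->
  \sum_(k < 2 ^ m) (sin ((x + k%:R * pi) / 2 ^+ m) ^+ 2)^-1 = 4 ^+ m * (sin x ^+ 2)^-1.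
Proof.
move=> s0; elim: m => [|m IH].
  by rewrite big_ord_recl big_ord0 addr0 mul0r addr0 divr1 mul1r.
have E : (2 ^ m.+1 = 2 ^ m + 2 ^ m)%N by rewrite expnS mul2n addnn.
rewrite -(big_mkord xpredT (fun k => (sin ((x + k%:R * pi) / 2 ^+ m.+1) ^+ 2)^-1)).
rewrite E big_mkord big_split_ord/= -big_split/=.
rewrite [4 ^+ m.+1]exprS -mulrA -IH mulr_sumr; apply: eq_bigr => k _.
set y := (x + k%:R * pi) / 2 ^+ m.+1.
have -> : (x + (2 ^ m + k)%:R * pi) / 2 ^+ m.+1 = y + pi / 2.
  rewrite /y natrD natrX exprS; field.
  by rewrite expf_neq0.
have y2 : (x + k%:R * pi) / 2 ^+ m = y *+ 2.
  by rewrite /y exprS -mulr_natr; field; rewrite expf_neq0.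
rewrite y2 inv_sin2_double// -y2; apply: contra s0 => /eqP/(sin_pow2_eq0 m).
rewrite divfK ?expf_neq0// => h; rewrite -sqrf_eq0 -(sin_pi_natD k) h.
by rewrite expr0n.
Qed.

(* The partial fraction expansion of 1 / sin^2, from the iterated doubling
   formula and 1 / sin^2 <= 1 / y^2 + 1. *)
Lemma sinc2_partial_sum (m : nat) x : 0 < x < 1 ->
  1 - (2 ^+ m.+1)^-1 <=
    \sum_(k < 2 ^ m) (sinc2 (x + k%:R) + sinc2 (x + (k%:R - 2 ^+ m))).
Proof.
move=> /andP[x0 x1]; have p0 := pi_gt0 R.
have s0 : 0 < sin (pi * x).
  by apply: sin_gt0_pi; rewrite mulr_gt0//= -[ltRHS]mulr1 ltr_pM2l.
(* There are [N] shifts j with - 2^m <= j < 2^m, and [pi * (x + j) / N] then stays in the interval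
   where [inv_sin2_le] applies. *)
pose N : R := 2 ^+ m.+1.
have N0 : 0 < N by rewrite exprn_gt0.
pose h (j : R) := (sin (pi * (x + j) / N) ^+ 2)^-1.
have E : N ^+ 2 * (sin (pi * x) ^+ 2)^-1 = \sum_(k < 2 ^ m) (h k%:R + h (k%:R - 2 ^+ m)).
  have -> : N ^+ 2 = 4 * 4 ^+ m.
    rewrite /N -exprM mulnC exprM -exprS; congr (_ ^+ _); ring.
  rewrite -mulrA -(sum_inv_sin2 m (lt0r_neq0 s0)) mulr_sumr; apply: eq_bigr => k _.
  set y := pi * (x + k%:R) / N.
  have -> : h (k%:R - 2 ^+ m) = (sin (y + pi / 2) ^+ 2)^-1.
    rewrite /h (_ : pi * _ / N = y + pi / 2 - pi); last first.
      by rewrite /y /N exprS; field; rewrite expf_neq0.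
    by rewrite -(sqrrN (sin _)) -sinDpi subrK.
  have y2 : (pi * x + k%:R * pi) / 2 ^+ m = y *+ 2.
    by rewrite /y /N exprS -mulr_natr; field; rewrite expf_neq0.
  rewrite y2 -inv_sin2_double// -y2.
  apply/eqP => /(sin_pow2_eq0 m).
  rewrite divfK ?expf_neq0// => s; have := sin_pi_natD k (pi * x).
  by rewrite s expr0n/= => /esym/eqP; rewrite sqrf_eq0 gt_eqF.
have key (j : R) (n : int) : j = n%:~R -> - 2 ^+ m <= j -> j + 1 <= 2 ^+ m ->
    sin (pi * x) ^+ 2 / N ^+ 2 * h j <= sinc2 (x + j) + (N ^+ 2)^-1.
  move=> jn j1 j2.
  have xj0 : x + j != 0.
    apply/eqP => xj; have : x \is a Num.int.
      by rewrite -(addrK j x) xj jn -mulrNz add0r intr_int.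
    move=> /intrP[k xk]; move: x0 x1; rewrite xk ltr0z -[1]/(1%:~R) ltr_int; lia.
  have pxj0 : pi * (x + j) / N != 0 by rewrite !mulf_neq0 ?invr_eq0 ?xj0 ?(gt_eqF p0) ?(gt_eqF N0).
  have /inv_sin2_le/(_ pxj0) : - (pi / 2) < pi * (x + j) / N < pi / 2.
    rewrite -mulrA -mulrN !ltr_pM2l// ltr_pdivrMr// ltr_pdivlMr// /N exprS.
    by apply/andP; split; lra.
  rewrite -/(h j) => hle.
  have sN0 : 0 <= sin (pi * x) ^+ 2 / N ^+ 2 by rewrite divr_ge0 ?sqr_ge0.
  apply: le_trans (ler_wpM2l sN0 hle) _; rewrite mulrDr mulr1; apply: lerD.
    rewrite /sinc2 (negbTE xj0) !exprMn jn -(sin2_pi_shift x n) -jn !exprVn.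
    rewrite le_eqVlt; apply/orP; left; apply/eqP; move: (gt_eqF p0).
    by generalize (@pi R) => P P0; field; rewrite xj0 P0 (gt_eqF N0).
  by rewrite -[leRHS]mul1r ler_pM2r ?invr_gt0 ?exprn_gt0//.
(* Each of the [N] terms costs an error of 1 / N^2, whence the total loss 1 / N in the statement. *)
have : \sum_(k < 2 ^ m) (sin (pi * x) ^+ 2 / N ^+ 2 * (h k%:R + h (k%:R - 2 ^+ m))) <=
    \sum_(k < 2 ^ m) ((sinc2 (x + k%:R) + sinc2 (x + (k%:R - 2 ^+ m))) + 2 / N ^+ 2).
  apply: ler_sum => k _; rewrite mulrDr.
  have km : k%:R + 1 <= 2 ^+ m :> R by rewrite natr1 -natrX ler_nat.
  have k1 := @key k%:R k erefl.
  have k2 := @key (k%:R - 2 ^+ m) (k%:Z - (2 ^ m)%N%:Z).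
  have k0 : 0 <= k%:R :> R by rewrite ler0n.
  have N2 : 2 / N ^+ 2 = (N ^+ 2)^-1 + (N ^+ 2)^-1 by ring.
  rewrite N2; have : 0 < 2 ^+ m :> R by rewrite exprn_gt0.
  move=> ?; have {}k1 := k1 ltac:(lra) km.
  have {}k2 := k2 ltac:(by rewrite intrB -!pmulrn natrX) ltac:(lra) ltac:(lra); lra.
rewrite -mulr_sumr -E big_split/= sumr_const card_ord.
rewrite mulrA divfK ?gt_eqF ?exprn_gt0// mulfV ?gt_eqF ?exprn_gt0//.
rewrite (_ : 2 / N ^+ 2 *+ (2 ^ m)%N = N^-1); first by rewrite /N; lra.
rewrite -mulr_natr natrX /N [2 ^+ m.+1]exprS; field; by rewrite expf_neq0.
Qed.

End sinc.

Section trig_integral.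
Context (R : realType).

Lemma Rintegral01_derive (f F : R -> R) :
  (forall t : R, is_derive t (1 : R) F (f t)) -> continuous f ->
  (\int[@lebesgue_measure R]_(t in `[0%R, 1%R[) f t)%R = F 1 - F 0.
Proof.
move=> dF cf.
have dF' t : derivable F t 1 by have [] := dF t.
have cF : continuous F.
  by move=> t; apply/differentiable_continuous/derivable1_diffP.
have fI : (@lebesgue_measure R).-integrable `[0%R, 1%R] (EFin \o f).
  apply: continuous_compact_integrable; first exact: segment_compact.
  exact: continuous_subspaceT.
rewrite Rintegral_itv_bndo_bndc; last first.
  by apply: integrableS fI => //; apply: subset_itvl; rewrite bnd_simp.
rewrite /Rintegral (@continuous_FTC2 _ f F) ?ltr01//.
- exact: continuous_subspaceT.
- split => //; apply: cvg_at_right_filter || apply: cvg_at_left_filter; exact: cF.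
- by move=> t _; rewrite derive1E; apply: derive_val.
Qed.

Lemma is_derive_sin_scale (c t : R) : c != 0 ->
  is_derive t (1 : R) (fun t => sin (c * t) / c) (cos (c * t)).
Proof.
move=> c0; have -> : cos (c * t) = c^-1 *: (cos (c * t) *: (c *: 1)).
  by rewrite /GRing.scale/=; field.
rewrite (_ : (fun t => _) = (fun t => c^-1 *: sin (c *: t))); last first.
  by apply/funext => u; rewrite mulrC.
by apply: is_deriveZ; apply: is_derive1_comp.
Qed.

Lemma is_derive_cos_scale (c t : R) : c != 0 ->
  is_derive t (1 : R) (fun t => - cos (c * t) / c) (sin (c * t)).
Proof.
move=> c0; have -> : sin (c * t) = (- c^-1) *: (- sin (c * t) *: (c *: 1)).
  by rewrite /GRing.scale/=; field.
rewrite (_ : (fun t => _) = (fun t => (- c^-1) *: cos (c *: t))); last first.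
  by apply/funext => u; rewrite /GRing.scale/=; ring.
by apply: is_deriveZ; apply: is_derive1_comp.
Qed.

Lemma trig_integral01 (x : R) :
  (\int[@lebesgue_measure R]_(t in `[0%R, 1%R[) cos (2 * pi * (x * t)))%R ^+ 2 +
  (\int[@lebesgue_measure R]_(t in `[0%R, 1%R[) sin (2 * pi * (x * t)))%R ^+ 2 =
  sinc2 x.
Proof.
rewrite /sinc2; have [->|x0] := eqVneq x 0.
  under eq_Rintegral do rewrite mul0r mulr0 cos0.
  under [X in _ + X ^+ 2]eq_Rintegral do rewrite mul0r mulr0 sin0.
  rewrite !Rintegral_cst//= lebesgue_measure_itv/= lte_fin ltr01 -EFinB subr0/=.
  by rewrite mul0r mulr1 expr1n expr0n addr0.
have p0 : pi != 0 :> R by rewrite gt_eqF// pi_gt0.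
pose c := 2 * pi * x; have c0 : c != 0 by rewrite !mulf_neq0.
have cont (g : R -> R) : continuous g -> continuous (fun t => g (c * t)).
  by move=> cg t; apply: continuous_comp; [exact: mulrl_continuous|exact: cg].
under eq_Rintegral do rewrite mulrA.
under [X in _ + X ^+ 2]eq_Rintegral do rewrite mulrA.
rewrite (Rintegral01_derive (fun t => is_derive_sin_scale t c0)); last first.
  exact/cont/continuous_cos.
rewrite (Rintegral01_derive (fun t => is_derive_cos_scale t c0)); last first.
  exact/cont/continuous_sin.
rewrite !mulr0 !mulr1 sin0 cos0 mul0r subr0.
(* The half-angle identity sin(c)^2 + (1 - cos(c))^2 = 4 sin(c / 2)^2 produces the square of
   sinc. *)
have -> : c = (pi * x) *+ 2 by rewrite -mulr_natr /c; ring.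
have := cos2Dsin2 (pi * x); rewrite cos_mulr2n sin_mulr2n.
move: p0; generalize (@pi R) => P P0.
generalize (cos (P * x)) => C; generalize (sin (P * x)) => S cs.
transitivity (((C * S * 2) ^+ 2 + (2 - C ^+ 2 * 2) ^+ 2) / (P * x * 2) ^+ 2).
  by field; rewrite P0 x0.
have -> : (C * S * 2) ^+ 2 + (2 - C ^+ 2 * 2) ^+ 2 = 4 * S ^+ 2.
  have -> : C ^+ 2 = 1 - S ^+ 2 by lra.
  have -> : (C * S * 2) ^+ 2 = 4 * C ^+ 2 * S ^+ 2 by ring.
  have -> : C ^+ 2 = 1 - S ^+ 2 by lra.
  ring.
by field; rewrite P0 x0.
Qed.

End trig_integral.

(** * The Fourier transform of the cube in any dimension *)

Section cube_integral.
Context (R : realType).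

Lemma measurable_cos : measurable_fun setT (@cos R).
Proof. by apply: continuous_measurable_fun; exact: continuous_cos. Qed.

Lemma measurable_sin : measurable_fun setT (@sin R).
Proof. by apply: continuous_measurable_fun; exact: continuous_sin. Qed.

Lemma dotv_vcons d (x y : vec R d.+1) :
  dotv x y = x ord0 0 * y ord0 0 + dotv (vtail x) (vtail y).
Proof.
by rewrite /dotv big_ord_recl; congr (_ + _); apply: eq_bigr => i _; rewrite !mxE.
Qed.

Lemma measurable_dotv d (x : vec R d) : measurable_fun setT (dotv x).
Proof.
apply: measurable_sum => j; apply: measurable_funM => //.
exact: measurable_coord.
Qed.

Lemma measurable_ecos d (x : vec R d) : measurable_fun setT (ecos x).
Proof.
apply: (measurableT_comp measurable_cos).
by apply: measurable_funM => //; exact: measurable_dotv.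
Qed.

Lemma measurable_esin d (x : vec R d) : measurable_fun setT (esin x).
Proof.
apply: (measurableT_comp measurable_sin).
by apply: measurable_funM => //; exact: measurable_dotv.
Qed.

Lemma ecos_bound d (x y : vec R d) : `|ecos x y| <= 1.
Proof. exact: cos_max. Qed.

Lemma esin_bound d (x y : vec R d) : `|esin x y| <= 1.
Proof. exact: sin_max. Qed.

Lemma Icube_integrable d (f : vec R d -> R) (M : R) :
  measurable_fun setT f -> (forall x, `|f x| <= M) ->
  (@leb_outer R d).-integrable (@Icube R d) (EFin \o f).
Proof.
move=> mf fM; apply: (bounded_integrable (M := M)) => //.
- exact: measurable_Icube.
- by rewrite /= leb_Icube ltry.
- exact: measurable_funTS.
Qed.

Definition cosI d (x : vec R d) : R := (\int[@leb_outer R d]_(y in @Icube R d) ecos x y)%R.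
Definition sinI d (x : vec R d) : R := (\int[@leb_outer R d]_(y in @Icube R d) esin x y)%R.

Definition sincW d (x : vec R d) : R := \prod_(j < d) sinc2 (x j 0).

(** [cosI] and [sinI] are the real and imaginary parts of the transform. Splitting off one
    coordinate multiplies two complex numbers, and squared moduli are multiplicative. *)
Lemma cosI_sinI d (x : vec R d) : cosI x ^+ 2 + sinI x ^+ 2 = sincW x.
Proof.
elim: d x => [|d IH] x.
  rewrite /sincW big_ord0 /cosI /sinI.
  under eq_Rintegral do rewrite /ecos /dotv big_ord0 mulr0 cos0.
  under [X in _ + X ^+ 2]eq_Rintegral do rewrite /esin /dotv big_ord0 mulr0 sin0.
  have mI := @measurable_Icube R 0.
  by rewrite !Rintegral_cst//= leb_Icube/= mul0r mulr1 expr1n expr0n addr0.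
pose a := x ord0 0; pose x' := vtail x.
pose c (t : R) : R := cos (2 * pi * (a * t)); pose s (t : R) : R := sin (2 * pi * (a * t)).
have mm : measurable_fun setT (fun t : R => 2 * pi * (a * t)).
  by do 2 apply: measurable_funM => //.
have mc : measurable_fun setT c.
  exact: measurableT_comp measurable_cos mm.
have ms : measurable_fun setT s.
  exact: measurableT_comp measurable_sin mm.
have cM t : `|c t| <= 1 by exact: cos_max.
have sM t : `|s t| <= 1 by exact: sin_max.
pose p (f : R -> R) (g : vec R d -> R) (y : vec R d.+1) := f (y ord0 0) * g (vtail y).
have pI (f : R -> R) (g : vec R d -> R) : measurable_fun setT f -> measurable_fun setT g ->
    (forall t, `|(f t : R)| <= 1) -> (forall t, `|(g t : R)| <= 1) ->
    (@leb_outer R d.+1).-integrable (@Icube R d.+1) (EFin \o p f g).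
  move=> mf mg f1 g1; apply: (@Icube_integrable _ _ 1).
    apply: measurable_funM; first exact: measurableT_comp mf (measurable_coord _).
    exact: measurableT_comp mg (@measurable_vtail R d).
  by move=> y; rewrite normrM -[leRHS]mul1r ler_pM.
have mI := @measurable_Icube R d.+1.
have mec := measurable_ecos x'; have mes := measurable_esin x'.
have ec1 := ecos_bound x'; have es1 := esin_bound x'.
have Ec : cosI x = (\int[@lebesgue_measure R]_(t in `[0%R, 1%R[) c t)%R * cosI x' -
    (\int[@lebesgue_measure R]_(t in `[0%R, 1%R[) s t)%R * sinI x'.
  rewrite /cosI /sinI -!(@Icube_fubini _ _ _ _ 1)//.
  rewrite -RintegralB//; [|exact: (pI c)|exact: (pI s)].
  apply: eq_Rintegral => y _.
  by rewrite /ecos dotv_vcons mulrDr cosD.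
have Es : sinI x = (\int[@lebesgue_measure R]_(t in `[0%R, 1%R[) s t)%R * cosI x' +
    (\int[@lebesgue_measure R]_(t in `[0%R, 1%R[) c t)%R * sinI x'.
  rewrite /cosI /sinI -!(@Icube_fubini _ _ _ _ 1)//.
  rewrite -RintegralD//; [|exact: (pI s)|exact: (pI c)].
  apply: eq_Rintegral => y _.
  by rewrite /esin dotv_vcons mulrDr sinD.
have -> : sincW x = sinc2 a * sincW x'.
  by rewrite /sincW big_ord_recl; congr (_ * _); apply: eq_bigr => i _; rewrite mxE.
rewrite -IH -(trig_integral01 a) Ec Es; ring.
Qed.

Lemma sincW_ge0 d (x : vec R d) : 0 <= sincW x.
Proof. by apply: prodr_ge0 => j _; exact: sinc2_ge0. Qed.

Lemma sincW0 d : sincW (0 : vec R d) = 1.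
Proof. by rewrite /sincW big1// => j _; rewrite mxE /sinc2 eqxx. Qed.

Lemma sincW_eq0 d (x y : vec R d) : sincW (x - y) = 0 <-> exists j, keller_coord x y j.
Proof.
split=> [/eqP/prodf_eq0[j _ /eqP/sinc2_eq0[h1 h2]]|[j [h1 h2]]].
  exists j; rewrite !vecE in h1 h2; split=> // E; apply: h2.
  by rewrite E subrr.
apply/eqP/prodf_eq0; exists j => //; apply/eqP/sinc2_eq0; rewrite !vecE; split=> //.
by move=> /eqP; rewrite subr_eq0 => /eqP.
Qed.

End cube_integral.

(** * Orthogonal expansions *)

Section inner_product.
Context (R : realType) (V : lmodType R) (P : V -> Prop) (B : V -> V -> R).
Hypothesis P0 : P 0.
Hypothesis PD : forall f g, P f -> P g -> P (f + g).
Hypothesis PZ : forall a f, P f -> P (a *: f).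
Hypothesis BC : forall f g, B f g = B g f.
Hypothesis BD : forall f g h, P f -> P g -> P h -> B (f + g) h = B f h + B g h.
Hypothesis BZ : forall a f h, P f -> P h -> B (a *: f) h = a * B f h.
Hypothesis B_ge0 : forall f, 0 <= B f f.

Let PN f : P f -> P (- f).
Proof. by move=> Pf; rewrite -scaleN1r; exact: PZ. Qed.

Let BN f h : P f -> P h -> B (- f) h = - B f h.
Proof. by move=> Pf Ph; rewrite -scaleN1r BZ// mulN1r. Qed.

(** The form is only semidefinite, as functions equal almost everywhere are not identified. When
    [B g g = 0] the quadratic [key] is affine in t, and a large t makes it negative unless
    [B f g = 0]. *)
Lemma cauchy_schwarz f g : P f -> P g -> B f g ^+ 2 <= B f f * B g g.
Proof.
move=> Pf Pg.
have key t : 0 <= B f f - t * B f g *+ 2 + t ^+ 2 * B g g.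
  have := B_ge0 (f + (- t) *: g).
  have Ptg : P ((- t) *: g) by exact: PZ.
  have Pftg := PD Pf Ptg.
  rewrite BD// BZ// ![B _ (f + _)]BC !BD// !BZ// (BC g f).
  move=> h; apply: le_trans h _; rewrite le_eqVlt; apply/orP; left; apply/eqP; ring.
have := B_ge0 g; rewrite le_eqVlt => /predU1P[g0|g0].
  rewrite -g0 mulr0; have [->|fg] := eqVneq (B f g) 0; first by rewrite expr0n.
  have := key ((B f f + 1) / B f g); rewrite -g0 mulr0 addr0 mulfVK//.
  by have := B_ge0 f; lra.
have := key (B f g / B g g).
rewrite -(ler_pM2r g0) mul0r; set x := B f g; set y := B f f; set z := B g g.
move=> h; rewrite -subr_ge0; apply: le_trans h _.
by rewrite le_eqVlt; apply/orP; left; apply/eqP; field; rewrite gt_eqF.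
Qed.

Section residual.
Context (K : eqType) (e : K -> V) (s : seq K).
Hypothesis us : uniq s.
Hypothesis Pe : forall k, P (e k).
Hypothesis one : forall k l, k \in s -> l \in s -> B (e k) (e l) = (k == l)%:R.

Definition residual (f : V) : V := f - \sum_(k <- s) B f (e k) *: e k.

Let Psum (a : K -> R) (r : seq K) : P (\sum_(k <- r) a k *: e k).
Proof.
elim: r => [|k r IH]; first by rewrite big_nil.
by rewrite big_cons; apply: PD => //; exact: PZ.
Qed.

Let Bsum (a : K -> R) (r : seq K) h : P h ->
  B (\sum_(k <- r) a k *: e k) h = \sum_(k <- r) a k * B (e k) h.
Proof.
move=> Ph; elim: r => [|k r IH].
  rewrite !big_nil -(scale0r h) BZ// ?mul0r//.
by rewrite !big_cons BD ?BZ ?IH//; exact: PZ.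
Qed.

Lemma P_residual f : P f -> P (residual f).
Proof.
by move=> Pf; apply: PD => //; apply: PN; exact: Psum.
Qed.

Lemma residualE f h : P f -> P h ->
  B (residual f) h = B f h - \sum_(k <- s) B f (e k) * B (e k) h.
Proof.
move=> Pf Ph; rewrite /residual.
by rewrite BD ?BN ?Bsum//; apply: PN; exact: Psum.
Qed.

Lemma residual_orth f l : P f -> l \in s -> B (residual f) (e l) = 0.
Proof.
move=> Pf ls; rewrite residualE// (bigD1_seq l)//= one// eqxx mulr1 big1_seq ?addr0 ?subrr//.
by move=> k /andP[/negbTE kl ks]; rewrite one// kl mulr0.
Qed.

(** Pythagoras for the orthogonal projection; with [B_ge0] it becomes Bessel's inequality. *)
Lemma residual_norm f : P f ->
  B (residual f) (residual f) = B f f - \sum_(k <- s) B f (e k) ^+ 2.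
Proof.
move=> Pf; have Pr := P_residual Pf; rewrite residualE//.
rewrite [X in _ - X](_ : _ = 0) ?subr0; last first.
  by rewrite big1_seq// => k /andP[_ ks]; rewrite (BC (e k)) residual_orth// mulr0.
by rewrite BC residualE//; congr (_ - _); apply: eq_bigr => k _; rewrite (BC (e k)).
Qed.

End residual.
End inner_product.

Section esum_seq.
Context (R : realType) (I : choiceType) (X : set I) (a : I -> R).

Lemma esum_le_seq (c : \bar R) :
  (forall s : seq I, uniq s -> (forall i, i \in s -> X i) ->
    ((\sum_(i <- s) a i)%:E <= c)%E) ->
  (\esum_(i in X) (a i)%:E <= c)%E.
Proof.
move=> h; apply: ge_ereal_sup => _ [F [finF FX] <-].
rewrite fsbig_finite//= sumEFin; apply: h => // i.
by rewrite in_fset_set// inE => /FX.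
Qed.

Lemma seq_le_esum (s : seq I) : uniq s -> (forall i, i \in s -> X i) ->
  ((\sum_(i <- s) a i)%:E <= \esum_(i in X) (a i)%:E)%E.
Proof.
move=> us sX; apply: esum_ge; exists [set` s]; first by split.
by rewrite -fsbig_seq//= sumEFin.
Qed.

Lemma esum_adherent (c : R) : (c%:E < \esum_(i in X) (a i)%:E)%E ->
  exists s : seq I, [/\ uniq s, forall i, i \in s -> X i & c < \sum_(i <- s) a i].
Proof.
move=> /ereal_sup_gt[_ [F [finF FX] <-]].
rewrite fsbig_finite//= sumEFin lte_fin => cF.
exists (finmap.enum_fset (fset_set F)); split=> // i.
by rewrite in_fset_set// inE => /FX.
Qed.

End esum_seq.

(** * Square-integrable functions on the cube and Bessel's inequality *)

Section L2cube.
Context (R : realType) (d : nat).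
Local Notation V := (vec R d).
Local Notation mu := (@leb_outer R d).
Local Notation I := (@Icube R d).
Let mI := @measurable_Icube R d.

Definition square_integrable (u : V -> R) : Prop :=
  measurable_fun I u /\ mu.-integrable I (EFin \o (fun x => u x ^+ 2)).

Lemma square_integrableM u v : square_integrable u -> square_integrable v ->
  mu.-integrable I (EFin \o (fun x => u x * v x)).
Proof.
move=> [mu_ iu] [mv iv].
apply: (le_integrable mI _ _ (integrableD mI iu iv)).
  by apply/measurable_EFinP; exact: measurable_funM.
move=> x _; rewrite /= lee_fin [leRHS]ger0_norm ?addr_ge0 ?sqr_ge0//.
rewrite ler_norml; have h1 := sqr_ge0 (u x + v x); have h2 := sqr_ge0 (u x - v x).
by have h3 := sqr_ge0 (u x); have h4 := sqr_ge0 (v x); apply/andP; split; nra.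
Qed.

Lemma square_integrableD u v : square_integrable u -> square_integrable v ->
  square_integrable (fun x => u x + v x).
Proof.
move=> su sv; split; first by apply: measurable_funD; [exact: su.1|exact: sv.1].
have iuv := square_integrableM su sv.
have := integrableD mI (integrableD mI su.2 sv.2) (integrableZl mI 2 iuv).
apply: eq_integrable => // x _ /=; rewrite -EFinM -!EFinD; congr EFin; ring.
Qed.

Lemma square_integrableZ a u : square_integrable u ->
  square_integrable (fun x => a * u x).
Proof.
move=> su; split; first by apply: measurable_funM => //; exact: su.1.
apply: eq_integrable (integrableZl mI (a ^+ 2) su.2) => // x _ /=.
by rewrite -EFinM exprMn.
Qed.

Lemma square_integrable_bounded (u : V -> R) (M : R) : measurable_fun setT u ->
  (forall x, `|u x| <= M) -> square_integrable u.
Proof.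
move=> mu_ uM; split; first exact: measurable_funTS.
apply: (@Icube_integrable _ _ _ (M ^+ 2)); first exact: measurable_funX.
by move=> x; rewrite normrX ler_pXn2r ?nnegrE// (le_trans _ (uM x)).
Qed.

Lemma square_integrable_int u : square_integrable u -> mu.-integrable I (EFin \o u).
Proof.
move=> su; have := @square_integrable_bounded (fun=> 1) 1 ltac:(exact: measurable_cst) ltac:(by move=> x; rewrite normr1).
move=> /(square_integrableM su); apply: eq_integrable => // x _ /=.
by rewrite mulr1.
Qed.

Definition F2 : lmodType R := ((V -> R) * (V -> R))%type.

Definition sq2 (f : F2) : Prop := square_integrable f.1 /\ square_integrable f.2.

(** With complex functions as pairs of real ones, this is the real part of the complex inner
    product. The imaginary part is the pairing with i times the second function, so every
    exponential contributes two real vectors, [expE x] and [expJ x]. *)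
Definition ip (f g : F2) : R :=
  (\int[mu]_(x in I) (f.1 x * g.1 x) + \int[mu]_(x in I) (f.2 x * g.2 x))%R.

Lemma sq2D f g : sq2 f -> sq2 g -> sq2 (f + g).
Proof. by move=> [f1 f2] [g1 g2]; split; exact: square_integrableD. Qed.

Lemma sq2Z a f : sq2 f -> sq2 (a *: f).
Proof. by move=> [f1 f2]; split; exact: square_integrableZ. Qed.

Lemma ipC f g : ip f g = ip g f.
Proof.
by rewrite /ip; congr (_ + _); apply: eq_Rintegral => x _; rewrite mulrC.
Qed.

Lemma ipD f g h : sq2 f -> sq2 g -> sq2 h -> ip (f + g) h = ip f h + ip g h.
Proof.
move=> [f1 f2] [g1 g2] [h1 h2]; rewrite /ip addrACA.
by congr (_ + _); (rewrite -RintegralD//; [|exact: square_integrableM..]);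
  apply: eq_Rintegral => x _; rewrite mulrDl.
Qed.

Lemma ipZ a f h : sq2 f -> sq2 h -> ip (a *: f) h = a * ip f h.
Proof.
move=> [f1 f2] [h1 h2]; rewrite /ip mulrDr.
by congr (_ + _); (rewrite -RintegralZl//; [|exact: square_integrableM..]);
  apply: eq_Rintegral => x _; rewrite mulrA.
Qed.

Lemma ip_ge0 f : 0 <= ip f f.
Proof. by apply: addr_ge0; apply: Rintegral_ge0 => x _; rewrite -expr2 sqr_ge0. Qed.

Definition expE (x : V) : F2 := (ecos x, esin x).
Definition expJ (x : V) : F2 := (fun y => - esin x y, ecos x).
Definition exps (k : V * bool) : F2 := if k.2 then expJ k.1 else expE k.1.

Lemma sq2_exps k : sq2 (exps k).
Proof.
have sc x : square_integrable (ecos x).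
  exact: square_integrable_bounded (measurable_ecos x) (ecos_bound x).
have ss x : square_integrable (esin x).
  exact: square_integrable_bounded (measurable_esin x) (esin_bound x).
case: k => x []; split; [|exact: sc|exact: sc|exact: ss].
apply: (square_integrable_bounded (M := 1)).
  by apply: measurableT_comp => //; exact: measurable_esin.
by move=> y; rewrite normrN esin_bound.
Qed.

Lemma sq2_expE x : sq2 (expE x). Proof. exact: (sq2_exps (x, false)). Qed.
Lemma sq2_expJ x : sq2 (expJ x). Proof. exact: (sq2_exps (x, true)). Qed.

Lemma sq2_0 : sq2 0.
Proof. by rewrite -(scale0r (expE 0)); apply: sq2Z; exact: sq2_expE. Qed.

Lemma dotvB (x y z : V) : dotv (x - y) z = dotv x z - dotv y z.
Proof.
by rewrite /dotv -sumrB; apply: eq_bigr => i _; rewrite !vecE mulrBl.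
Qed.

Lemma ecosB (x y z : V) : ecos (x - y) z = ecos x z * ecos y z + esin x z * esin y z.
Proof. by rewrite /ecos /esin dotvB mulrBr cosB. Qed.

Lemma esinB (x y z : V) : esin (x - y) z = esin x z * ecos y z - ecos x z * esin y z.
Proof. by rewrite /ecos /esin dotvB mulrBr sinB. Qed.

Let ipE f g (h : V -> R) : sq2 f -> sq2 g ->
  (forall x, f.1 x * g.1 x + f.2 x * g.2 x = h x) -> ip f g = (\int[mu]_(x in I) h x)%R.
Proof.
move=> [f1 f2] [g1 g2] fgh; rewrite /ip -RintegralD//; try exact: square_integrableM.
by apply: eq_Rintegral => x _; exact: fgh.
Qed.

Lemma ipEE x y : ip (expE x) (expE y) = cosI (x - y).
Proof. by apply: ipE => [||z]; [exact: sq2_expE..|rewrite ecosB]. Qed.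

Lemma ipEJ x y : ip (expE x) (expJ y) = sinI (x - y).
Proof.
apply: ipE => [||z]; [exact: sq2_expE|exact: sq2_expJ|rewrite esinB/=; ring].
Qed.

Lemma ipJJ x y : ip (expJ x) (expJ y) = cosI (x - y).
Proof. by apply: ipE => [||z]; [exact: sq2_expJ..|rewrite ecosB/=; ring]. Qed.

(** All pairings are [cosI] or [sinI] of a difference of frequencies. Their squares add up to
    [sincW], which vanishes at separated frequencies, so both vanish. *)
Lemma exps_orthonormal (s : seq V) : keller_family [set` s] id ->
  forall k l, k.1 \in s -> l.1 \in s -> ip (exps k) (exps l) = (k == l)%:R.
Proof.
move=> ks.
have c0 : cosI (0 : V) = 1 /\ sinI (0 : V) = 0.
  have s0 : sinI (0 : V) = 0.
    rewrite /sinI; under eq_Rintegral => x _.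
      rewrite /esin (_ : dotv 0 x = 0) ?mulr0 ?sin0; last first.
        by rewrite /dotv big1// => i _; rewrite mxE mul0r.
      over.
    by rewrite Rintegral_cst// mul0r.
  split => //; rewrite /cosI; under eq_Rintegral => x _.
    rewrite /ecos (_ : dotv 0 x = 0) ?mulr0 ?cos0; last first.
      by rewrite /dotv big1// => i _; rewrite mxE mul0r.
    over.
  by rewrite Rintegral_cst//= leb_Icube mulr1.
have cs0 (x y : V) : x \in s -> y \in s -> x <> y -> cosI (x - y) = 0 /\ sinI (x - y) = 0.
  move=> xs ys xy; have := cosI_sinI (x - y).
  rewrite (sincW_eq0 x y).2; last exact: ks.
  move=> /eqP; rewrite paddr_eq0 ?sqr_ge0// !sqrf_eq0 => /andP[/eqP -> /eqP ->].
  by [].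
move=> [x b] [y c] /= xs ys.
have [<-|xy] := eqVneq x y.
  by case: b; case: c; rewrite /exps/= ?ipEE ?ipJJ ?[ip (expJ _) (expE _)]ipC ?ipEJ
    subrr ?c0.1 ?c0.2 xpair_eqE eqxx.
have [h1 h2] := cs0 _ _ xs ys (elimN eqP xy).
have [h3 h4] := cs0 _ _ ys xs (elimN eqP (contra_neq esym xy)).
by case: b; case: c; rewrite /exps/= ?ipEE ?ipJJ ?[ip (expJ _) (expE _)]ipC ?ipEJ
  ?h1 ?h2 ?h3 ?h4 xpair_eqE (negbTE xy).
Qed.

Lemma sum_exps (s : seq V) (f : F2) :
  \sum_(k <- [seq (x, b) | x <- s, b <- [:: false; true]]) ip f (exps k) ^+ 2 =
  \sum_(x <- s) (ip f (expE x) ^+ 2 + ip f (expJ x) ^+ 2).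
Proof.
rewrite big_allpairs_dep; apply: eq_bigr => x _.
by rewrite !big_cons big_nil /= addr0.
Qed.

Lemma keller_family_sub (X : set V) (s : seq V) :
  keller_family X id -> (forall i, i \in s -> X i) -> keller_family [set` s] id.
Proof. by move=> kX sX i k /sX Xi /sX Xk; exact: kX. Qed.

Let pairs (s : seq V) := [seq (x, b) | x <- s, b <- [:: false; true]].

Let uniq_pairs s : uniq s -> uniq (pairs s).
Proof. by move=> us; apply: allpairs_uniq => // -[? ?] [? ?]. Qed.

Let mem_pairs s k : (k \in pairs s) = (k.1 \in s).
Proof.
apply/allpairsP/idP => [[[x b] [/= xs _ ->]]//|].
by case: k => x b /= xs; exists (x, b); split=> //; case: b.
Qed.

Definition proj_residual (s : seq V) (f : F2) : F2 := residual ip exps (pairs s) f.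

Section keller_seq.
Context (s : seq V).
Hypotheses (us : uniq s) (ks : keller_family [set` s] id).

Let one k l : k \in pairs s -> l \in pairs s -> ip (exps k) (exps l) = (k == l)%:R.
Proof. rewrite !mem_pairs; exact: exps_orthonormal. Qed.

Lemma sq2_proj_residual f : sq2 f -> sq2 (proj_residual s f).
Proof. exact: (P_residual ip sq2_0 sq2D sq2Z _ sq2_exps). Qed.

Lemma proj_residual_orth f k : sq2 f -> k.1 \in s -> ip (proj_residual s f) (exps k) = 0.
Proof.
move=> sf ksn; apply: (residual_orth sq2_0 sq2D sq2Z ipD ipZ (uniq_pairs us) sq2_exps one) => //.
by rewrite mem_pairs.
Qed.

Lemma proj_residual_norm f : sq2 f -> ip (proj_residual s f) (proj_residual s f) =
  ip f f - \sum_(x <- s) (ip f (expE x) ^+ 2 + ip f (expJ x) ^+ 2).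
Proof.
move=> sf; rewrite -sum_exps.
exact: (residual_norm sq2_0 sq2D sq2Z ipC ipD ipZ (uniq_pairs us) sq2_exps one).
Qed.

Lemma proj_residualE f g : sq2 f -> sq2 g -> ip (proj_residual s f) g =
  ip f g - \sum_(k <- pairs s) ip f (exps k) * ip (exps k) g.
Proof. by move=> sf sg; exact: (residualE sq2_0 sq2D sq2Z ipD ipZ _ sq2_exps). Qed.

End keller_seq.

Lemma ip_exp2 (x y : V) : ip (expE x) (expE y) ^+ 2 + ip (expE x) (expJ y) ^+ 2 = sincW (x - y).
Proof. by rewrite ipEE ipEJ cosI_sinI. Qed.

Lemma ip_exp1 (x : V) : ip (expE x) (expE x) = 1.
Proof.
have kx : keller_family [set` [:: x]] id.
  by move=> i k; rewrite /= !inE => /eqP -> /eqP ->.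
have := @exps_orthonormal [:: x] kx (x, false) (x, false).
by rewrite /= !inE !eqxx; apply.
Qed.

(** Bessel's inequality for the unit vector [expE x]: its two real coefficients at the frequency
    [p i] have squares summing to [sincW (x - p i)]. *)
Lemma sincW_packing (K : choiceType) : packing K (@sincW R d).
Proof.
split=> [x|X p kX x]; first exact: sincW_ge0.
apply: esum_le_seq => s us sX.
have inj_p : {in s &, injective p}.
  move=> i k iS kS pik; apply: contrapT => ik.
  by have [j [_]] := kX _ _ (sX _ iS) (sX _ kS) ik; rewrite pik.
have kp : keller_family [set` map p s] id.
  move=> _ _ /= /mapP[i iS ->] /mapP[k kS ->] pik.
  by apply: kX; [exact: sX..|move=> ik; apply: pik; rewrite ik].
have ump : uniq (map p s) by rewrite map_inj_in_uniq.
have := ip_ge0 (proj_residual (map p s) (expE x)).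
rewrite (proj_residual_norm ump kp); last exact: sq2_expE.
rewrite ip_exp1 big_map lee_fin subr_ge0.
by under eq_bigr do rewrite ip_exp2.
Qed.

End L2cube.

(** * Completeness of the exponentials *)

Section smooth_sign.
Context (R : realType).

(** A polynomial map of [-1, 1] into itself that fixes -1, 0 and 1 and attracts every other point to
    the nearer end, so its iterates are polynomials tending to the sign. *)
Definition smoothstep (t : R) : R := (3 * t - t ^+ 3) / 2.

Lemma smoothstep_bound t : `|t| <= 1 -> `|smoothstep t| <= 1.
Proof.
rewrite !ler_norml => /andP[h1 h2]; rewrite /smoothstep.
have E1 : 1 - (3 * t - t ^+ 3) / 2 = (1 - t) ^+ 2 * (2 + t) / 2 by field.
have E2 : 1 + (3 * t - t ^+ 3) / 2 = (1 + t) ^+ 2 * (2 - t) / 2 by field.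
have p1 : 0 <= (1 - t) ^+ 2 * (2 + t) / 2.
  by rewrite divr_ge0// mulr_ge0 ?sqr_ge0//; lra.
have p2 : 0 <= (1 + t) ^+ 2 * (2 - t) / 2.
  by rewrite divr_ge0// mulr_ge0 ?sqr_ge0//; lra.
by rewrite -E1 in p1; rewrite -E2 in p2; apply/andP; split; lra.
Qed.

Lemma iter_smoothstep_bound n t : `|t| <= 1 -> `|iter n smoothstep t| <= 1.
Proof. by move=> t1; elim: n => //= n IH; exact: smoothstep_bound. Qed.

Lemma smoothstepN t : smoothstep (- t) = - smoothstep t.
Proof. by rewrite /smoothstep; field. Qed.

Lemma cvg_iter_smoothstep t : `|t| <= 1 -> iter n smoothstep t @[n --> \oo] --> Num.sg t.
Proof.
wlog t0 : t / 0 <= t.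
  move=> H t1; have [t0|t0] := leP 0 t; first exact: H.
  rewrite -[t]opprK sgrN.
  have -> : (fun n => iter n smoothstep (- - t)) = (fun n => - iter n smoothstep (- t)).
    apply/funext => n; elim: n => [|n IH]//=; by rewrite IH smoothstepN.
  by apply: cvgN; apply: H; rewrite ?normrN//; lra.
move=> t1; move: t0; rewrite le_eqVlt => /predU1P[<-|t0].
  rewrite sgr0 (_ : (fun n => _) = (fun=> 0)); first exact: cvg_cst.
  by apply/funext; elim=> //= n ->; rewrite /smoothstep expr0n mulr0 subrr mul0r.
rewrite gtr0_sg//; rewrite (ger0_norm (ltW t0)) in t1.
(* The distance e to 1 is mapped to e * (e * (3 - e) / 2). The factor increases on [0, 1] and is
   below 1 for e < 1, so its initial value [rho] bounds all later ones. *)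
pose e := 1 - t; pose rho := e * (3 - e) / 2.
have rho1 : `|rho| < 1.
  rewrite ger0_norm; last by rewrite /rho divr_ge0// mulr_ge0//; rewrite /e; lra.
  rewrite ltr_pdivrMr// mul1r /e; nra.
have key n : 0 <= 1 - iter n smoothstep t <= rho ^+ n * e.
  elim: n => [|n /andP[h1 h2]]; first by rewrite mul1r /e /= lexx andbT; lra.
  have le1 : rho ^+ n * e <= e.
    rewrite -[leRHS]mul1r ler_wpM2r//; first by rewrite /e; lra.
    apply: exprn_ile1; last exact: ltW (le_lt_trans (ler_norm _) rho1).
    by rewrite /rho divr_ge0// mulr_ge0//; rewrite /e; lra.
  set y := iter n smoothstep t in h1 h2 *; rewrite /= -/y.
  have ye : 1 - y <= e := le_trans h2 le1.
  have -> : 1 - smoothstep y = (1 - y) * ((1 - y) * (3 - (1 - y)) / 2).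
    by rewrite /smoothstep; field.
  have r0 : 0 <= (1 - y) * (3 - (1 - y)) / 2.
    by rewrite divr_ge0// mulr_ge0//; move: ye; rewrite /e; lra.
  rewrite mulr_ge0//= exprSr [leRHS]mulrAC; apply: ler_pM => //.
  rewrite /rho ler_pM2r ?invr_gt0//.
  move: ye; rewrite /e; nra.
suff : (fun n => 1 - (1 - iter n smoothstep t)) @ \oo --> (1 - 0 : R).
  by rewrite subr0; under eq_fun do rewrite subKr.
apply: cvgB; first exact: cvg_cst.
apply: (@squeeze_cvgr _ _ _ _ (fun=> 0) (fun n => rho ^+ n * e)).
- by apply: nearW => n; exact: key.
- exact: cvg_cst.
- by rewrite -[X in _ --> X](mul0r e); apply: cvgMl; exact: cvg_expr.
Qed.

End smooth_sign.

(** * A function orthogonal to all exponentials vanishes almost everywhere *)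

Section multiplier.
Context (R : realType) (d : nat).
Local Notation V := (vec R d).
Local Notation mu := (@leb_outer R d).
Local Notation I := (@Icube R d).
Let mI := @measurable_Icube R d.

Definition exp_null (u : V -> R) : Prop :=
  mu.-integrable I (EFin \o u) /\ forall x : V,
    (\int[mu]_(y in I) (u y * ecos x y) = 0)%R /\
    (\int[mu]_(y in I) (u y * esin x y) = 0)%R.

(* Cosines are multipliers, and multipliers are closed under bounded pointwise
   limits; iterating [smoothstep] turns a cosine into a sign, hence yields the
   indicators of half-spaces and then of all Borel sets. *)
Definition multiplier (g : V -> R) : Prop :=
  [/\ measurable_fun I g, exists M : R, forall x, I x -> `|g x| <= M &
    forall u, exp_null u -> exp_null (fun x => g x * u x)].

Let intM (u g : V -> R) (M : R) : mu.-integrable I (EFin \o u) -> measurable_fun I g ->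
  (forall x, I x -> `|g x| <= M) -> mu.-integrable I (EFin \o (fun x => g x * u x)).
Proof.
move=> iu mg gM.
have mu_ : measurable_fun I u by apply/measurable_EFinP; case/integrableP : iu.
apply: (le_integrable mI _ _ (integrableZl mI M iu)).
  by apply/measurable_EFinP; exact: measurable_funM.
move=> x Ix; rewrite /= lee_fin !normrM ler_wpM2r//.
by apply: le_trans (gM _ Ix) (ler_norm _).
Qed.

Let intM_cos (u : V -> R) (x : V) : mu.-integrable I (EFin \o u) ->
  mu.-integrable I (EFin \o (fun y => u y * ecos x y)).
Proof.
move=> iu; have me : measurable_fun I (ecos x).
  exact: measurable_funTS (measurable_ecos _).
have := intM iu me (fun y _ => ecos_bound x y).
by apply: eq_integrable => // y _ /=; rewrite mulrC.
Qed.

Let intM_sin (u : V -> R) (x : V) : mu.-integrable I (EFin \o u) ->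
  mu.-integrable I (EFin \o (fun y => u y * esin x y)).
Proof.
move=> iu; have me : measurable_fun I (esin x).
  exact: measurable_funTS (measurable_esin _).
have := intM iu me (fun y _ => esin_bound x y).
by apply: eq_integrable => // y _ /=; rewrite mulrC.
Qed.

Lemma exp_nullD u v : exp_null u -> exp_null v -> exp_null (fun x => u x + v x).
Proof.
move=> [iu hu] [iv hv]; split; first exact: (integrableD mI iu iv).
move=> x; have [hu1 hu2] := hu x; have [hv1 hv2] := hv x; split.
  under eq_Rintegral do rewrite mulrDl.
  by rewrite RintegralD ?hu1 ?hv1 ?addr0//; exact: intM_cos.
under eq_Rintegral do rewrite mulrDl.
by rewrite RintegralD ?hu2 ?hv2 ?addr0//; exact: intM_sin.
Qed.

Lemma exp_nullZ a u : exp_null u -> exp_null (fun x => a * u x).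
Proof.
move=> [iu hu]; split; first exact: (integrableZl mI a iu).
move=> x; have [hu1 hu2] := hu x; split.
  under eq_Rintegral do rewrite -mulrA.
  by rewrite RintegralZl ?hu1 ?mulr0//; exact: intM_cos.
under eq_Rintegral do rewrite -mulrA.
by rewrite RintegralZl ?hu2 ?mulr0//; exact: intM_sin.
Qed.

Lemma exp_null_eq u v : (forall x, I x -> u x = v x) -> exp_null u -> exp_null v.
Proof.
move=> uv [iu hu]; split.
  apply: eq_integrable iu => // x; rewrite inE /= => Ix; by rewrite uv.
move=> x; have [h1 h2] := hu x; split; [rewrite -[RHS]h1|rewrite -[RHS]h2];
  by apply: eq_Rintegral => y; rewrite inE => Iy; rewrite uv.
Qed.

Lemma multiplier_eq g h : (forall x, I x -> g x = h x) -> multiplier g -> multiplier h.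
Proof.
move=> gh [mg [M gM] kg]; split.
- by apply: eq_measurable_fun mg => x; rewrite inE => Ix; rewrite gh.
- by exists M => x Ix; rewrite -gh// gM.
- by move=> u /kg; apply: exp_null_eq => x Ix; rewrite gh.
Qed.

Lemma multiplier_cst a : multiplier (fun=> a).
Proof.
split; [exact: measurable_cst|by exists `|a| => x _|].
by move=> u; exact: exp_nullZ.
Qed.

Lemma multiplierD g h : multiplier g -> multiplier h -> multiplier (fun x => g x + h x).
Proof.
move=> [mg [M gM] kg] [mh [N hN] kh]; split.
- exact: measurable_funD.
- exists (M + N) => x Ix; apply: le_trans (ler_normD _ _) _.
  by rewrite lerD ?gM ?hN.
- move=> u ku; apply: exp_null_eq (exp_nullD (kg _ ku) (kh _ ku)) => x _.
  by rewrite mulrDl.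
Qed.

Lemma multiplierM g h : multiplier g -> multiplier h -> multiplier (fun x => g x * h x).
Proof.
move=> [mg [M gM] kg] [mh [N hN] kh]; split.
- exact: measurable_funM.
- by exists (M * N) => x Ix; rewrite normrM ler_pM ?gM ?hN.
- by move=> u ku; apply: exp_null_eq (kg _ (kh _ ku)) => x _; rewrite mulrA.
Qed.

Lemma multiplier_cvg (g_ : nat -> V -> R) (g : V -> R) (M : R) :
  (forall n, multiplier (g_ n)) -> (forall n x, I x -> `|g_ n x| <= M) ->
  (forall x, I x -> g_ n x @[n --> \oo] --> g x) -> multiplier g.
Proof.
move=> mg_ gM cg.
have mg : measurable_fun I g.
  by apply: (measurable_fun_cvg (h := g_)) => // n; case: (mg_ n).
have gM' x : I x -> `|g x| <= M.
  move=> Ix; have c : `|g_ n x| @[n --> \oo] --> `|g x|.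
    by apply: cvg_norm; exact: cg.
  rewrite -(cvg_lim (@Rhausdorff R) c); apply: limr_le.
    by apply/cvg_ex; exists `|g x|.
  by apply: nearW => n; exact: gM.
split=> //; first by exists M.
move=> u [iu hu]; split; first exact: intM gM'.
have lim0 (h : V -> R) : measurable_fun I h -> (forall x, `|h x| <= 1) ->
    (forall n, \int[mu]_(y in I) (g_ n y * u y * h y) = 0)%R ->
    (\int[mu]_(y in I) (g y * u y * h y) = 0)%R.
  move=> mh h1 h0.
  have iabs : mu.-integrable I (fun x => (M * `|u x|)%:E).
    have := integrableZl mI M (integrable_norm iu); exact: eq_integrable.
  have mu_ : measurable_fun I u by apply/measurable_EFinP; case/integrableP : iu.
  have c := @dominated_cvg _ _ _ mu I mI (fun n y => (g_ n y * u y * h y)%:E)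
    (fun y => (g y * u y * h y)%:E) _ _ _ _ iabs _.
  rewrite /Rintegral; suff -> : (\int[mu]_(y in I) (g y * u y * h y)%:E = 0)%E by [].
  apply: (cvg_unique (@ereal_hausdorff R) (c _ _ _ _)) => //.
  - move=> n; apply/measurable_EFinP; do 2 apply: measurable_funM => //.
    by case: (mg_ n).
  - move=> y Iy; apply/cvg_EFin; first exact: nearW.
    by apply: cvgMl; apply: cvgMl; exact: cg.
  - move=> n y Iy; rewrite lee_fin !normrM -[leRHS]mulr1 ler_pM//.
    by rewrite ler_wpM2r// gM.
  have -> : (fun n => \int[mu]_(y in I) (g_ n y * u y * h y)%:E)%E = (fun=> 0%E).
    apply/funext => n; rewrite -[RHS]/((0 : R)%:E) -(h0 n) fineK//.
    apply: integrable_fin_num => //.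
    apply: (le_integrable mI _ _ iabs).
      apply/measurable_EFinP; do 2 apply: measurable_funM => //.
      by case: (mg_ n).
    move=> y Iy; rewrite lee_fin !normrM normr_id -[leRHS]mulr1 ler_pM//.
    by rewrite ler_wpM2r// (le_trans (gM n y Iy))// ler_norm.
  exact: cvg_cst.
move=> x; split; apply: lim0.
- exact: measurable_funTS (measurable_ecos _).
- exact: ecos_bound.
- by move=> n; have [_ _ k] := mg_ n; have [_ /(_ x)[]] := k u (conj iu hu).
- exact: measurable_funTS (measurable_esin _).
- exact: esin_bound.
- by move=> n; have [_ _ k] := mg_ n; have [_ /(_ x)[]] := k u (conj iu hu).
Qed.

Lemma dotvD (x y z : V) : dotv (x + y) z = dotv x z + dotv y z.
Proof. by rewrite /dotv -big_split; apply: eq_bigr => i _; rewrite !vecE mulrDl. Qed.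

(** Product formulas turn the pairing at [y] into half the sum of those at [y + x] and [y - x];
    hence [exp_null] involves every real frequency. *)
Lemma multiplier_ecos (x : V) : multiplier (ecos x).
Proof.
split; first exact: measurable_funTS (measurable_ecos _).
  by exists 1 => y _; exact: ecos_bound.
move=> u [iu hu]; split.
  by apply: eq_integrable (intM_cos x iu) => // y _ /=; rewrite mulrC.
move=> y; have [p1 p2] := hu (y + x); have [m1 m2] := hu (y - x).
have cD z : ecos (y + x) z = ecos y z * ecos x z - esin y z * esin x z.
  by rewrite /ecos /esin dotvD mulrDr cosD.
have sD z : esin (y + x) z = esin y z * ecos x z + ecos y z * esin x z.
  by rewrite /ecos /esin dotvD mulrDr sinD.
split.
  transitivity (2^-1 * (\int[mu]_(z in I) (u z * ecos (y + x) z) +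
      \int[mu]_(z in I) (u z * ecos (y - x) z)))%R.
    rewrite -RintegralD//; [|exact: intM_cos..]; rewrite -RintegralZl//.
      apply: eq_Rintegral => z _; rewrite cD ecosB; by field.
    by have := integrableD mI (intM_cos (y + x) iu) (intM_cos (y - x) iu); apply: eq_integrable.
  by rewrite p1 m1 addr0 mulr0.
transitivity (2^-1 * (\int[mu]_(z in I) (u z * esin (y + x) z) +
    \int[mu]_(z in I) (u z * esin (y - x) z)))%R.
  rewrite -RintegralD//; [|exact: intM_sin..]; rewrite -RintegralZl//.
    apply: eq_Rintegral => z _; rewrite sD esinB; by field.
  by have := integrableD mI (intM_sin (y + x) iu) (intM_sin (y - x) iu); apply: eq_integrable.
by rewrite p2 m2 addr0 mulr0.
Qed.

Lemma multiplier_iter_smoothstep g n : multiplier g ->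
  multiplier (fun x => iter n (@smoothstep R) (g x)).
Proof.
move=> mg; elim: n => [//|n IH] /=.
apply: (@multiplier_eq (fun x => iter n (@smoothstep R) (g x) * (3 / 2) +
   iter n (@smoothstep R) (g x) * (iter n (@smoothstep R) (g x) *
    (iter n (@smoothstep R) (g x) * (- 2^-1))))).
  by move=> x _; rewrite /smoothstep; field.
apply: multiplierD; first exact: multiplierM IH (multiplier_cst _).
by do 3 apply: multiplierM => //; exact: multiplier_cst.
Qed.

Lemma multiplier_sg g : multiplier g -> (forall x, I x -> `|g x| <= 1) ->
  multiplier (fun x => Num.sg (g x)).
Proof.
move=> mg g1; apply: (@multiplier_cvg (fun n x => iter n (@smoothstep R) (g x)) _ 1).
- by move=> n; exact: multiplier_iter_smoothstep.
- by move=> n x Ix; apply: iter_smoothstep_bound; exact: g1.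
- by move=> x Ix; apply: cvg_iter_smoothstep; exact: g1.
Qed.

Definition mult_set (A : set V) : Prop := multiplier (\1_A : V -> R).

Lemma mult_setC A : mult_set A -> mult_set (~` A).
Proof.
move=> mA; apply: (@multiplier_eq (fun x => 1 + (-1) * (\1_A x : R))).
  by move=> x _; rewrite !indicE in_setC; case: (_ \in _); rewrite /=; ring.
by apply: multiplierD; [|apply: multiplierM => //]; exact: multiplier_cst.
Qed.

Lemma mult_setI A B : mult_set A -> mult_set B -> mult_set (A `&` B).
Proof.
move=> mA mB; apply: (multiplier_eq _ (multiplierM mA mB)) => x _.
by rewrite indicI.
Qed.

Lemma mult_setU A B : mult_set A -> mult_set B -> mult_set (A `|` B).
Proof.
move=> mA mB; rewrite -[A `|` B]setCK setCU.
by apply: mult_setC; apply: mult_setI; exact: mult_setC.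
Qed.

Lemma mult_set0 : mult_set set0.
Proof. by apply: multiplier_eq (multiplier_cst 0) => x _; rewrite indic0. Qed.

Lemma mult_bigcup (F : (set V)^nat) : (forall n, mult_set (F n)) ->
  mult_set (\bigcup_n F n).
Proof.
move=> mF; pose G n := \big[setU/set0]_(i < n) F i.
have mG n : mult_set (G n).
  by rewrite /G; elim/big_ind : _ => //; [exact: mult_set0|exact: mult_setU].
apply: (@multiplier_cvg (fun n => \1_(G n)) _ 1) => //.
  by move=> n x _; rewrite indicE; case: (_ \in _); rewrite /= ?normr1 ?normr0.
move=> x _; apply: cvg_near_cst.
case: (pselect ((\bigcup_n F n) x)) => [[n _ Fx]|nF].
  have bx : (\bigcup_n F n) x by exists n.
  exists n.+1 => // m /= nm; have Gx : G m x by rewrite /G -bigcup_mkord; exists n.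
  by rewrite !indicE !mem_set.
apply: nearW => n; have Gx : ~ G n x.
  by rewrite /G -bigcup_mkord => -[m _ Fx]; apply: nF; exists m.
by rewrite !indicE !memNset.
Qed.

Lemma mult_halfspace (j : 'I_d) (a : R) : mult_set [set x | x j 0 < a].
Proof.
have [a0|a0] := leP a 0.
  apply: multiplier_eq (multiplier_cst 0) => x Ix.
  rewrite indicE memNset//= => xa; have /andP[] := Ix j; lra.
have [a1|a1] := ltP 1 a.
  apply: multiplier_eq (multiplier_cst 1) => x Ix.
  by rewrite indicE mem_set//=; have /andP[] := Ix j; lra.
(* The half-integer frequency gives cos(pi x_j), which is strictly decreasing on the whole cube, so
   comparing it with cos(pi a) decides x_j < a. *)
pose e : V := 2^-1 *: axis R j.
have eE x : ecos e x = cos (pi * x j 0).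
  rewrite /ecos /dotv (bigD1 j)//= !vecE eqxx mulr1 big1; last first.
    by move=> i /negbTE ij; rewrite !vecE ij mulr0 mul0r.
  by rewrite addr0; congr cos; field.
pose g x := (ecos e x - cos (pi * a)) * 2^-1.
have mg : multiplier g.
  by apply: multiplierM; [apply: multiplierD; [exact: multiplier_ecos|]|];
    exact: multiplier_cst.
have g1 x : I x -> `|g x| <= 1.
  move=> _; rewrite /g eE normrM (@ger0_norm _ 2^-1)// ler_pdivrMr// mul1r.
  apply: le_trans (ler_normB _ _) _.
  by have := cos_max (pi * x j 0); have := cos_max (pi * a); lra.
have ms := multiplier_sg mg g1.
(* (s^2 + s) / 2 is 1 for s = 1 and 0 for s = 0 or -1, so points with x_j = a are correctly left
   out. *)
apply: (@multiplier_eq (fun x => (Num.sg (g x) * Num.sg (g x) + Num.sg (g x)) * 2^-1)); last first.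
  by apply: multiplierM; [apply: multiplierD => //; exact: multiplierM|exact: multiplier_cst].
move=> x Ix; have /andP[x0 x1] := Ix j; have p0 := pi_gt0 R.
have gE : (0 < g x) = (x j 0 < a).
  rewrite /g pmulr_lgt0// subr_gt0 eE.
  have h (y : R) : 0 <= y <= 1 -> pi * y \in `[0, pi].
    move=> /andP[y0 y1]; have := mulr_ge0 (ltW p0) y0.
    have := ler_wpM2l (ltW p0) y1; rewrite mulr1 in_itv/= => h1 h2.
    by apply/andP.
  rewrite ltr_cos; [by rewrite (ltr_pM2l p0)|..]; apply: h;
    by rewrite ?x0 ?(ltW x1) ?(ltW a0) ?a1.
rewrite indicE; case: (ltP (x j 0) a) => xa.
  by rewrite mem_set//= gtr0_sg ?gE//; field.
rewrite memNset/=; last by move=> ?; lra.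
have : g x <= 0 by rewrite leNgt gE -leNgt.
rewrite le_eqVlt => /predU1P[->|h]; first by rewrite sgr0; field.
by rewrite ltr0_sg//; field.
Qed.

Lemma mult_measurable (A : set V) : measurable A -> mult_set A.
Proof.
apply: borel_ind => [|j c]; last exact: mult_halfspace.
split; first exact: mult_set0.
- by move=> B; rewrite setTD; exact: mult_setC.
- exact: mult_bigcup.
Qed.

Lemma exp_null_int0 u : exp_null u -> (\int[mu]_(y in I) u y = 0)%R.
Proof.
move=> [_ /(_ 0)[h _]]; rewrite -[RHS]h; apply: eq_Rintegral => x _.
rewrite /ecos (_ : dotv 0 x = 0) ?mulr0 ?cos0 ?mulr1//.
by rewrite /dotv big1// => i _; rewrite mxE mul0r.
Qed.

(** Multiplying [u] by the multiplier that is 1 where [u] is positive and -1 elsewhere gives [|u|],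
    whose integral must then be 0. *)
Lemma exp_null_null u : exp_null u -> mu (I `&` [set x | u x != 0]) = 0%E.
Proof.
move=> nu; have iu := nu.1.
have mu_ : measurable_fun I u by apply/measurable_EFinP; case/integrableP : iu.
have mpos : measurable (I `&` [set x | 0 < u x]).
  rewrite (_ : [set x | 0 < u x] = u @^-1` `]0, +oo[%classic); last first.
    by apply/seteqP; split=> x /=; rewrite in_itv/= andbT.
  by apply: mu_ => //; exact: measurable_itv.
have ms : multiplier (fun x => 2 * (\1_(I `&` [set x | 0 < u x]) x : R) - 1).
  apply: multiplierD; last exact: multiplier_cst.
  by apply: multiplierM; [exact: multiplier_cst|exact: mult_measurable].
have [_ _ /(_ u nu)/exp_null_int0] := ms.
rewrite (@eq_Rintegral _ _ _ _ _ (fun x => `|u x|)); last first.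
  move=> x; rewrite inE => Ix; rewrite indicE; have [u0|u0] := ltP 0 (u x).
    by rewrite mem_set// gtr0_norm//=; ring.
  rewrite memNset/=; last by move=> [_ /=]; rewrite ltNge u0.
  by rewrite ler0_norm//; ring.
move=> h0; have iabs : mu.-integrable I (EFin \o (fun x => `|u x|)) by exact: integrable_norm.
have : (\int[mu]_(x in I) `|(EFin \o u) x| = 0)%E.
  rewrite -(fineK (integrable_fin_num mI iabs)) -[RHS]/((0 : R)%:E) -h0.
  by [].
have mEu : measurable_fun I (EFin \o u) by exact/measurable_EFinP.
move=> /(ae_eq_integral_abs mu mI mEu) [N [mN N0 sN]].
apply: (subset_measure0 _ mN _ N0).
  rewrite (_ : [set x | u x != 0] = u @^-1` [set~ 0]); last first.
    by apply/seteqP; split=> x /= /eqP.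
  by apply: mu_ => //; apply: measurableC; exact: measurable_set1.
move=> x [Ix /= ux]; apply: sN => /= /(_ Ix) [/eqP]; exact/negP.
Qed.

End multiplier.

(** * Limits of rapidly Cauchy sequences of square-integrable functions *)

Section riesz_fischer.
Context (R : realType).

Lemma cvg_of_summable_steps (u : nat -> R) :
  (\sum_(n <oo) `|u n - u n.+1|%:E < +oo)%E -> cvgn u.
Proof.
move=> Goo; set G := (\sum_(n <oo) _)%E in Goo.
have G0 : (0 <= G)%E by apply: nneseries_ge0 => n _ _; rewrite lee_fin.
have Gfin : G \is a fin_num by rewrite ge0_fin_numE.
have c : cvgn (series (telescope u)).
  apply: normed_cvg; apply: nondecreasing_is_cvgn.
    by apply: nondecreasing_series => n _ _; exact: normr_ge0.
  exists (fine G) => _ [n _ <-]; rewrite -lee_fin fineK//.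
  apply: (@le_trans _ _ (\sum_(0 <= k < n) `|u k - u k.+1|%:E)%E).
    rewrite sumEFin lee_fin le_eqVlt; apply/orP; left; apply/eqP.
    by apply: eq_bigr => i _; rewrite distrC.
  by apply: nneseries_lim_ge => k _ _; rewrite lee_fin.
have -> : u = (fun n => u 0%N + series (telescope u) n).
  by apply/funext => n; rewrite -eq_sum_telescope.
apply: is_cvgD => //; exact: is_cvg_cst.
Qed.

Lemma norm_le_steps (u : nat -> R) n :
  (`|u n|%:E <= `|u 0%N|%:E + \sum_(n <oo) `|u n - u n.+1|%:E)%E.
Proof.
apply: (@le_trans _ _ (`|u 0%N|%:E + \sum_(0 <= k < n) `|u k - u k.+1|%:E)%E).
  rewrite sumEFin -EFinD lee_fin; elim: n => [|n IH]; first by rewrite big_nil addr0.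
  rewrite big_nat_recr//= addrA.
  apply: le_trans (lerD IH (lexx _)); rewrite distrC.
  by rewrite -[leLHS](_ : `|u n + (u n.+1 - u n)| = _) ?ler_normD// addrC subrK.
by rewrite leeD2l//; apply: nneseries_lim_ge => k _ _; rewrite lee_fin.
Qed.

Lemma le_half_square (P t : R) : 0 < P -> t <= 2^-1 * (P * t ^+ 2 + P^-1).
Proof.
move=> P0; rewrite -(ler_pM2l P0) (_ : P * (_ * _) = 2^-1 * ((P * t) ^+ 2 + 1)).
  by have := sqr_ge0 (P * t - 1); lra.
by field; rewrite gt_eqF.
Qed.

Context (d : nat).
Local Notation V := (vec R d).
Local Notation mu := (@leb_outer R d).
Local Notation I := (@Icube R d).
Let mI := @measurable_Icube R d.

(** The absolute steps have an integrable sum, hence converge almost everywhere; Fatou makes the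
    limit square-integrable, and [|u 0|] plus that sum dominates the sequence. Testing against
    bounded functions is enough, as exponentials are bounded. *)
Lemma riesz_fischer (u : nat -> V -> R) (C : R) :
  (forall n, square_integrable (u n)) ->
  (forall n, \int[mu]_(x in I) ((u n x - u n.+1 x) ^+ 2) <= 4^-1 ^+ n)%R ->
  (forall n, \int[mu]_(x in I) (u n x ^+ 2) <= C)%R ->
  exists2 v : V -> R, square_integrable v &
    forall h : V -> R, measurable_fun I h -> (forall x, `|h x| <= 1) ->
      (\int[mu]_(x in I) (u n x * h x) @[n --> \oo] --> \int[mu]_(x in I) (v x * h x))%R.
Proof.
move=> su step uC.
have mu_ n : measurable_fun I (u n) := (su n).1.
have iu n := square_integrable_int (su n).
pose D n x := `|u n x - u n.+1 x|.
have mD n : measurable_fun I (D n).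
  by apply: measurableT_comp => //; exact: measurable_funB.
have sd n : square_integrable (fun x => u n x - u n.+1 x).
  rewrite (_ : (fun x => _) = (fun x => u n x + -1 * u n.+1 x)).
    exact: square_integrableD (su n) (square_integrableZ (-1) (su n.+1)).
  by apply/funext => x; rewrite mulN1r.
have intD n : (\int[mu]_(x in I) (D n x)%:E <= (2 / (2 ^ n.+1)%:R)%:E)%E.
  have iD : mu.-integrable I (EFin \o (fun x => D n x)).
    exact: integrable_norm (square_integrable_int (sd n)).
  (* |w| <= (P w^2 + 1 / P) / 2 with P = 2^n: the rate 4^-n on squares and the unit volume of the
     cube both give 2^-n after integration. *)
  pose b x := 2^-1 * (2 ^+ n * (u n x - u n.+1 x) ^+ 2 + (2 ^+ n)^-1).
  have p2 : 0 < 2 ^+ n :> R by rewrite exprn_gt0.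
  have Db x : D n x <= b x.
    rewrite /D /b; set w := u n x - _.
    have -> : w ^+ 2 = `|w| ^+ 2 by rewrite real_normK ?num_real.
    exact: le_half_square.
  have i1 : mu.-integrable I (EFin \o (fun x => 2 ^+ n * (u n x - u n.+1 x) ^+ 2)).
    exact: integrableZl (sd n).2.
  have i2 : mu.-integrable I (EFin \o (fun _ : V => (2 ^+ n)^-1 : R)).
    apply: (@Icube_integrable _ _ _ `|(2 ^+ n)^-1|) => //.
  have i3 : mu.-integrable I (EFin \o (fun x => 2 ^+ n * (u n x - u n.+1 x) ^+ 2 + (2 ^+ n)^-1)).
    exact: integrableD i1 i2.
  have ib : mu.-integrable I (EFin \o b) by exact: integrableZl i3.
  rewrite -(fineK (integrable_fin_num mI iD)) lee_fin.
  apply: le_trans (le_Rintegral mI iD ib (fun x _ => Db x)) _.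
  rewrite RintegralZl// RintegralD// RintegralZl//; last exact: (sd n).2.
  rewrite Rintegral_cst//= leb_Icube/= mulr1.
  have := step n; set J := Rintegral _ _ _ => J4.
  have E4 : 4^-1 ^+ n = (2 ^+ n)^-1 * (2 ^+ n)^-1 :> R.
    by rewrite -invfM -exprMn exprVn; congr (_ ^+ _)^-1; ring.
  rewrite {}E4 in J4; rewrite natrX exprS invfM mulrA divff// mul1r.
  have : 2 ^+ n * J <= (2 ^+ n)^-1.
    by rewrite -ler_pdivlMl// mulrC.
  lra.
pose G x := (\sum_(n <oo) (D n x)%:E)%E.
have D0 n x : (0 <= (D n x)%:E)%E by rewrite lee_fin /D normr_ge0.
have mG : measurable_fun I G.
  apply: ge0_emeasurable_sum => // n _; exact/measurable_EFinP.
have GI : (\int[mu]_(x in I) G x <= 2%:E)%E.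
  rewrite integral_nneseries//; last by move=> n; exact/measurable_EFinP.
  apply: le_trans (epsilon_trick0 (eps := 2) xpredT _) => //.
  apply: lee_nneseries => n *; last exact: intD.
  by apply: integral_ge0 => x _; exact: D0.
have iG : mu.-integrable I G.
  apply/integrableP; split => //.
  under eq_integral => x _ do rewrite gee0_abs ?nneseries_ge0//.
  by apply: le_lt_trans GI _; rewrite ltry.
have [N [mN N0 sN]] := integrable_ae mI iG.
pose A := I `\` N.
have mA : measurable A by exact: measurableD.
have AI : A `<=` I by move=> x [].
have Gfin x : A x -> G x \is a fin_num.
  move=> [Ix nN]; apply: contrapT => Gx; apply: nN; apply: sN => /= /(_ Ix).
  exact: Gx.
have cu x : A x -> cvgn (fun n => u n x).
  move=> Ax; apply: cvg_of_summable_steps.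
  by have := Gfin x Ax; rewrite ge0_fin_numE// nneseries_ge0.
pose v0 x := limn (fun n => u n x).
have cv x : A x -> u n x @[n --> \oo] --> v0 x by move=> /cu.
(* Putting 0 outside the conull set [A] makes integrals over the cube equal to integrals over
   [A]. *)
pose v : V -> R := v0 \_ A.
have vA x : A x -> v x = v0 x by move=> Ax; rewrite /v patchE mem_set.
have mv0 : measurable_fun A v0.
  apply: (measurable_fun_cvg (h := u)) => // n; exact: measurable_funS (mu_ n).
have mv : measurable_fun I v.
  by apply: (measurable_restrict v0 mA mI).1; rewrite (setIidr AI).
have intA (f : V -> R) : (forall x, ~ A x -> f x = 0) ->
    (\int[mu]_(x in I) (f x)%:E = \int[mu]_(x in A) (f x)%:E)%E.
  move=> fA; rewrite -[in RHS](setIidr AI) integral_mkcondr.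
  by apply: eq_integral => x _; rewrite patchE; case: ifPn => // /negP; rewrite inE => /fA ->.
have v0A x : ~ A x -> v x = 0 by move=> nA; rewrite /v patchE memNset.
have sv : square_integrable v.
  split=> //; apply/integrableP; split.
    by apply/measurable_EFinP; exact: measurable_funX.
  under eq_integral => x _ do rewrite /= ger0_norm ?sqr_ge0//.
  rewrite intA; last by move=> x /v0A ->; rewrite expr0n.
  apply: (@le_lt_trans _ _ C%:E); last exact: ltry.
  have mu2 n : measurable_fun A (fun x => (u n x ^+ 2)%:E).
    by apply/measurable_EFinP; apply: measurable_funX; exact: measurable_funS (mu_ n).
  have := @fatou _ _ _ mu A mA (fun n x => (u n x ^+ 2)%:E) mu2 (fun n x _ => sqr_ge0 (u n x)).
  rewrite (eq_integral (fun x => (v x ^+ 2)%:E)); last first.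
    move=> x; rewrite inE => Ax; rewrite vA//.
    apply: (cvg_limn_einf_sup _).1; apply/cvg_EFin; first exact: nearW.
    exact: (cvgM (cv x Ax) (cv x Ax)).
  move=> /le_trans; apply; apply: le_trans (limn_einf_sup _) _.
  rewrite limn_esup_lim; apply: lime_le; first exact: is_cvg_esups.
  apply: nearW => n; apply: ge_ereal_sup => _ [m _ <-].
  apply: (@le_trans _ _ (\int[mu]_(x in I) (u m x ^+ 2)%:E)%E).
    apply: ge0_subset_integral => //.
    - by apply/measurable_EFinP; exact: measurable_funX.
    - by move=> x _; rewrite lee_fin sqr_ge0.
  by rewrite -(fineK (integrable_fin_num mI (su m).2)) lee_fin; exact: uC.
exists v => // h mh h1.
have iuh n : mu.-integrable I (fun x => (u n x * h x)%:E).
  apply: (le_integrable mI _ _ (iu n)).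
    by apply/measurable_EFinP; exact: measurable_funM.
  by move=> x _; rewrite lee_fin normrM -[leRHS]mulr1 ler_pM.
have E n : (\int[mu]_(x in I) (u n x * h x)%:E = \int[mu]_(x in A) (u n x * h x)%:E)%E.
  exact: negligible_integral.
have idom : mu.-integrable A (fun x => `|u 0%N x|%:E + G x)%E.
  apply: integrableS AI _ => //.
  by apply: integrableD => //; exact: integrable_norm (iu 0%N).
have muh n : measurable_fun A (fun x => (u n x * h x)%:E).
  apply/measurable_EFinP; apply: measurable_funM; first exact: measurable_funS (mu_ n).
  exact: measurable_funS mh.
have c := @dominated_cvg _ _ _ mu A mA (fun n x => (u n x * h x)%:E)
   (fun x => (v x * h x)%:E) (fun x => `|u 0%N x|%:E + G x)%E muh.
rewrite /Rintegral; under eq_fun do rewrite E.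
rewrite intA; last by move=> x /v0A ->; rewrite mul0r.
have {}c : ((\int[mu]_(x in A) (u n x * h x)%:E) @[n --> \oo] --> \int[mu]_(x in A) (v x * h x)%:E)%E.
  apply: c => //.
  - move=> x Ax; apply/cvg_EFin; first exact: nearW.
    by apply: cvgMl; rewrite vA//; exact: cv.
  - by move=> x Ax; rewrite fin_numD Gfin.
  - move=> n x Ax; rewrite abse_EFin normrM.
    apply: le_trans (norm_le_steps (fun n => u n x) n).
    by rewrite lee_fin -[leRHS]mulr1 ler_pM.
have ivh : mu.-integrable A (fun x => (v x * h x)%:E).
  apply: integrableS AI _ => //.
  apply: (le_integrable mI _ _ (square_integrable_int sv)).
    by apply/measurable_EFinP; exact: measurable_funM.
  by move=> x _; rewrite lee_fin normrM -[leRHS]mulr1 ler_pM.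
apply: fine_cvg; rewrite fineK//; exact: integrable_fin_num ivh.
Qed.

End riesz_fischer.

(** * The sum of [sincW] over the integer lattice *)

Section sinc_lattice_sum.
Context (R : realType).

Let near_int (m : nat) (x : R) (l : 'I_(2 ^ m + 2 ^ m)) : int :=
  Num.floor x - l%:Z + (2 ^ m)%N%:Z.

Let near_int_inj m x : injective (@near_int m x).
Proof. move=> k l; rewrite /near_int => h; apply/val_inj => /=; lia. Qed.

Lemma bernoulli_sub (n : nat) (e : R) : 0 <= e <= 1 -> 1 - n%:R * e <= (1 - e) ^+ n.
Proof.
move=> /andP[e0 e1]; elim: n => [|n IH]; first by rewrite mul0r subr0.
have h : 0 <= 1 - e by lra.
rewrite exprS; apply: le_trans (ler_wpM2l h IH).
have := ler0n R n; rewrite -natr1; nra.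
Qed.

Let sinc2_near_sum (m : nat) (x : R) :
  1 - (2 ^+ m.+1)^-1 <= \sum_(l < 2 ^ m + 2 ^ m) sinc2 (x - (near_int x l)%:~R).
Proof.
have E (l : 'I_(2 ^ m + 2 ^ m)) : x - (near_int x l)%:~R = x - (Num.floor x)%:~R + (l%:R - 2 ^+ m) :> R.
  by rewrite /near_int intrD intrB -!pmulrn natrX; ring.
under eq_bigr do rewrite E.
have /andP[h1 h2] := floor_itv x; rewrite intrD in h2.
set y := x - (Num.floor x)%:~R.
have [y0|y0] := eqVneq y 0.
  have lt : (2 ^ m < 2 ^ m + 2 ^ m)%N by rewrite -addn1 leq_add2l expn_gt0.
  rewrite (bigD1 (Ordinal lt))//= y0 natrX subrr addr0 {1}/sinc2 eqxx.
  rewrite lerD//; apply: (@le_trans _ _ 0); first by rewrite oppr_le0 invr_ge0 exprn_ge0.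
  by apply: sumr_ge0 => *; exact: sinc2_ge0.
have y01 : 0 < y < 1 by rewrite lt_neqAle eq_sym y0 /y; apply/andP; split; lra.
apply: le_trans (sinc2_partial_sum m y01) _.
rewrite big_split_ord/= big_split/= addrC lerD//.
rewrite le_eqVlt; apply/orP; left; apply/eqP; apply: eq_bigr => i _.
by congr sinc2; rewrite natrD natrX; ring.
Qed.

(** Bessel already gives at most 1, so finite partial sums suffice. Over a product grid of lattice
    points near [x] the sum factors into one-dimensional sums, each at least 1 - 1 / 2^(m+1). *)
Lemma sincW_lattice_sum d (x : vec R d) :
  (\esum_(k in [set: 'cV[int]_d]) (sincW (x - @intv R d k))%:E = 1)%E.
Proof.
have kZ : keller_family [set: 'cV[int]_d] (@intv R d).
  move=> k l _ _ kl.
  have [j] : exists j, k j 0 != l j 0.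
    apply/existsP; apply: contraT; rewrite negb_exists => /forallP h.
    by exfalso; apply: kl; apply/colP => j; have := h j; rewrite negbK => /eqP.
  move=> kj; exists j; rewrite /keller_coord !intvE; split.
    by rewrite -intrB intr_int.
  by move=> /eqP; rewrite eqr_int (negbTE kj).
have le1 := (@sincW_packing R d _).2 _ _ kZ x.
apply/le_anti; rewrite le1/= leNgt; apply/negP.
set S := \esum_(k in _) _ in le1 *.
have S0 : (0 <= S)%E by apply: esum_ge0 => k _; rewrite lee_fin sincW_ge0.
have Sfin : S \is a fin_num by rewrite ge0_fin_numE// (le_lt_trans le1)// ltry.
rewrite -(fineK Sfin) lte_fin => S1.
(* By Bernoulli's inequality the d-th power loses at most d / 2^(m+1), made smaller than the
   supposed deficit. *)
have [m md] : exists m : nat, d%:R * (2 ^+ m.+1)^-1 < 1 - fine S :> R.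
  pose m := Num.truncn (d%:R / (1 - fine S)).
  have h : 0 < 1 - fine S by lra.
  exists m; rewrite ltr_pdivrMr ?exprn_gt0// mulrC -ltr_pdivrMr//.
  apply: lt_trans (truncnS_gt _) _; rewrite -natrX ltr_nat.
  exact: ltn_expl.
pose c (f : {ffun 'I_d -> 'I_(2 ^ m + 2 ^ m)}) : 'cV[int]_d :=
  \col_j near_int (x j 0) (f j).
have cinj : injective c.
  move=> f g fg; apply/ffunP => j; apply: (@near_int_inj m (x j 0)).
  by have /colP/(_ j) := fg; rewrite !mxE.
pose s := [seq c f | f <- enum {ffun 'I_d -> 'I_(2 ^ m + 2 ^ m)}].
have us : uniq s by rewrite map_inj_uniq// enum_uniq.
have := @seq_le_esum R _ [set: 'cV[int]_d] (fun k => sincW (x - @intv R d k)) s us (fun _ _ => I).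
rewrite -/S -(fineK Sfin) lee_fin leNgt => /negP; apply.
apply: (@lt_le_trans _ _ ((1 - (2 ^+ m.+1)^-1) ^+ d)).
  apply: (@lt_le_trans _ _ (1 - d%:R * (2 ^+ m.+1)^-1)); first by lra.
  apply: bernoulli_sub; rewrite invr_ge0 exprn_ge0//= invf_le1 ?exprn_gt0//.
  by rewrite exprn_ege1// ler1n.
rewrite big_map big_enum/=.
rewrite (eq_bigr (fun f : {ffun 'I_d -> 'I_(2 ^ m + 2 ^ m)} =>
    \prod_j sinc2 (x j 0 - (near_int (x j 0) (f j))%:~R))); last first.
  by move=> f _; apply: eq_bigr => j _; rewrite !vecE !mxE.
rewrite -(bigA_distr_bigA (fun j l => sinc2 (x j 0 - (near_int (x j 0) l)%:~R)))/=.
rewrite -[X in _ ^+ X](card_ord d) -prodr_const; apply: ler_prod => j _.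
rewrite sinc2_near_sum andbT subr_ge0 invf_le1 ?exprn_gt0//.
by rewrite exprn_ege1// ler1n.
Qed.

End sinc_lattice_sum.

(** * Parseval's identity implies completeness *)

Section completeness.
Context (R : realType) (d : nat).
Local Notation V := (vec R d).
Local Notation mu := (@leb_outer R d).
Local Notation I := (@Icube R d).
Let mI := @measurable_Icube R d.

Lemma L2_sq2 (u v : V -> R) : L2 I u v <-> sq2 ((u, v) : F2 R d).
Proof.
split=> [[mu_ [mv uvoo]]|[[mu_ iu] [mv iv]]].
  have iuv : mu.-integrable I (fun x => ((u x) ^+ 2 + (v x) ^+ 2)%:E).
    apply/integrableP; split.
      by apply/measurable_EFinP; apply: measurable_funD; exact: measurable_funX.
    under eq_integral => x _ do rewrite abse_EFin ger0_norm ?addr_ge0 ?sqr_ge0//.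
    exact: uvoo.
  split; split => //; apply: (le_integrable mI _ _ iuv);
    by [apply/measurable_EFinP; exact: measurable_funX |
        move=> x _; rewrite /= lee_fin !ger0_norm ?addr_ge0 ?sqr_ge0 ?lerDl ?lerDr ?sqr_ge0].
split=> //; split=> //.
have := integrable_lty mI (integrableD mI iu iv).
by under eq_integral do rewrite /= -EFinD.
Qed.

Lemma orth_exp_ip (u v : V -> R) (x : V) : sq2 ((u, v) : F2 R d) ->
  orth_exp I u v x <->
  ip ((u, v) : F2 R d) (expE x) = 0 /\ ip ((u, v) : F2 R d) (expJ x) = 0.
Proof.
move=> [su sv]; have [sc ss] := sq2_expE x.
have iuc := square_integrableM su sc; have ivs := square_integrableM sv ss.
have ius := square_integrableM su ss; have ivc := square_integrableM sv sc.
have ze (f : V -> R) : mu.-integrable I (EFin \o f) ->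
    (\int[mu]_(y in I) (f y)%:E = 0)%E <-> (\int[mu]_(y in I) f y = 0)%R.
  move=> fi; rewrite /Rintegral -[(\int[mu]_(y in I) (f y)%:E)%E in X in X <-> _]fineK.
    by split=> [[]|->].
  exact: integrable_fin_num fi.
rewrite /orth_exp ze; last exact: (integrableD mI iuc ivs).
rewrite ze; last first.
  by have := integrableB mI ivc ius; apply: eq_integrable.
rewrite RintegralD// RintegralB//.
suff -> : ip ((u, v) : F2 R d) (expJ x) =
    (\int[mu]_(y in I) (v y * ecos x y) - \int[mu]_(y in I) (u y * esin x y))%R by [].
rewrite /ip addrC; congr (_ + _) => /=.
rewrite -mulN1r -RintegralZl//; apply: eq_Rintegral => y _; ring.
Qed.

(** Multiplication by -i: it exchanges the pairings with [expE] and [expJ] up to sign, so a result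
    on real parts also covers imaginary parts. *)
Let rot (f : F2 R d) : F2 R d := (f.2, fun y => - f.1 y).

Let sq2_rot f : sq2 f -> sq2 (rot f).
Proof.
move=> [f1 f2]; split=> //=.
rewrite (_ : (fun y => _) = (fun y => -1 * f.1 y)); first exact: square_integrableZ.
by apply/funext => y; rewrite mulN1r.
Qed.

Let ip_rotE f x : sq2 f -> ip (rot f) (expE x) = ip f (expJ x).
Proof.
move=> [f1 f2]; rewrite /ip addrC; congr (_ + _) => /=.
by apply: eq_Rintegral => y _; ring.
Qed.

Let ip_rotJ f x : sq2 f -> ip (rot f) (expJ x) = - ip f (expE x).
Proof.
move=> [f1 f2]; have [sc ss] := sq2_expE x.
rewrite /ip opprD addrC; congr (_ + _) => /=; rewrite -mulN1r -RintegralZl//;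
  try exact: square_integrableM; apply: eq_Rintegral => y _; ring.
Qed.

(* If the Parseval sum of every exponential is 1, each exponential is an L^2
   limit of combinations of the family, so orthogonality to the family gives
   orthogonality to all exponentials. *)
Lemma parseval_orth (X : set V) (f : F2 R d) :
  keller_family X id ->
  (forall x, \esum_(i in X) (sincW (x - i))%:E = 1)%E -> sq2 f ->
  (forall i, X i -> ip f (expE i) = 0 /\ ip f (expJ i) = 0) ->
  forall x, ip f (expE x) = 0.
Proof.
move=> kX p1 sf fX x; apply: contrapT => /eqP fx.
set a := ip f (expE x) in fx.
have a0 : 0 < a ^+ 2 by rewrite lt_neqAle sqr_ge0 andbT eq_sym sqrf_eq0.
have f0 := ip_ge0 f; pose A := ip f f; have A1 : 0 < A + 1 by rewrite /A; lra.
(* The residual norm is made so small that Cauchy-Schwarz would give a^2 < a^2; adding 1 to [A]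
   keeps the quotient meaningful when [A = 0]. *)
have [|s [us sX lt]] := @esum_adherent _ _ X (fun i => sincW (x - i)) (1 - a ^+ 2 / (A + 1)).
  by rewrite p1 lte_fin gtrBl divr_gt0.
have ks := keller_family_sub kX sX; have sE := @sq2_expE R d x.
pose r := proj_residual s (expE x).
have rE : ip r f = a.
  rewrite /r proj_residualE// big1_seq ?subr0 ?[ip _ f]ipC// => k /andP[_ ksn].
  have [h1 h2] : ip f (expE k.1) = 0 /\ ip f (expJ k.1) = 0.
    apply: fX; apply: sX; move/allpairsP : ksn => [[y b] [/= ys _ ->]].
    exact: ys.
  by case: k {ksn} h1 h2 => y [] /= h1 h2; rewrite [ip (exps _) f]ipC /exps/= ?h1 ?h2 mulr0.
have rr : ip r r < a ^+ 2 / (A + 1).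
  rewrite /r (proj_residual_norm us ks)// ip_exp1.
  by under eq_bigr do rewrite ip_exp2; lra.
have := cauchy_schwarz (@sq2D R d) (@sq2Z R d) (@ipC R d) (@ipD R d) (@ipZ R d) (@ip_ge0 R d)
  (sq2_proj_residual s sE) sf.
rewrite -/r rE -/A; rewrite ltr_pdivlMr// in rr.
by have := ip_ge0 r; rewrite -/A in f0; nra.
Qed.

Lemma parseval_complete (X : set V) : keller_family X id ->
  (forall x, \esum_(i in X) (sincW (x - i))%:E = 1)%E ->
  forall u v : V -> R, L2 I u v -> (forall i, X i -> orth_exp I u v i) ->
    Defs.null_set [set x | I x /\ (u x <> 0 \/ v x <> 0)].
Proof.
move=> kX p1 u v /L2_sq2 suv orth.
have orth' i : X i -> ip ((u, v) : F2 R d) (expE i) = 0 /\ ip ((u, v) : F2 R d) (expJ i) = 0.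
  by move=> Xi; apply/(orth_exp_ip _ suv); exact: orth.
have h1 := parseval_orth kX p1 suv orth'.
have h2 x : ip ((u, v) : F2 R d) (expJ x) = 0.
  rewrite -ip_rotE//; apply: (parseval_orth kX p1 (sq2_rot suv)) => i /orth'[h h'].
  by rewrite ip_rotE// ip_rotJ// h h' oppr0.
have dotvN (x y : V) : dotv (- x) y = - dotv x y.
  by rewrite /dotv -sumrN; apply: eq_bigr => i _; rewrite !vecE mulNr.
have [su sv] := suv.
(* Comparing the frequencies [x] and [- x] separates the even cosine part from the odd sine part, so
   [u] and [v] are each orthogonal to everything. *)
have nE x : let f := ((u, v) : F2 R d) in
   (\int[mu]_(y in I) (u y * ecos x y) = 0 /\ \int[mu]_(y in I) (v y * esin x y) = 0)%R.
  have := h1 x; have := h1 (- x); rewrite /ip/=.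
  have -> : (\int[mu]_(y in I) (u y * ecos (- x) y) = \int[mu]_(y in I) (u y * ecos x y))%R.
    by apply: eq_Rintegral => y _; rewrite /ecos dotvN mulrN cosN.
  have -> : (\int[mu]_(y in I) (v y * esin (- x) y) = - \int[mu]_(y in I) (v y * esin x y))%R.
    rewrite -mulN1r -RintegralZl//; last exact: square_integrableM sv (sq2_expE x).2.
    by apply: eq_Rintegral => y _; rewrite /esin dotvN mulrN sinN; ring.
  by move=> a b; split; lra.
have nJ x : (\int[mu]_(y in I) (v y * ecos x y) = 0 /\ \int[mu]_(y in I) (u y * esin x y) = 0)%R.
  have := h2 x; have := h2 (- x); rewrite /ip/=.
  have -> : (\int[mu]_(y in I) (v y * ecos (- x) y) = \int[mu]_(y in I) (v y * ecos x y))%R.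
    by apply: eq_Rintegral => y _; rewrite /ecos dotvN mulrN cosN.
  have -> : (\int[mu]_(y in I) (u y * - esin (- x) y) = \int[mu]_(y in I) (u y * esin x y))%R.
    by apply: eq_Rintegral => y _; rewrite /esin dotvN [2 * pi * _]mulrN sinN opprK.
  have -> : (\int[mu]_(y in I) (u y * - esin x y) = - \int[mu]_(y in I) (u y * esin x y))%R.
    rewrite -[RHS]mulN1r -RintegralZl//; last exact: square_integrableM su (sq2_expE x).2.
    by apply: eq_Rintegral => y _; ring.
  by move=> a b; split; lra.
have nu : exp_null u.
  by split=> [|x]; [exact: square_integrable_int|have [? _] := nE x; have [_ ?] := nJ x].
have nv : exp_null v.
  by split=> [|x]; [exact: square_integrable_int|have [_ ?] := nE x; have [? _] := nJ x].
rewrite /Defs.null_set; apply/le_anti/andP; split; last exact: outer_measure_ge0.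
have -> : [set x | I x /\ (u x <> 0 \/ v x <> 0)] =
    (I `&` [set x | u x != 0]) `|` (I `&` [set x | v x != 0]).
  apply/seteqP; split=> x /=.
    by move=> [Ix [/eqP h|/eqP h]]; [left|right].
  by move=> [[Ix /eqP h]|[Ix /eqP h]]; split=> //; [left|right].
apply: le_trans (outer_measureU2 _ _ _) _.
by rewrite /= !exp_null_null// adde0.
Qed.

End completeness.

(** * Completeness implies Parseval's identity *)

Section complete_parseval.
Context (R : realType) (d : nat).
Local Notation V := (vec R d).
Local Notation mu := (@leb_outer R d).
Local Notation I := (@Icube R d).
Let mI := @measurable_Icube R d.

Lemma sum_sub_le (w : V -> R) (s t : seq V) : (forall i, 0 <= w i) ->
  uniq s -> uniq t -> {subset s <= t} -> \sum_(i <- s) w i <= \sum_(i <- t) w i.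
Proof.
move=> w0 us ut st.
rewrite [leRHS](bigID (mem s))/= -[X in _ <= X + _]big_filter.
have -> : \sum_(i <- s) w i = \sum_(i <- [seq i <- t | i \in s]) w i.
  apply: perm_big; apply: uniq_perm => //; first exact: filter_uniq.
  move=> i; rewrite mem_filter; case: (boolP (i \in s)) => //= /st -> //.
by rewrite lerDl sumr_ge0.
Qed.

(** Unions of near-optimal finite subsets make them nested; the rate 4^-n is the one [riesz_fischer]
    requires. *)
Lemma nested_approximation (X : set V) (w : V -> R) (S : R) :
  (forall i, 0 <= w i) -> (\esum_(i in X) (w i)%:E = S%:E)%E ->
  exists t : nat -> seq V, forall n,
    [/\ uniq (t n), forall i, i \in t n -> X i, {subset t n <= t n.+1} &
      S - 4^-1 ^+ n < \sum_(i <- t n) w i].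
Proof.
move=> w0 wS.
have /choice[s Ps] n : exists s : seq V,
    [/\ uniq s, forall i, i \in s -> X i & S - 4^-1 ^+ n < \sum_(i <- s) w i].
  by apply: esum_adherent; rewrite wS lte_fin gtrBl exprn_gt0.
pose t := fix t n := if n is m.+1 then undup (t m ++ s n) else s 0%N.
have tS n : t n.+1 = undup (t n ++ s n.+1) by [].
exists t => n; have [us sX lt] := Ps n.
have sub : {subset s n <= t n}.
  by case: (n) => [//|m] i iS; rewrite tS mem_undup mem_cat iS orbT.
have ut : uniq (t n) by case: (n) => [|m]; [have [] := Ps 0%N|rewrite tS undup_uniq].
split=> //.
- elim: (n) => [|m IH] i; first by have [_ + _] := Ps 0%N; apply.
  rewrite tS mem_undup mem_cat => /orP[/IH//|].
  by have [_ + _] := Ps m.+1; apply.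
- by move=> i it; rewrite tS mem_undup mem_cat it.
by apply: lt_le_trans lt _; exact: sum_sub_le.
Qed.

(* If some sum is below 1, the residuals of that exponential converge in L^2 to
   a nonzero function orthogonal to the whole family. *)
Lemma complete_parseval (X : set V) : keller_family X id ->
  (forall u v : V -> R, L2 I u v -> (forall i, X i -> orth_exp I u v i) ->
    Defs.null_set [set x | I x /\ (u x <> 0 \/ v x <> 0)]) ->
  forall x, (\esum_(i in X) (sincW (x - i))%:E = 1)%E.
Proof.
move=> kX compl x.
have le1 := (@sincW_packing R d _).2 X id kX x.
apply/le_anti; rewrite le1/= leNgt; apply/negP => lt1.
have S0 : (0 <= \esum_(i in X) (sincW (x - i))%:E)%E.
  by apply: esum_ge0 => k _; rewrite lee_fin sincW_ge0.
have Sfin : (\esum_(i in X) (sincW (x - i))%:E)%E \is a fin_num.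
  by rewrite ge0_fin_numE// (lt_trans lt1)// ltry.
have [S SE] : exists S : R, (\esum_(i in X) (sincW (x - i))%:E = S%:E)%E.
  by exists (fine (\esum_(i in X) (sincW (x - i))%:E)%E); rewrite fineK.
rewrite SE lte_fin in lt1.
have [t Pt] := nested_approximation (fun i => sincW_ge0 (x - i)) SE.
have ut n : uniq (t n) by have [] := Pt n.
have tX n : forall i, i \in t n -> X i by have [] := Pt n.
have kt n := keller_family_sub kX (@tX n).
have sE := @sq2_expE R d x.
have sumS (s : seq V) : uniq s -> (forall i, i \in s -> X i) ->
    \sum_(i <- s) sincW (x - i) <= S.
  by move=> us sX; rewrite -lee_fin -SE; exact: seq_le_esum.
pose r n : F2 R d := proj_residual (t n) (expE x).
have sr n : sq2 (r n) by exact: sq2_proj_residual.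
pose a n := 1 - \sum_(i <- t n) sincW (x - i).
have rr n : ip (r n) (r n) = a n.
  rewrite /r (proj_residual_norm (ut n) (kt n))// ip_exp1.
  by under eq_bigr do rewrite ip_exp2.
have rg n (g : F2 R d) : sq2 g -> (forall k, k.1 \in t n -> ip (exps k) g = 0) ->
    ip (r n) g = ip (expE x) g.
  move=> sg og; rewrite /r proj_residualE// big1_seq ?subr0// => k /andP[_ kn].
  rewrite og ?mulr0//; move/allpairsP : kn => [[y b] [/= yt _ ->]].
  exact: yt.
have tle n m : (n <= m)%N -> {subset t n <= t m}.
  elim: m => [|m IH]; first by rewrite leqn0 => /eqP ->.
  rewrite leq_eqVlt => /predU1P[->//|/IH h] i /h.
  by have [_ _ + _] := Pt m; apply.
(* The later residual is orthogonal to all vectors used earlier, so its pairing with [r n] depends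
   on [m] only. Hence the squared steps telescope to [a n - a n.+1]. *)
have rnm n m : (n <= m)%N -> ip (r n) (r m) = ip (expE x) (r m).
  move=> nm; apply: rg => // k kn; rewrite ipC.
  by apply: (proj_residual_orth (ut m) (kt m)) => //; exact: tle kn.
have rE n : ip (r n) (expE x) = a n by rewrite ipC -rr rnm.
have aS n : 1 - S <= a n < 1 - S + 4^-1 ^+ n.
  have [_ _ _ h] := Pt n; rewrite /a; apply/andP; split; last by lra.
  by have := sumS _ (ut n) (@tX n); lra.
have step n : ip (r n - r n.+1) (r n - r n.+1) <= 4^-1 ^+ n.
  have sN : sq2 (- r n.+1) by rewrite -scaleN1r; exact: sq2Z.
  have sD : sq2 (r n - r n.+1) by exact: sq2D.
  have -> : ip (r n - r n.+1) (r n - r n.+1) = a n - a n.+1.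
    have ipN (f g : F2 R d) : sq2 f -> sq2 g -> ip (- f) g = - ip f g.
      by move=> sf sg; rewrite -scaleN1r ipZ// mulN1r.
    have rn1 : ip (r n) (r n.+1) = a n.+1 by rewrite rnm// -(rnm n.+1 n.+1)// rr.
    have e1 : ip (- r n.+1) (r n - r n.+1) = - ip (r n.+1) (r n - r n.+1) by exact: ipN.
    have e2 m : ip (r m) (r n - r n.+1) = ip (r m) (r n) - ip (r m) (r n.+1).
      have -> : ip (r m) (r n - r n.+1) = ip (r n) (r m) + ip (- r n.+1) (r m).
        by rewrite ipC ipD.
      have -> : ip (- r n.+1) (r m) = - ip (r n.+1) (r m) by exact: ipN.
      by rewrite !(ipC _ (r m)).
    by rewrite ipD// e1 !e2 !rr (ipC (r n.+1) (r n)) rn1; ring.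
  have /andP[_ h1] := aS n; have /andP[h2 _] := aS n.+1; lra.
have sq_ip (f : F2 R d) : ip f f =
    (\int[mu]_(y in I) (f.1 y ^+ 2) + \int[mu]_(y in I) (f.2 y ^+ 2))%R by [].
have int_sq0 (u : V -> R) : (0 <= \int[mu]_(y in I) (u y ^+ 2))%R.
  by apply: Rintegral_ge0 => y _; exact: sqr_ge0.
have a1 n : a n <= 1.
  by rewrite /a gerBl; apply: sumr_ge0 => i _; exact: sincW_ge0.
have [u su cu] : exists2 u : V -> R, square_integrable u &
    forall h : V -> R, measurable_fun I h -> (forall y, `|h y| <= 1) ->
     (\int[mu]_(y in I) ((r n).1 y * h y) @[n --> \oo] --> \int[mu]_(y in I) (u y * h y))%R.
  apply: (riesz_fischer (u := fun n => (r n).1) (C := 1)) => n.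
  - exact: (sr n).1.
  - apply: le_trans (step n); rewrite sq_ip lerDl; exact: int_sq0.
  - apply: le_trans (a1 n); rewrite -rr sq_ip lerDl; exact: int_sq0.
have [v sv cv] : exists2 v : V -> R, square_integrable v &
    forall h : V -> R, measurable_fun I h -> (forall y, `|h y| <= 1) ->
     (\int[mu]_(y in I) ((r n).2 y * h y) @[n --> \oo] --> \int[mu]_(y in I) (v y * h y))%R.
  apply: (riesz_fischer (u := fun n => (r n).2) (C := 1)) => n.
  - exact: (sr n).2.
  - apply: le_trans (step n); rewrite sq_ip lerDr; exact: int_sq0.
  - apply: le_trans (a1 n); rewrite -rr sq_ip lerDr; exact: int_sq0.
pose f : F2 R d := (u, v).
have sf : sq2 f by split.
have cf k : ip (r n) (exps k) @[n --> \oo] --> ip f (exps k).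
  have mc y : measurable_fun I (@ecos R d y) := measurable_funTS (measurable_ecos y).
  have ms y : measurable_fun I (@esin R d y) := measurable_funTS (measurable_esin y).
  case: k => y []; apply: cvgD.
  - apply: cu; first exact: (sq2_expJ y).1.1.
    by move=> z; rewrite /exps/= normrN esin_bound.
  - exact: (cv (ecos y) (mc y) (ecos_bound y)).
  - exact: (cu (ecos y) (mc y) (ecos_bound y)).
  - exact: (cv (esin y) (ms y) (esin_bound y)).
have orth i : X i -> ip f (expE i) = 0 /\ ip f (expJ i) = 0.
  move=> Xi.
  (* If [i] is not yet in [t n], the coefficients are those of [expE x] itself, and [sincW (x - i)]
     fits into the remainder of the sum, which is below 4^-n. *)
  have small n : ip (r n) (expE i) ^+ 2 + ip (r n) (expJ i) ^+ 2 <= 4^-1 ^+ n.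
    case: (boolP (i \in t n)) => it.
      have h b := @proj_residual_orth _ _ _ (ut n) (kt n) _ (i, b) sE it.
      have h1 : ip (r n) (expE i) = 0 := h false.
      have h2 : ip (r n) (expJ i) = 0 := h true.
      by rewrite h1 h2 expr0n addr0 exprn_ge0.
    have kc : keller_family [set` i :: t n] id.
      apply: (keller_family_sub kX) => j; rewrite inE => /predU1P[->//|].
      exact: tX.
    have h b : ip (r n) (exps (i, b)) = ip (expE x) (exps (i, b)).
      apply: rg; first exact: sq2_exps.
      move=> k kn; rewrite (exps_orthonormal kc) ?inE ?kn ?eqxx ?orbT//.
      by case: eqP => // ki; move: it; rewrite -[i]/((i, b).1) -ki kn.
    have -> : ip (r n) (expE i) = ip (expE x) (expE i) := h false.
    have -> : ip (r n) (expJ i) = ip (expE x) (expJ i) := h true.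
    rewrite ip_exp2.
    have := sumS (i :: t n) _ _; rewrite big_cons /= it ut => /(_ isT) hs.
    have [_ _ _ lt] := Pt n.
    have : sincW (x - i) + \sum_(j <- t n) sincW (x - j) <= S.
      by apply: hs => j; rewrite inE => /predU1P[->//|]; exact: tX.
    lra.
  have c : ip (r n) (expE i) ^+ 2 + ip (r n) (expJ i) ^+ 2 @[n --> \oo] -->
      ip f (expE i) ^+ 2 + ip f (expJ i) ^+ 2.
    have c1 := cf (i, false); have c2 := cf (i, true).
    exact: cvgD (cvgM c1 c1) (cvgM c2 c2).
  have c0 : ip (r n) (expE i) ^+ 2 + ip (r n) (expJ i) ^+ 2 @[n --> \oo] --> (0 : R).
    apply: (@squeeze_cvgr _ _ _ _ (fun=> 0) (fun n => 4^-1 ^+ n)).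
    - by apply: nearW => n; rewrite small addr_ge0 ?sqr_ge0.
    - exact: cvg_cst.
    - by apply: cvg_expr; rewrite ger0_norm//; lra.
  have /eqP : ip f (expE i) ^+ 2 + ip f (expJ i) ^+ 2 = 0.
    exact: (cvg_unique (@Rhausdorff R) c c0).
  by rewrite paddr_eq0 ?sqr_ge0// !sqrf_eq0 => /andP[/eqP -> /eqP ->].
(* The pairings of the residuals with [expE x] equal their squared norms, which stay above
   [1 - S > 0]. *)
have fx : ip f (expE x) != 0.
  have c := cf (x, false).
  have : 1 - S <= ip f (exps (x, false)).
    rewrite -(cvg_lim (@Rhausdorff R) c); apply: limr_ge.
      by apply/cvg_ex; exists (ip f (exps (x, false))).
    apply: nearW => n; have -> : ip (r n) (exps (x, false)) = a n := rE n.
    by have /andP[] := aS n.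
  by move=> h; rewrite gt_eqF//; apply: lt_le_trans h; rewrite subr_gt0.
have L2uv : L2 I u v by exact/L2_sq2.
have orth' i : X i -> orth_exp I u v i by move=> /orth h; exact/(orth_exp_ip _ sf).
have N0 := compl u v L2uv orth'.
have mN : measurable [set y | I y /\ (u y <> 0 \/ v y <> 0)].
  have -> : [set y | I y /\ (u y <> 0 \/ v y <> 0)] =
      (I `&` u @^-1` [set~ 0]) `|` (I `&` v @^-1` [set~ 0]).
    apply/seteqP; split=> y /=; first by move=> [Iy [h|h]]; [left|right].
    by move=> [[Iy h]|[Iy h]]; split=> //; [left|right].
  have m0 : measurable ([set~ 0] : set R).
    by apply: measurableC; exact: measurable_set1.
  by apply: measurableU; [exact: su.1|exact: sv.1].
have z (w h : V -> R) : square_integrable w -> square_integrable h ->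
    (forall y, I y -> w y <> 0 -> [set y | I y /\ (u y <> 0 \/ v y <> 0)] y) ->
    (\int[mu]_(y in I) (w y * h y) = 0)%R.
  move=> sw sh wN; rewrite /Rintegral (@negligible_integral _ _ _ _ I _ _ mN mI)//.
    rewrite integral0_eq// => y [Iy nN]; congr EFin.
    case: (eqVneq (w y) 0) => [->|/eqP wy]; first by rewrite mul0r.
    by exfalso; apply: nN; exact: wN.
  exact: square_integrableM.
have z1 := z u (ecos x) su (sq2_expE x).1 (fun y Iy h => conj Iy (or_introl h)).
have z2 := z v (esin x) sv (sq2_expE x).2 (fun y Iy h => conj Iy (or_intror h)).
by move/eqP : fx; apply; rewrite /ip/= z1 z2 addr0.
Qed.

End complete_parseval.

(** * Volume of a fundamental domain *)

Section linear_volume.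
Context (R : realType) (d : nat).
Local Notation V := (vec R d).
Local Notation leb := (@leb_outer R d).
Local Notation I := (@Icube R d).
Let mI := @measurable_Icube R d.

Lemma leb_translate (A : set V) (t : V) : leb ((fun x : V => x + t) @^-1` A) = leb A.
Proof.
have le (B : set V) (s : V) : (leb ((fun x : V => x + s)%R @^-1` B) <= leb B)%E.
  apply: le_ereal_inf_tmp => _ [K [a [b [cov ->]]]].
  have -> : (\sum_(k <oo | k \in K) (box_vol (a k) (b k))%:E =
      \sum_(k <oo | k \in K) (box_vol (a k - s) (b k - s))%:E)%E.
    apply: eq_eseriesr => k _; congr EFin; apply: eq_bigr => i _.
    by rewrite !vecE opprD addrACA subrr addr0.
  apply: (leb_cover_le (a := fun k => a k - s) (b := fun k => b k - s)) => x /= /cov[k Kk xk].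
  exists k => // i; have := xk i; rewrite !vecE => /andP[h1 h2].
  by apply/andP; split; lra.
apply/le_anti; rewrite le/=.
rewrite [leLHS](_ : _ = leb ((fun x : V => x + - t) @^-1` ((fun x : V => x + t) @^-1` A))) ?le//.
by congr leb; apply/seteqP; split=> x /=; rewrite subrK.
Qed.

Definition lin (A : 'M[R]_d) (x : V) : V := A *m x.

Lemma linD A x y : lin A (x + y) = lin A x + lin A y.
Proof. exact: mulmxDr. Qed.

Lemma lin_coord A x i : lin A x i 0 = \sum_j A i j * x j 0.
Proof. by rewrite /lin mxE. Qed.

Lemma linK A x : A \in unitmx -> lin (invmx A) (lin A x) = x.
Proof. by move=> uA; rewrite /lin mulmxA mulVmx// mul1mx. Qed.

Lemma linVK A x : A \in unitmx -> lin A (lin (invmx A) x) = x.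
Proof. by move=> uA; rewrite /lin mulmxA mulmxV// mul1mx. Qed.

Lemma measurable_lin A : measurable_fun setT (lin A).
Proof.
apply: measurable_vecP => i; under eq_fun do rewrite lin_coord.
by apply: measurable_sum => j; apply: measurable_funM => //; exact: measurable_coord.
Qed.

Lemma measurable_addv d0 (T : measurableType d0) (f g : T -> V) :
  measurable_fun setT f -> measurable_fun setT g ->
  measurable_fun setT (fun x => f x + g x).
Proof.
move=> mf mg; apply: measurable_vecP => i; under eq_fun do rewrite vecDE.
by apply: measurable_funD; exact: measurableT_comp (measurable_coord i) _.
Qed.

Lemma measurable_oppv : measurable_fun setT (fun x : V => - x).
Proof.
apply: measurable_vecP => i; under eq_fun do rewrite vecNE.
by apply: measurableT_comp => //; exact: measurable_coord.
Qed.

Lemma measurable_pre d1 d2 (T1 : measurableType d1) (T2 : measurableType d2)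
  (f : T1 -> T2) (A : set T2) : measurable_fun setT f -> measurable A -> measurable (f @^-1` A).
Proof. by move=> mf mA; rewrite -[X in measurable X]setTI; exact: mf. Qed.

Lemma leb_sections (P : set (V * V)) : measurable P ->
  (\int[leb]_x leb [set y : V | P (x, y)] = \int[leb]_y leb [set x : V | P (x, y)])%E.
Proof.
move=> mP.
have := @fubini_tonelli _ _ V V R leb leb (fun z => (\1_P z)%:E).
move=> /(_ _ _) E.
transitivity (\int[leb]_x \int[leb]_y (\1_P (x, y))%:E)%E.
  apply: eq_integral => x _.
  rewrite (_ : (fun y => (\1_P (x, y))%:E) = (fun y => (\1_[set y | P (x, y)] y)%:E))//.
  rewrite integral_indic ?setIT//.
  by apply: (measurable_pre (f := fun y => (x, y)) _ mP); exact: pair1_measurable.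
rewrite E//; last first.
  apply/measurable_EFinP; exact: measurable_indic.
apply: eq_integral => y _.
rewrite (_ : (fun x => (\1_P (x, y))%:E) = (fun x => (\1_[set x | P (x, y)] x)%:E))//.
rewrite integral_indic ?setIT//.
by apply: (measurable_pre (f := fun x => (x, y)) _ mP); exact: pair2_measurable.
Qed.

(* Integrate the set of pairs (x, y) with y in I and A x + y in S in both orders. *)
Lemma leb_lin (A : 'M[R]_d) (S : set V) : A \in unitmx -> measurable S ->
  leb (lin A @^-1` S) = (leb (lin A @^-1` I) * leb S)%E.
Proof.
move=> uA.
(* The point is a factor independent of [T]; taking [T] to be the cube identifies it. *)
suff key (T : set V) : measurable T ->
    leb (lin A @^-1` T) = (leb [set x : V | (- lin A x)%R \in I] * leb T)%E.
  move=> mS; rewrite (key S mS) (key I mI); congr (_ * _)%E.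
  by rewrite leb_Icube mule1.
move=> {}mT.
have mlin1 : measurable_fun setT (fun z : V * V => lin A z.1).
  exact: measurableT_comp (@measurable_lin A) measurable_fst.
have mP : measurable [set z : V * V | I z.2 /\ T (lin A z.1 + z.2)].
  apply: measurableI; first exact: (measurable_pre measurable_snd mI).
  apply: (measurable_pre (f := fun z : V * V => lin A z.1 + z.2)) => //.
  exact: measurable_addv.
have mQ : measurable [set z : V * V | I (z.2 - lin A z.1) /\ T z.2].
  apply: measurableI; last exact: (measurable_pre measurable_snd mT).
  apply: (measurable_pre (f := fun z : V * V => z.2 - lin A z.1)) => //.
  apply: measurable_addv => //; exact: measurableT_comp measurable_oppv mlin1.
have cst_restrict (B : set V) (c : \bar R) : measurable B -> (0 <= c)%E ->
    (\int[leb]_y (if y \in B then c else 0) = c * leb B)%E.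
  move=> mB c0; rewrite -(integral_cst _ mB) integral_mkcond.
  by apply: eq_integral => y _; rewrite patchE.
transitivity (\int[leb]_y leb [set x : V | I y /\ T (lin A x + y)%R])%E.
  rewrite -[LHS]mule1 -(leb_Icube R d) -cst_restrict//.
  apply: eq_integral => y _; case: ifPn => [|/negP]; rewrite inE => Iy.
    rewrite -(leb_translate _ (lin (invmx A) y)); congr leb.
    by apply/seteqP; split=> x /=; rewrite linD linVK//; tauto.
  by rewrite (_ : [set x | _] = set0) ?measure0//; apply/seteqP; split=> x //= -[].
rewrite -(leb_sections mP).
transitivity (\int[leb]_x leb [set y : V | I (y - lin A x)%R /\ T y])%E.
  apply: eq_integral => x _.
  rewrite -(leb_translate [set y : V | I (y - lin A x) /\ T y] (lin A x)); congr leb.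
  by apply/seteqP; split=> y /=; rewrite addrK addrC.
rewrite (leb_sections mQ) -cst_restrict//.
apply: eq_integral => y _; case: ifPn => [|/negP]; rewrite inE => Ty.
  rewrite -(leb_translate _ (lin (invmx A) y)); congr leb.
  by apply/seteqP; split=> x /=; rewrite linD linVK// opprD addrCA subrr addr0 inE; tauto.
by rewrite (_ : [set x | _] = set0) ?measure0//; apply/seteqP; split=> x //= -[].
Qed.

(** Volume of the parallelepiped spanned by the columns of [B], written as a preimage so that
    multiplicativity follows from [leb_lin]. *)
Definition vol (B : 'M[R]_d) : \bar R := leb (lin (invmx B) @^-1` I).

Lemma vol_ge0 B : (0 <= vol B)%E. Proof. exact: measure_ge0. Qed.

Lemma vol1 : vol 1%:M = 1%E.
Proof.
rewrite /vol -(leb_Icube R d); congr leb; apply/seteqP; split=> x;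
  by rewrite /= /lin invmx1 mul1mx.
Qed.

Lemma vol_mul A B : A \in unitmx -> B \in unitmx -> vol (A *m B) = (vol A * vol B)%E.
Proof.
move=> uA uB; rewrite /vol -leb_lin ?unitmx_inv//; last first.
  by apply: measurable_pre => //; exact: measurable_lin.
have invE : invmx (A *m B) = invmx B *m invmx A.
  have uAB : A *m B \in unitmx by rewrite unitmx_mul uA.
  rewrite -[RHS]mul1mx -(mulVmx uAB) -!mulmxA (mulmxA B) mulmxV// mul1mx.
  by rewrite mulmxV// mulmx1.
by congr leb; apply/seteqP; split=> x /=; rewrite /lin invE mulmxA.
Qed.

End linear_volume.

(** * The volume of a parallelepiped is the absolute determinant *)

Section volume_bounds.
Context (R : realType) (d : nat).
Local Notation V := (vec R d).
Local Notation leb := (@leb_outer R d).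
Local Notation I := (@Icube R d).

Lemma le_prod_cvg (v : R) (a c : 'I_d -> R) :
  (forall n : nat, v <= \prod_i (a i + c i * n.+1%:R^-1)) -> v <= \prod_i a i.
Proof.
move=> h; pose p : {poly R} := \prod_i ((a i)%:P + (c i) *: 'X).
have pE (e : R) : p.[e] = \prod_i (a i + c i * e).
  by rewrite horner_prod; apply: eq_bigr => i _; rewrite !hornerE.
have cp : (fun n : nat => p.[n.+1%:R^-1]) @ \oo --> p.[0].
  exact: (@continuous_cvg _ _ _ _ _ (fun n : nat => n.+1%:R^-1 : R) (horner p) 0
    (@continuous_horner _ p 0) (@cvg_harmonic R)).
have -> : \prod_i a i = p.[0].
  by rewrite pE; apply: eq_bigr => i _; rewrite mulr0 addr0.
rewrite -(cvg_lim (@Rhausdorff R) cp); apply: limr_ge.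
  by apply/cvg_ex; exists p.[0].
by apply: nearW => n; rewrite pE.
Qed.

Lemma vol_le_rowsum (B : 'M[R]_d) : B \in unitmx -> (vol B <= (\prod_i \sum_j `|B i j|)%:E)%E.
Proof.
move=> uB.
have key (e : R) : 0 < e -> (vol B <= (\prod_i (\sum_j `|B i j| + 1 * e))%:E)%E.
  (* The box spans the extreme values of each coordinate. The slack [e] is there because boxes are
     open above, while a row without positive entries attains its maximum 0. *)
  move=> e0; pose lo : V := \col_i \sum_j Num.min (B i j) 0.
  pose hi : V := \col_i (\sum_j Num.max (B i j) 0 + e).
  apply: le_trans (_ : leb (box lo hi) <= _)%E.
    apply: le_outer_measure => x Ix i; rewrite -(linVK x uB) lin_coord !mxE.
    set y := lin _ _ in Ix *.
    have t j : Num.min (B i j) 0 <= B i j * y j 0 <= Num.max (B i j) 0.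
      have /andP[y0 y1] := Ix j; case: (leP (B i j) 0) => b0; apply/andP; split; nra.
    apply/andP; split; first by apply: ler_sum => j _; have /andP[] := t j.
    rewrite ltr_pwDr//; by apply: ler_sum => j _; have /andP[] := t j.
  rewrite leb_box lee_fin le_eqVlt; apply/orP; left; apply/eqP.
  apply: eq_bigr => i _; rewrite !mxE.
  have -> : \sum_j Num.max (B i j) 0 + e - \sum_j Num.min (B i j) 0 =
      \sum_j `|B i j| + 1 * e.
    rewrite mul1r addrAC -sumrB; congr (_ + _); apply: eq_bigr => j _.
    case: (leP (B i j) 0) => b0; first by rewrite sub0r ler0_norm.
    by rewrite subr0 gtr0_norm.
  by apply/max_idPl; rewrite mul1r addr_ge0 ?sumr_ge0// ltW.
have fv : vol B \is a fin_num.
  rewrite ge0_fin_numE ?vol_ge0//; apply: le_lt_trans (key 1 ltr01) _; exact: ltry.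
rewrite -(fineK fv) lee_fin; apply: (@le_prod_cvg _ _ (fun=> 1)) => n.
by rewrite -lee_fin fineK//; apply: key; rewrite invr_gt0.
Qed.

Lemma vol_fin (B : 'M[R]_d) : B \in unitmx -> vol B \is a fin_num.
Proof.
by move=> uB; rewrite ge0_fin_numE ?vol_ge0// (le_lt_trans (vol_le_rowsum uB))// ltry.
Qed.

(* Conjugating by diag(s ^ w i) scales every off-diagonal entry by s at least. *)
Lemma vol_triangular (w : 'I_d -> nat) (T : 'M[R]_d) : T \in unitmx ->
  (forall i j, i != j -> T i j != 0 -> (w j < w i)%N) ->
  (vol T <= (\prod_i `|T i i|)%:E)%E.
Proof.
move=> uT tri.
pose c i : R := \sum_(j | j != i) `|T i j|.
have key (s : R) : 0 < s <= 1 -> (vol T <= (\prod_i (`|T i i| + c i * s))%:E)%E.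
  move=> /andP[s0 s1].
  pose D (t : R) : 'M[R]_d := diag_mx (\row_i t ^+ w i).
  have DD : D s *m D s^-1 = 1%:M.
    apply/matrixP => i j; rewrite mul_diag_mx !mxE.
    have [->|ij] := eqVneq i j; last by rewrite mulr0.
    by rewrite -exprMn mulfV ?expr1n ?mulr1n// gt_eqF.
  have [uD uD'] := mulmx1_unit DD.
  (* Multiplicativity makes conjugation invisible to the volume, whatever the volume of [D s] is. *)
  have vD : (vol (D s) * vol (D s^-1%R) = 1)%E by rewrite -vol_mul// DD vol1.
  have -> : vol T = vol (D s *m T *m D s^-1).
    rewrite !vol_mul ?unitmx_mul ?uD// [(vol (D s) * _)%E]muleC -muleA vD mule1.
    by [].
  have u3 : D s *m T *m D s^-1 \in unitmx by rewrite !unitmx_mul uD uT uD'.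
  apply: le_trans (vol_le_rowsum u3) _; rewrite lee_fin; apply: ler_prod => i _.
  rewrite sumr_ge0//= (bigD1 i)//= /c mulr_suml.
  have E j : (D s *m T *m D s^-1) i j = s ^+ w i * T i j * (s^-1) ^+ w j.
    by rewrite mul_mx_diag mxE mul_diag_mx !mxE.
  apply: lerD.
    by rewrite E mulrAC -exprMn mulfV ?gt_eqF// expr1n mul1r.
  apply: ler_sum => j ji; rewrite E.
  have [->|Tij] := eqVneq (T i j) 0; first by rewrite mulr0 mul0r normr0 mul0r.
  have wij := tri i j; rewrite eq_sym ji Tij in wij; have {}wij := wij isT isT.
  rewrite !normrM mulrAC mulrC ler_wpM2l// -normrM exprVn -expfB//.
  rewrite ger0_norm ?exprn_ge0 ?(ltW s0)//.
  have [k ->] : exists k, (w i - w j)%N = k.+1 by exists (w i - w j).-1; lia.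
  by rewrite exprS ler_piMr ?exprn_ile1 ?(ltW s0)//.
rewrite -(fineK (vol_fin uT)) lee_fin; apply: (@le_prod_cvg _ _ c) => n.
rewrite -lee_fin fineK ?vol_fin//; apply: key.
by rewrite invr_gt0 ltr0n/= invf_le1 ?ltr0n// ler1n.
Qed.

End volume_bounds.

(** Only an upper bound is needed: applied to [A] and to its inverse, whose volumes multiply to 1,
    it forces equality. The bound comes from the LUP decomposition, by row sums for the permutation
    and [vol_triangular] for the two triangular factors. *)
Lemma vol_det (R : realType) (d : nat) (A : 'M[R]_d) : A \in unitmx ->
  vol A = `|\det A|%:E.
Proof.
case: d A => [|d] A uA.
  by rewrite (flatmx0 A) det_mx00 normr1 -[RHS](vol1 R 0); congr vol; apply/matrixP => -[].
suff le (B : 'M[R]_d.+1) : B \in unitmx -> (vol B <= `|\det B|%:E)%E.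
  apply/le_anti; rewrite le//=.
  have uV : invmx A \in unitmx by rewrite unitmx_inv.
  have d0 : `|\det A| != 0 by rewrite normr_eq0 -unitfE -unitmxE.
  have E : (vol A * vol (invmx A) = 1)%E by rewrite -vol_mul// mulmxV// vol1.
  have [fa fb] := (vol_fin uA, vol_fin uV).
  pose a : R := fine (vol A); pose b : R := fine (vol (invmx A)).
  have ab : a * b = 1 by apply: EFin_inj; rewrite EFinM !fineK.
  have a0 : 0 <= a by rewrite fine_ge0// vol_ge0.
  have leb : b <= `|\det A|^-1 by rewrite -lee_fin fineK// -normfV -det_inv le.
  rewrite -(fineK fa) lee_fin.
  have dp : 0 < `|\det A| by rewrite lt_neqAle eq_sym d0 normr_ge0.
  have := ler_wpM2l a0 leb; rewrite ab -(ler_pM2r dp) mul1r mulfVK//.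
move=> uB; case PLU : (cormen_lup B) => [[P L] U].
have [] := (cormen_lup_correct B, cormen_lup_perm B).
have lowL := @cormen_lup_lower _ _ B; have upU := @cormen_lup_upper _ _ B.
have dL := cormen_lup_detL B.
rewrite PLU/= in lowL upU dL * => PBE /is_perm_mxP[s Ps].
have PB : P *m B = L *m U by exact: PBE.
have uP : P \in unitmx by rewrite Ps unitmx_perm.
have uL : L \in unitmx by rewrite unitmxE dL unitr1.
have uU : U \in unitmx.
  by have : P *m B \in unitmx; [rewrite unitmx_mul uP|rewrite PB unitmx_mul uL].
have uP' : invmx P \in unitmx by rewrite unitmx_inv.
have BE : B = invmx P *m (L *m U) by rewrite -PB mulmxA mulVmx// mul1mx.
have vP : (vol (invmx P) <= 1)%E.
  apply: le_trans (vol_le_rowsum uP') _.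
  have -> : invmx P = perm_mx s^-1%g by rewrite Ps perm_mxV.
  rewrite -[leRHS]/(1%:E) lee_fin big1// => i _.
  rewrite (bigD1 (s^-1 i)%g)//= !mxE eqxx normr1 big1 ?addr0// => j ji.
  by rewrite !mxE eq_sym (negbTE ji) normr0.
have vL : (vol L <= 1)%E.
  apply: le_trans (@vol_triangular _ _ (fun i => i) L uL _) _.
    move=> i j ij; case: (ltnP j i) => // le_ij; rewrite lowL//.
    by rewrite (negbTE ij) eqxx.
  by rewrite lee_fin big1// => i _; rewrite lowL// eqxx normr1.
have vU : (vol U <= `|\det U|%:E)%E.
  apply: le_trans (@vol_triangular _ _ (fun i => d.+1 - i)%N U uU _) _.
    move=> i j ij Uij; have lt : (i < j)%N.
      rewrite ltn_neqAle ij/= leqNgt; apply: contra Uij => /upU ->.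
      by rewrite eqxx.
    by have := ltn_ord j; lia.
  rewrite -det_tr det_trig; last first.
    by apply/is_trig_mxP => i j ij; rewrite mxE upU.
  by rewrite normr_prod lee_fin; under [leRHS]eq_bigr do rewrite mxE.
have -> : `|\det B| = `|\det U|.
  rewrite BE !det_mulmx dL mul1r normrM det_inv Ps det_perm normfV normrX normrN1.
  by rewrite expr1n invr1 mul1r.
rewrite BE !vol_mul ?unitmx_mul ?uL//.
apply: le_trans vU; rewrite -[leRHS]mul1e -[X in (_ <= X * _)%E]mul1e muleA.
apply: lee_pmul => //; rewrite ?mule_ge0 ?vol_ge0//.
by apply: lee_pmul => //; exact: vol_ge0.
Qed.

Lemma measure_bigcup_count (d : measure_display) (R : realType) (T : measurableType d)
    (mu : {measure set T -> \bar R}) (K : countType) (F : K -> set T) :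
  (forall k, measurable (F k)) -> (forall x k k', F k x -> F k' x -> k = k') ->
  measurable (\bigcup_k F k) /\ mu (\bigcup_k F k) = (\esum_(k in [set: K]) mu (F k))%E.
Proof.
move=> mF disj; pose G n := oapp F set0 (pickle_inv n).
have GF k : G (pickle k) = F k by rewrite /G pickleK_inv.
have mG n : measurable (G n) by rewrite /G; case: pickle_inv => //= k.
have -> : \bigcup_k F k = \bigcup_n G n.
  apply/seteqP; split=> x [].
    by move=> k _ Fx; exists (pickle k) => //; rewrite GF.
  by move=> n _; rewrite /G; case: pickle_inv => //= k Fx; exists k.
split; first exact: bigcup_measurable.
have tG : trivIset setT G.
  move=> n n' _ _ [x []]; rewrite /G.
  case En : pickle_inv => [k|//]; case En' : pickle_inv => [k'|//]/= Fk Fk'.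
  have := @pickle_invK K n; have := @pickle_invK K n'; rewrite En En'/= => <- <-.
  by rewrite (disj _ _ _ Fk Fk').
rewrite (measure_bigcup mu)// nneseries_esum// set_mem_set.
rewrite (esumID (range (@pickle K)))// [X in (_ + X)%E]esum1 ?adde0; last first.
  move=> n [_ nK]; rewrite /G; case En : pickle_inv => [k|]; last by rewrite measure0.
  by case: nK; exists k => //; have := @pickle_invK K n; rewrite En.
rewrite setTI esum_image; last by move=> k k' _ _; exact: (pcan_inj pickleK).
by apply: eq_esum => k _; rewrite GF.
Qed.

(** * Lattices, fundamental domains and periodization *)

Section covolume.
Context (R : realType) (d : nat) (A : 'M[R]_d).
Local Notation V := (vec R d).
Local Notation leb := (@leb_outer R d).
Local Notation I := (@Icube R d).
Let mI := @measurable_Icube R d.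
Hypothesis uA : A \in unitmx.

Definition latpt (k : 'cV[int]_d) : V := lin A (intv R k).

Lemma latptD k k' : latpt (k + k') = latpt k + latpt k'.
Proof.
rewrite /latpt -linD; congr lin; apply: vecP => j.
by rewrite vecDE !intvE mxE rmorphD.
Qed.

Lemma latptN k : latpt (- k) = - latpt k.
Proof.
rewrite /latpt /lin -mulmxN; congr mulmx; apply: vecP => j.
by rewrite vecNE !intvE mxE rmorphN.
Qed.

Lemma latpt0 : latpt 0 = 0.
Proof. by rewrite -(subrr (0 : 'cV[int]_d)) latptD latptN subrr. Qed.

Lemma latpt_inj : injective latpt.
Proof.
move=> k k' /(congr1 (lin (invmx A))); rewrite !linK// => kk.
apply/matrixP => j l; rewrite (ord1 l).
by have := congr1 (fun v : V => v j 0) kk; rewrite !intvE => /intr_inj.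
Qed.

Definition fundom : set V := lin (invmx A) @^-1` I.

Lemma measurable_shift (S : set V) (v : V) : measurable S ->
  measurable ((fun x : V => x + v) @^-1` S).
Proof. by move=> mS; apply: measurable_pre mS; exact: measurable_addv. Qed.

Lemma measurable_fundom : measurable fundom.
Proof. by apply: measurable_pre => //; exact: measurable_lin. Qed.

Lemma leb_fundom : leb fundom = `|\det A|%:E.
Proof. exact: vol_det. Qed.

Lemma fundom_cover (x : V) : exists k, fundom (x + latpt k).
Proof.
pose y := lin (invmx A) x; exists (\col_j - Num.floor (y j 0)) => j.
rewrite linD linK// vecDE -/y intvE [X in X%:~R]mxE mulrNz.
have := floor_itv (y j 0); rewrite intrD => /andP[h1 h2].
by apply/andP; split; lra.
Qed.

Lemma fundom_disj (x : V) k k' : fundom (x + latpt k) -> fundom (x + latpt k') -> k = k'.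
Proof.
rewrite /fundom /= !linD !linK// => Ik Ik'; apply/matrixP => j l; rewrite (ord1 l).
have := Ik j; have := Ik' j; rewrite !vecDE !intvE; set y := lin _ _ _ _.
move=> /andP[h1 h2] /andP[h3 h4].
have lt1 : (k j 0)%:~R < ((k' j 0) + 1)%:~R :> R by rewrite intrD; lra.
have lt2 : (k' j 0)%:~R < ((k j 0) + 1)%:~R :> R by rewrite intrD; lra.
by move: lt1 lt2; rewrite !ltr_int; lia.
Qed.

Lemma leb_fundom_sum (S : set V) : measurable S ->
  leb S = (\esum_(k in [set: 'cV[int]_d]) leb (S `&` [set x : V | fundom (x + latpt k)%R]))%E.
Proof.
move=> mS.
have [|x k k' [_ /= h] [_ /= h']|_ <-] := @measure_bigcup_count _ R _ leb _
    (fun k => S `&` [set x : V | fundom (x + latpt k)%R]).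
- by move=> k; apply: measurableI => //; apply: measurable_shift; exact: measurable_fundom.
- exact: fundom_disj h h'.
- congr leb; apply/seteqP; split=> x; last by case=> k _ [].
  by have [k xk] := fundom_cover x => Sx; exists k.
Qed.

Lemma leb_fundom_shift (S : set V) k :
  leb (fundom `&` [set x : V | S (x - latpt k)%R]) = leb (S `&` [set x : V | fundom (x + latpt k)%R]).
Proof.
rewrite -(leb_translate _ (latpt k)); congr leb.
by apply/seteqP; split=> x /=; rewrite addrK => -[].
Qed.

Definition periodization (S : set V) : set V := [set x | exists k, S (x - latpt k)].

Lemma leb_periodization (S : set V) : measurable S ->
  (forall x k k', S (x - latpt k) -> S (x - latpt k') -> k = k') ->
  measurable (periodization S) /\ leb (fundom `&` periodization S) = leb S.
Proof.
move=> mS disj.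
have mSk k : measurable [set x : V | S (x - latpt k)] by exact: (measurable_shift (- _)).
have perE : periodization S = \bigcup_k [set x : V | S (x - latpt k)].
  by apply/seteqP; split=> x [k]; [exists k|exists k].
split.
  by rewrite perE; have [] := @measure_bigcup_count _ R _ leb _ _ mSk disj.
have [||_ sumE] := @measure_bigcup_count _ R _ leb _
    (fun k => fundom `&` [set x : V | S (x - latpt k)%R]).
- by move=> k; apply: measurableI => //; exact: measurable_fundom.
- by move=> x k k' [_ h] [_ h']; exact: disj h h'.
rewrite perE setI_bigcupr [LHS]sumE leb_fundom_sum//.
by apply: eq_esum => k _; exact: leb_fundom_shift.
Qed.

(** The complement of the periodization is invariant under the lattice, so it is null as soon as it
    is null in one cell. There it misses exactly the volume of [S], by unfolding. *)
Lemma periodization_conull (S : set V) : measurable S ->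
  (forall x k k', S (x - latpt k) -> S (x - latpt k') -> k = k') ->
  leb (~` periodization S) = 0%E <-> leb S = `|\det A|%:E.
Proof.
move=> mS disj; have [mP PE] := leb_periodization mS disj.
have mD := measurable_fundom.
have decomp : leb fundom = (leb (fundom `\` periodization S) + leb S)%E.
  by rewrite -PE -(measureDI leb).
have shiftP k : leb (fundom `&` ~` periodization S) =
    leb (~` periodization S `&` [set x : V | fundom (x + latpt k)%R]).
  rewrite -leb_fundom_shift; congr (leb (_ `&` _)); apply/seteqP; split=> x /= nP [l Sl]; apply: nP.
    by exists (k + l); rewrite latptD opprD addrA.
  by exists (l - k); rewrite latptD latptN opprB addrA subrK.
rewrite -leb_fundom decomp setDE; split=> [P0|SE].
  rewrite (_ : leb (_ `&` _) = 0%E) ?add0e//; apply/le_anti.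
  by rewrite measure_ge0 andbT -P0; apply: le_outer_measure => x [].
rewrite leb_fundom_sum; last exact: measurableC.
apply: esum1 => k _; rewrite -shiftP.
have fS : leb S \is a fin_num.
  by rewrite ge0_fin_numE// SE -setDE -decomp leb_fundom ltry.
by have := congr1 (fun z => z - leb S)%E SE; rewrite addeK// subee.
Qed.

End covolume.

(** * Tilings and spectra *)

Section tiles.
Context (R : realType) (d : nat).
Local Notation V := (vec R d).
Local Notation leb := (@leb_outer R d).
Local Notation I := (@Icube R d).
Let mI := @measurable_Icube R d.

Lemma translateE (A : set V) (t : V) : translate A t = [set x | A (x - t)].
Proof.
apply/seteqP; split=> x; first by case=> y Ay <- /=; rewrite addrK.
by move=> /= Ax; exists (x - t) => //; rewrite subrK.
Qed.

Lemma box_not_null (a b : V) (N : set V) : (forall j, a j 0 < b j 0) ->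
  box a b `<=` N -> leb N <> 0%E.
Proof.
move=> ab sN N0; have := le_outer_measure leb _ _ sN; rewrite /= N0 leb_box lee_fin leNgt.
by rewrite prodr_gt0// => j _; rewrite lt_max subr_gt0 ab.
Qed.

Definition cubes_disjoint (X : set V) : Prop :=
  forall x i k, X i -> X k -> I (x - i) -> I (x - k) -> i = k.

Lemma keller_cubes_disjoint (X : set V) : keller_family X id -> cubes_disjoint X.
Proof.
move=> kX x i k Xi Xk /icubeP xi /icubeP xk; apply: contrapT => ik.
have [j [ji ne]] := kX i k Xi Xk ik.
have /intrP[z zE] := ji; have := xi j; have := xk j => /andP[h1 h2] /andP[h3 h4].
have lt1 : z%:~R < 1%:~R :> R by rewrite -zE; lra.
have lt2 : (-1)%:~R < z%:~R :> R by rewrite -zE; lra.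
rewrite !ltr_int in lt1 lt2; apply: ne; apply/eqP; rewrite -subr_eq0 zE.
by rewrite (_ : z = 0)//; lia.
Qed.

Lemma cubes_disjoint_null (X : set V) t t' : cubes_disjoint X ->
  X t -> X t' -> t <> t' -> Defs.null_set (translate I t `&` translate I t').
Proof.
move=> dX Xt Xt' tt'; rewrite /Defs.null_set !translateE.
rewrite (_ : _ `&` _ = set0) ?outer_measure0//.
by apply/seteqP; split=> // x [/= xt xt']; apply: tt'; exact: (dX x).
Qed.

(** Half-open cubes sharing a point [x] also share a box with lower corner [x], so a null
    intersection is empty. *)
Lemma is_tile_disjoint (X : set V) : is_tile I X -> cubes_disjoint X.
Proof.
move=> [_ null2] x i k Xi Xk /icubeP xi /icubeP xk; apply: contrapT => ik.
pose b : V := \col_j Num.min (i j 0 + 1) (k j 0 + 1).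
apply: (@box_not_null x b _ _ _ (null2 i k Xi Xk ik)).
  by move=> j; rewrite mxE lt_min; have /andP[_ ->] := xi j; have /andP[_ ->] := xk j.
move=> y xby; rewrite !translateE; split; apply/icubeP => j;
  have := xby j; rewrite mxE lt_min => /andP[h1 /andP[h2 h3]];
  have /andP[h4 _] := xi j; have /andP[h5 _] := xk j; apply/andP; split=> //; lra.
Qed.

(* Cubes that come near [x] are told apart by the sign pattern of
   [i j 0 > x j 0], so only finitely many matter and they avoid a box at [x]. *)
Lemma is_tile_cover (X : set V) : is_tile I X -> forall x, exists2 i, X i & I (x - i).
Proof.
move=> tX x; apply: contrapT => nx; have dX := is_tile_disjoint tX.
(* Corners with the same pattern differ by less than 1 in every coordinate, so their coordinatewise
   maximum lies in both cubes: at most one corner per pattern. *)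
pose near (S : {set 'I_d}) (i : V) := X i /\
  forall j, x j 0 - 1 < i j 0 < x j 0 + 1 /\ (j \in S) = (x j 0 < i j 0).
have near_uniq S i k : near S i -> near S k -> i = k.
  move=> [Xi Si] [Xk Sk].
  pose y : V := \col_j Num.max (i j 0) (k j 0).
  apply: (dX y) => //; apply/icubeP => j; rewrite mxE le_max lexx ?orbT/= gt_max;
    have [/andP[h1 h2] e1] := Si j; have [/andP[h3 h4] e2] := Sk j;
    rewrite e1 in e2; case: ltP e2 => h5 /esym; case: ltP => // h6 _;
    apply/andP; split; lra.
have /choice[e eP] (S : {set 'I_d}) : exists e : R, 0 < e /\
    forall i, near S i -> exists j, x j 0 + e <= i j 0.
  have [[i Si]|nS] := pselect (exists i, near S i); last first.
    by exists 1; split=> [|i Si]; [exact: ltr01|case: nS; exists i].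
  have [j ij] : exists j, x j 0 < i j 0.
    apply: contrapT => nj; apply: nx; exists i; first exact: Si.1.
    apply/icubeP => j; have [/andP[h1 h2] _] := Si.2 j.
    rewrite leNgt; apply/andP; split; last by lra.
    by apply/negP => h; apply: nj; exists j.
  exists (i j 0 - x j 0); rewrite subr_gt0; split=> // k Sk; exists j.
  by rewrite (near_uniq _ _ _ Sk Si) addrC subrK.
(* The default 1 matters: it forces every cube meeting the box to have its corner within 1 of [x],
   as [near] demands. *)
pose e0 : R := \big[Num.min/1]_S e S.
have e0_gt0 : 0 < e0 by apply: lt_bigmin => [|S _]; [exact: ltr01|have [] := eP S].
pose b : V := \col_j (x j 0 + e0).
apply: (@box_not_null x b _ _ _ tX.1) => [j|y xby [i Xi]].
  by rewrite mxE ltrDl.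
rewrite translateE => /icubeP yi.
pose S : {set 'I_d} := [set j | x j 0 < i j 0]%SET.
have e01 : e0 <= 1 by exact: bigmin_le_id.
have [j xj] : exists j, x j 0 + e S <= i j 0.
  apply: (eP S).2; split=> // j; rewrite inE; split=> //.
  have := yi j; have := xby j; rewrite mxE => /andP[h1 h2] /andP[h3 h4].
  by apply/andP; split; lra.
have : e0 <= e S by exact: bigmin_le.
have := yi j; have := xby j; rewrite mxE => /andP[h1 h2] /andP[h3 h4]; lra.
Qed.

Lemma is_tileP (X : set V) : is_tile I X <-> exact_tiling X id.
Proof.
split=> [tX|[cov disj]].
  by split; [exact: is_tile_cover|exact: is_tile_disjoint].
split=> [|t t' Xt Xt' tt'].
  rewrite /Defs.null_set (_ : ~` _ = set0) ?outer_measure0//; apply/seteqP; split=> // x nx.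
  by have [i Xi xi] := cov x; apply: nx; exists i => //; rewrite translateE.
exact: cubes_disjoint_null disj Xt Xt' tt'.
Qed.

Lemma esum_indic_cubes (K : choiceType) (X : set K) (p : K -> V) (x : V) :
  (forall i k, X i -> X k -> I (x - p i) -> I (x - p k) -> i = k) ->
  (\esum_(i in X) (\1_I (x - p i))%:E)%E = (`[< exists2 i, X i & I (x - p i) >]%:R)%:E :> \bar R.
Proof.
move=> disj; case: asboolP => [[i Xi xi]|nx].
  rewrite (esumID [set i]); last by move=> *; rewrite lee_fin.
  rewrite setIidr; last by move=> _ ->.
  rewrite esum_set1 ?lee_fin// indicE mem_set// esum1 ?adde0// => k [Xk /= ik].
  rewrite indicE memNset// => xk; apply: ik; exact: disj.
by rewrite esum1// => i Xi; rewrite indicE memNset// => xi; apply: nx; exists i.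
Qed.

Lemma indic_packing (K : choiceType) : packing K (\1_I : V -> R).
Proof.
split=> [x|X p kX x]; first by rewrite indicE ler0n.
rewrite esum_indic_cubes ?lee_fin ?lern1 ?leq_b1// => i k Xi Xk xi xk.
apply: contrapT => ik; have [j kj] := kX i k Xi Xk ik.
have kp : keller_family [set p i; p k] id.
  move=> a b [->|->] [->|->] // _; first by exists j.
  exists j; case: kj => kj ne; split; last exact/nesym.
  by rewrite -opprB rpredN.
by case: kj => _ []; rewrite (keller_cubes_disjoint kp _ _ xi xk)//; [left|right].
Qed.

Lemma indic_lattice_sum (x : V) :
  (\esum_(k in [set: 'cV[int]_d]) (\1_I (x - @intv R d k))%:E = 1 :> \bar R)%E.
Proof.
have latE k : latpt 1%:M (- k) = - @intv R d k by rewrite latptN /latpt /lin mul1mx.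
have domE y : fundom 1%:M y = I y by rewrite /fundom /= /lin invmx1 mul1mx.
rewrite esum_indic_cubes.
  have [k] := fundom_cover (unitmx1 _ _) x; rewrite -[k]opprK latE domE => xk.
  by rewrite asboolT//; exists (- k).
move=> k k' _ _; rewrite -!latE -!domE => xk xk'.
exact/oppr_inj/(fundom_disj (unitmx1 _ _) xk xk').
Qed.

Lemma exact_tilingP (X : set V) : exact_tiling X id <->
  keller_family X id /\ forall k, exists2 i, X i & ceilv i = k.
Proof.
have sumP : keller_family X id ->
    (forall x, (\esum_(i in X) (\1_I (x - i))%:E = 1 :> \bar R)%E) <->
    (forall k, exists2 i, X i & ceilv i = k).
  move=> kX; apply: packing_sum1P => //; first exact: indic_packing.
    by rewrite indicE mem_set//; exact: Icube0.
  exact: indic_lattice_sum.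
split=> [tX|[kX /(sumP kX) sum1]].
  have kX := exact_tiling_keller tX; split=> //; apply/(sumP kX) => x.
  rewrite esum_indic_cubes; last exact: tX.2.
  by rewrite asboolT//; exact: tX.1.
have dX := keller_cubes_disjoint kX; split=> // x.
have := sum1 x; rewrite esum_indic_cubes; last exact: dX.
by case: asboolP => //= _ [] /esym/eqP; rewrite oner_eq0.
Qed.

Lemma spectral_pairP (X : set V) : spectral_pair I X <->
  keller_family X id /\ forall k, exists2 i, X i & ceilv i = k.
Proof.
have W0 : 0 < sincW (0 : V) by rewrite sincW0 ltr01.
have sumP (kX : keller_family X id) :=
  packing_sum1P (@sincW_packing R d V) kX W0 (@sincW_lattice_sum R d).
have kellerP : (forall lam mu, X lam -> X mu -> lam <> mu ->
    orth_exp I (ecos mu) (esin mu) lam) <-> keller_family X id.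
  have orthP (lam mu : V) : orth_exp I (ecos mu) (esin mu) lam <->
      exists j, keller_coord mu lam j.
    rewrite -sincW_eq0 -cosI_sinI (orth_exp_ip _ (sq2_expE mu)) ipEE ipEJ.
    split=> [[-> ->]|/eqP]; first by rewrite !expr0n/= addr0.
    by rewrite paddr_eq0 ?sqr_ge0// !sqrf_eq0 => /andP[/eqP-> /eqP->].
  split=> h i k Xi Xk ik; first by apply/orthP/h => //; exact/nesym.
  by apply/orthP/h => //; exact/nesym.
split=> [[/kellerP kX compl]|[kX /(sumP kX) sum1]].
  by split=> //; apply/(sumP kX); exact: complete_parseval.
by split; [exact/kellerP|exact: parseval_complete].
Qed.

Lemma spectral_pair_tile (X : set V) : spectral_pair I X <-> is_tile I X.
Proof. by rewrite is_tileP spectral_pairP exact_tilingP. Qed.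

Section lattice_tile.
Context (A : 'M[R]_d) (E : seq V).
Hypotheses (uA : A \in unitmx) (uE : uniq E).
Hypothesis latE : lattice A `&` diffset [set` E] [set` E] = [set 0].
Local Notation L := (sumset (lattice A) [set` E]).

Lemma sumset_lattice_inj k k' (e e' : V) : e \in E -> e' \in E ->
  latpt A k + e = latpt A k' + e' -> k = k' /\ e = e'.
Proof.
move=> Ee Ee' ee'.
have eE : e - e' = latpt A (k' - k).
  by rewrite latptD latptN; apply/eqP; rewrite subr_eq addrAC -ee' addrAC subrr add0r.
have : (lattice A `&` diffset [set` E] [set` E]) (e - e').
  by split; [exists (k' - k)|exists e, e'].
rewrite latE => /= ee0; have ee := subr0_eq ee0; split=> //.
by apply: (latpt_inj uA); apply: (addIr e); rewrite ee' ee.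
Qed.

Let cubes : set V := \bigcup_(e in [set` E]) [set x | I (x - e)].

Let periodization_cubes : periodization A cubes = \bigcup_(t in L) translate I t.
Proof.
apply/seteqP; split=> x.
  move=> [k [e Ee xe]]; exists (latpt A k + e); last by rewrite translateE /= opprD addrA.
  by exists (latpt A k), e; split; [exists k|].
move=> [_ [_ [e [[k ->] [Ee ->]]]]]; rewrite translateE /= => xke.
by exists k, e => //=; rewrite -addrA -opprD.
Qed.

(** The union of the cubes at [E] has volume [size E], and its periodization is the union of all the
    cubes; the trivial intersection of the lattice with [E - E] keeps distinct representations
    apart. *)
Lemma lattice_tile_size : cubes_disjoint L ->
  Defs.null_set (~` \bigcup_(t in L) translate I t) <-> (size E)%:R = `|\det A|.
Proof.
move=> dL.
have Lke k (e : V) : e \in E -> L (latpt A k + e).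
  by move=> Ee; exists (latpt A k), e; split; [exists k|].
have mcube (e : V) : measurable [set x : V | I (x - e)] by exact: (measurable_shift (- e)).
have lebcube (e : V) : leb [set x : V | I (x - e)%R] = 1%E.
  by rewrite -(leb_Icube R d) -[RHS](leb_translate I (- e)).
have mC : measurable cubes by apply: fin_bigcup_measurable => // e _; exact: mcube.
have lebC : leb cubes = (size E)%:R%:E.
  rewrite (measure_fin_bigcup leb)//.
    rewrite -fsbig_seq//.
    rewrite (eq_bigr (fun=> 1%:E)) => [|e _]; last exact: lebcube.
    by rewrite sumEFin big_const_seq count_predT iter_addr_0.
    exact: finite_seq.
  move=> e e' Ee Ee' [x [/= xe xe']].
  have [] // := @sumset_lattice_inj 0 0 e e' Ee Ee'.
  by apply: (dL x); rewrite ?latpt0 ?add0r//; [rewrite -[e]add0r -(latpt0 A)|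
    rewrite -[e']add0r -(latpt0 A)]; exact: Lke.
rewrite -periodization_cubes /Defs.null_set (periodization_conull uA mC).
  by rewrite lebC; split=> [[]|->].
move=> x k k' [e Ee xe] [e' Ee' xe'].
have [] // := @sumset_lattice_inj k k' e e' Ee Ee'.
apply: (dL x); [exact: Lke|exact: Lke| |];
  by rewrite opprD addrA.
Qed.

(** As the lattice is a group, the differences of two points of [L] are exactly the points of the
    lattice plus [E - E]. *)
Lemma keller_lattice : keller_family L id <->
  sumset (lattice A) (diffset [set` E] [set` E]) `<=` @ZI R d `|` [set 0].
Proof.
split=> [kL _ [_ [_ [[k ->] [[e [e' [Ee [Ee' ->]]]] ->]]]]|sZ].
  rewrite -[A *m _]/(latpt A k) addrA.
  have [->|ne] := eqVneq (latpt A k + e) e'; first by right; rewrite subrr.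
  left; have [|||j [ji ne']] := kL (latpt A k + e) e'.
  - by exists (latpt A k), e; split; [exists k|].
  - exists 0, e'; split; last by rewrite add0r.
    by exists 0; rewrite -(latpt0 A).
  - exact/eqP.
  have zj : (latpt A k + e - e') j 0 <> 0 by rewrite vecDE vecNE => /subr0_eq.
  split; first by move=> z0; apply: zj; rewrite z0.
  by exists j; split=> //; rewrite vecDE vecNE.
move=> _ _ [_ [e [[k ->] [Ee ->]]]] [_ [e' [[k' ->] [Ee' ->]]]].
rewrite -[A *m map_mx _ k]/(latpt A k) -[A *m map_mx _ k']/(latpt A k') => ne.
have : (@ZI R d `|` [set 0]) (latpt A (k - k') + (e - e')).
  by apply: sZ; exists (latpt A (k - k')), (e - e'); split; [exists (k - k')|split=> //; exists e, e'].
have -> : latpt A (k - k') + (e - e') = (latpt A k + e) - (latpt A k' + e').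
  by rewrite latptD latptN opprD addrACA.
case=> [[_ [j [ji ne']]]|/= /subr0_eq//].
exists j; rewrite vecDE vecNE in ji ne'; split=> // E0; apply: ne'.
by rewrite E0 subrr.
Qed.

End lattice_tile.
End tiles.

Theorem theorem4p2 (R : realType) (d : nat) (Rm : 'M[R]_d) (E : seq (vec R d)) :
  Rm \in unitmx -> uniq E ->
  lattice Rm `&` diffset [set` E] [set` E] = [set 0] ->
  (spectral_pair (@Icube R d) (sumset (lattice Rm) [set` E]) <->
     is_tile (@Icube R d) (sumset (lattice Rm) [set` E])) /\
  (is_tile (@Icube R d) (sumset (lattice Rm) [set` E]) <->
     ((size E)%:R = `|\det Rm| /\
      sumset (lattice Rm) (diffset [set` E] [set` E]) `<=` @ZI R d `|` [set 0])).
Proof.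
move=> uR uE latE; split; first exact: spectral_pair_tile.
split=> [tL|[sizeE /keller_lattice kL]].
  have dL := is_tile_disjoint tL; split.
    by apply/(lattice_tile_size uR uE latE dL); exact: tL.1.
  by apply/keller_lattice; apply: exact_tiling_keller; exact/is_tileP.
have dL := keller_cubes_disjoint kL; split.
  exact/(lattice_tile_size uR uE latE dL).
by move=> t t' Lt Lt' tt'; exact: cubes_disjoint_null dL Lt Lt' tt'.
Qed.
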